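(* Let $f$ be holomorphic on the open unit disk $\Delta$, let $0<r<1$ and $K=\overline\Delta_r=\{z:|z|\le r\}$. For $n\ge0$ let $N_K(n,1)$ denote the maximal number (possibly $+\infty$) of zeros on $K$ of functions $f-p$ with $p\in\mathcal R_{n1}$. If $\lim_{n\to\infty}N_K(n,1)/n=\infty$, then either $f$ extends to an entire function, or $f=P/Q$ on $\Delta$, where $P,Q$ are polynomials, $\deg Q=1$ and $Q$ does not divide $P$.
   Context: $\mathcal P_n$ is the space of complex polynomials of degree at most $n$; $\mathcal R_{nm}$ is the set of rational functions $P_n/Q_m$ with $P_n\in\mathcal P_n$, $Q_m\in\mathcal P_m$, $Q_m\not\equiv0$. Zeros are counted with multiplicity. *)

(* Defs.v *)
From HB Require Import structures.
From mathcomp Require Import all_boot all_order all_algebra.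
From mathcomp Require Import all_classical all_reals all_analysis.
From mathcomp Require Export complex.
Set Implicit Arguments. Unset Strict Implicit. Unset Printing Implicit Defensive.
Import Order.TTheory GRing.Theory Num.Theory.
Import numFieldNormedType.Exports.
Local Open Scope ring_scope.

Section Defs.
Variable R : realType.
Local Notation C := (R[i]).

(* complex differentiability at z (derivative in direction 1, with complex
   increments h : C) *)
Definition cdiff (f : C -> C) (z : C) : Prop :=
  derivable (f : C^o -> C^o) z 1.

Definition holo_disk (f : C -> C) : Prop :=
  forall z : C, `|z| < 1 -> cdiff f z.

Definition entire (F : C -> C) : Prop := forall z : C, cdiff F z.

Definition zero_order_ge (f : C -> C) (P Q : {poly C}) (z : C) (m : nat) : Prop :=
  exists2 e : R, 0 < e &
  exists g : C -> C,
    (forall w : C, `|w - z| < (e%:C)%C -> cdiff g w) /\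
    (forall w : C, `|w - z| < (e%:C)%C -> `|w| < 1 -> Q.[w] != 0 ->
        f w - P.[w] / Q.[w] = (w - z) ^+ m * g w).

Definition has_zeros_ge (f : C -> C) (r : R) (P Q : {poly C}) (k : nat) : Prop :=
  exists (s : seq C) (m : C -> nat),
    [/\ uniq s,
        (forall z, z \in s -> `|z| <= (r%:C)%C),
        (forall z, z \in s -> zero_order_ge f P Q z (m z)) &
        (k <= \sum_(z <- s) m z)%N].

Definition in_R_n1 (n : nat) (P Q : {poly C}) : Prop :=
  [/\ (size P <= n.+1)%N, (size Q <= 2)%N & Q != 0].

Definition NK1 (f : C -> C) (r : R) (n : nat) : \bar R :=
  ereal_sup [set ((k%:R)%:E : \bar R) | k in
     [set k : nat | exists P Q : {poly C}, in_R_n1 n P Q /\ has_zeros_ge f r P Q k]].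

End Defs.

(* Main.v *)
(** Suppose that [f - P/Q] has N zeros in [|z| <= r], with [Q = al z + be].  A Blaschke
    product gives [|h| <= theta^N sup_(|z| <= T) |h|] on [|z| <= r] for [h = Q f - P],
    where [r < T < 1] and [theta < 1].  Write [f = a_0 + ... + a_(n-1) z^(n-1) + z^n f_n].
    The part of [h] of degree at most n is controlled by [h] on [|z| <= r], so if N / n is
    large then the first coefficients of [u = al f_n + be f_(n+1)] are at most
    [d^n sup_(|z| <= T) |u|], with d as small as we like.

    Call n good when [sup_(|z| <= T) |f_(n+1)| <= D^n |a_n|]; there are always infinitely
    many good n.  At a good n the smallness of [u] makes [a_n], [a_(n+1)], [a_(n+2)] almost
    geometric, and this spreads goodness to all large n.  Hence [a_(n+1) / a_n] converges
    to some [l <> 0] faster than any geometric sequence.  The coefficients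
    [e_n = a_(n+1) - l a_n] of [(1 - l z) f] cannot be nonzero infinitely often: at good n
    for this new function the same estimate forces [|e_(n+1)| >= c |e_n|], whereas
    [e_n / a_n] decays superexponentially.  So [(1 - l z) f] is a polynomial, unless [f] is.

    The function theory starts from mere complex differentiability.  Goursat's argument on
    midpoint sums along squares yields the maximum principle, and the maximum principle
    applied to difference quotients yields removability and Taylor expansions. *)

Require Import Defs.
From HB Require Import structures.
From mathcomp Require Import all_boot all_order all_algebra.
From mathcomp Require Import all_classical all_reals all_analysis.
From mathcomp Require Import complex ring lra zify.
Import Order.TTheory GRing.Theory Num.Theory.
Import numFieldNormedType.Exports.
Local Open Scope classical_set_scope.
Local Open Scope ring_scope.
Set Implicit Arguments. Unset Strict Implicit. Unset Printing Implicit Defensive.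

(** The denominators Q for different n are unrelated, so the pair (al, be) must be eliminated at
    each n separately. The first two coefficients of u are small for the same pair, which makes the
    Hankel determinant a_n a_(n+2) - a_(n+1)^2 small; this is how deg Q <= 1 enters. The obstacle is
    that the smallness is relative to sup |u|, which involves whole tails of f, whereas ratios of
    coefficients need it relative to one coefficient. Goodness exchanges a tail for a coefficient at
    the price D^n, and such a price is always affordable because d is chosen after D. Good ranks are
    at first only known to be infinitely many. They spread upwards from a rank where |a_(n+1) / a_n|
    is not too small, and downwards from ranks where this ratio is very small; one of the two
    situations occurs often enough. For (1 - l z) f no new hypothesis is needed, since al f_n + be
    f_(n+1) is also a combination of f_n and the corresponding tail of the new function. *)

Definition nm {R : realType} (z : R[i]) : R := ComplexField.Normc.normc z.

(** * The modulus with real values, within reach of linear arithmetic over [R] *)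

Section Modulus.
Variable R : realType.
Local Notation C := R[i].
Implicit Types (x y z : C) (a : R).

Lemma normr_nm z : `|z| = (nm z)%:C%C. Proof. by []. Qed.

Lemma real_complexM a b : (a * b)%:C%C = a%:C%C * b%:C%C :> C.
Proof. exact: rmorphM. Qed.

Lemma nm_ge0 z : 0 <= nm z. Proof. by case: z => a b; exact: sqrtr_ge0. Qed.

Lemma nmM x y : nm (x * y) = nm x * nm y.
Proof. exact: ComplexField.Normc.normcM. Qed.

Lemma nmV x : nm x^-1 = (nm x)^-1.
Proof. exact: ComplexField.Normc.normcV. Qed.

Lemma nm0 : nm (0 : C) = 0. Proof. exact: ComplexField.Normc.normc0. Qed.

Lemma nm1 : nm (1 : C) = 1. Proof. exact: ComplexField.Normc.normc1. Qed.

Lemma nm_eq0 z : (nm z == 0) = (z == 0).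
Proof.
apply/eqP/eqP => [|->]; last exact: nm0.
exact: ComplexField.Normc.eq0_normc.
Qed.

Lemma nm_gt0 z : (0 < nm z) = (z != 0).
Proof. by rewrite lt_neqAle nm_ge0 andbT eq_sym nm_eq0. Qed.

Lemma nmN x : nm (- x) = nm x.
Proof. by have /complexI := normrN x. Qed.

Lemma nmB x y : nm (x - y) = nm (y - x). Proof. by rewrite -nmN opprB. Qed.

Lemma nmD x y : nm (x + y) <= nm x + nm y.
Proof. by have := ler_normD x y; rewrite !normr_nm -rmorphD lecR. Qed.

Lemma nm_triB x y : nm (x - y) <= nm x + nm y.
Proof. by rewrite -(nmN y) nmD. Qed.

Lemma nm_triB2 x y : nm x - nm y <= nm (x - y).
Proof. by have := nmD (x - y) y; rewrite subrK; lra. Qed.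

Lemma nm_dist_tri z x y : nm (x - y) <= nm (x - z) + nm (z - y).
Proof. by rewrite (_ : x - y = (x - z) + (z - y)) ?nmD//; ring. Qed.

Lemma nmX x n : nm (x ^+ n) = nm x ^+ n.
Proof. by elim: n => [|n IH]; rewrite ?expr0 ?nm1// !exprS nmM IH. Qed.

Lemma nm_sqr z : nm z ^+ 2 = complex.Re z ^+ 2 + complex.Im z ^+ 2.
Proof. by case: z => a b; rewrite sqr_sqrtr// addr_ge0 ?sqr_ge0. Qed.

Lemma nm_real a : nm a%:C%C = `|a|.
Proof. by rewrite /nm /= expr0n addr0 sqrtr_sqr. Qed.

Lemma nm_ge_Re z : `|complex.Re z| <= nm z.
Proof. by rewrite -ler_sqr ?nnegrE ?nm_ge0// nm_sqr real_normK ?num_real// lerDl sqr_ge0. Qed.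

Lemma nm_ge_Im z : `|complex.Im z| <= nm z.
Proof. by rewrite -ler_sqr ?nnegrE ?nm_ge0// nm_sqr real_normK ?num_real// lerDr sqr_ge0. Qed.

Lemma nm_i : nm ('i : C)%C = 1.
Proof. by rewrite /nm /= expr0n add0r expr1n sqrtr1. Qed.

Lemma nm_le_ReIm z : nm z <= `|complex.Re z| + `|complex.Im z|.
Proof.
rewrite (_ : z = (complex.Re z)%:C%C + 'i%C * (complex.Im z)%:C%C); last exact: complexE.
by rewrite (le_trans (nmD _ _))// nmM nm_i mul1r !nm_real -complexE.
Qed.

(** The order of [R[i]] only relates numbers with equal imaginary parts, so a positive complex
    radius is a positive real. *)
Lemma gt0_realE z : 0 < z -> z = (complex.Re z)%:C%C /\ 0 < complex.Re z.
Proof.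
by case: z => u v; rewrite ltcE /= => /andP[/eqP -> ->].
Qed.

Lemma nm_prod (I : Type) (s : seq I) (F : I -> C) :
  nm (\prod_(i <- s) F i) = \prod_(i <- s) nm (F i).
Proof.
elim: s => [|i s IH]; first by rewrite !big_nil nm1.
by rewrite !big_cons nmM IH.
Qed.

End Modulus.

(** * Complex differentiability in epsilon-delta form *)

Section Differentiability.
Variable R : realType.
Local Notation C := R[i].
Implicit Types (f g : C -> C) (z w d : C).

(** Multiplied out by the distance, so that w = z is not excluded and no quotient appears. *)
Definition cderiv f z d := forall e : R, 0 < e -> exists2 r : R, 0 < r &
  forall w, nm (w - z) < r -> nm (f w - f z - d * (w - z)) <= e * nm (w - z).

Definition ccont f z := forall e : R, 0 < e -> exists2 r : R, 0 < r &
  forall w, nm (w - z) < r -> nm (f w - f z) < e.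

Lemma nbhs_nm (A : set C) z :
  nbhs (z : C^o) A <-> exists2 r : R, 0 < r & forall w, nm (w - z) < r -> A w.
Proof.
split=> [/nbhs_ballP[e /= e0 he]|[r r0 hr]]; last apply/nbhs_ballP.
- have [eE e0'] := gt0_realE e0; exists (complex.Re e) => //.
  move=> w hw; apply: he; rewrite eE; change (`|z - w| < (complex.Re e)%:C%C).
  by rewrite normr_nm ltcR nmB.
- exists r%:C%C; first by rewrite /= ltcR.
  move=> w; change (`|z - w| < r%:C%C -> A w).
  by rewrite normr_nm ltcR nmB; exact: hr.
Qed.

Lemma cdiffP f z : cdiff f z <-> exists d, cderiv f z d.
Proof.
rewrite /cdiff /derivable; split.
- move=> /cvg_ex[/= d hd]; exists d => e e0.
  have /cvgrPdist_le/(_ e%:C%C) := hd.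
  rewrite ltcR => /(_ e0) /nbhs_nm[r r0 hr]; exists r => // w hw.
  have [->|wz] := eqVneq w z; first by rewrite !subrr mulr0 subrr nm0 mulr0.
  have h0 : w - z != 0 by rewrite subr_eq0.
  have := hr (w - z); rewrite subr0 => /(_ hw h0) /=.
  rewrite /= /shift /= [_ *: 1](mulr1 (w - z)) subrK normr_nm lecR => hh.
  rewrite (_ : f w - f z - _ = - ((w - z) * (d - (w - z)^-1 * (f w - f z)))); last by field.
  by rewrite nmN nmM mulrC ler_wpM2r ?nm_ge0.
- move=> [d hd]; apply/cvg_ex; exists d; apply/cvgrPdist_le => e e0.
  have [eE e0'] := gt0_realE e0.
  have [r r0 hr] := hd _ e0'.
  apply/nbhs_nm; exists r => // h; rewrite subr0 => hw h0 /=.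
  rewrite eE /= /shift /= [_ *: 1](mulr1 h) normr_nm lecR.
  suff hh : nm (d - h^-1 * (f (h + z) - f z)) <= complex.Re e by exact: hh.
  have := hr (h + z); rewrite addrK => /(_ hw).
  rewrite (_ : d - _ = - (h^-1 * (f (h + z) - f z - d * h))); last by field.
  by rewrite nmN nmM nmV ler_pdivrMl ?nm_gt0// [nm h * _]mulrC.
Qed.

End Differentiability.

Section Calculus.
Variable R : realType.
Local Notation C := R[i].
Implicit Types (f g : C -> C) (z w d p : C).

Lemma cdiff_cst d z : cdiff (fun _ => d) z.
Proof. exact: (@derivable_cst C C^o C^o). Qed.

Lemma cdiff_id z : cdiff id z.
Proof. exact: (@derivable_id C C^o). Qed.

Lemma cdiffD f g z : cdiff f z -> cdiff g z -> cdiff (fun w => f w + g w) z.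
Proof. exact: (@derivableD C C^o C^o). Qed.

Lemma cdiffB f g z : cdiff f z -> cdiff g z -> cdiff (fun w => f w - g w) z.
Proof. exact: (@derivableB C C^o C^o). Qed.

Lemma cdiffM f g z : cdiff f z -> cdiff g z -> cdiff (fun w => f w * g w) z.
Proof. exact: derivableM. Qed.

Lemma cdiffV f z : f z != 0 -> cdiff f z -> cdiff (fun w => (f w)^-1) z.
Proof. exact: derivableV. Qed.

Lemma cdiffX f n z : cdiff f z -> cdiff (fun w => f w ^+ n) z.
Proof.
move=> fz; elim: n => [|n IH]; first exact: cdiff_cst.
rewrite (_ : (fun w => _) = fun w => f w * f w ^+ n); first exact: cdiffM.
by apply/funext => w; rewrite exprS.
Qed.

Lemma cdiff_subr d z : cdiff (fun w => w - d) z.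
Proof. exact: (@cdiffB id (fun=> d) z (@cdiff_id z) (@cdiff_cst d z)). Qed.

Lemma cdiff_near_eq f g z (r : R) : 0 < r ->
  (forall w, nm (w - z) < r -> f w = g w) -> cdiff f z -> cdiff g z.
Proof.
move=> r0 fg /cdiffP[d hd]; apply/cdiffP; exists d => e e0.
have [r' r'0 hr'] := hd _ e0; exists (Num.min r r'); first by rewrite lt_min r0.
move=> w; rewrite lt_min => /andP[h1 h2]; rewrite -fg// -fg ?hr'//.
by rewrite subrr nm0.
Qed.

Lemma cdiff_horner (p : {poly C}) z : cdiff (horner p) z.
Proof.
elim/poly_ind: p => [|p c IH].
  by rewrite (_ : horner 0 = fun=> 0); [exact: cdiff_cst|apply/funext => w; rewrite horner0].
rewrite (_ : horner _ = fun w => p.[w] * w + c).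
  apply: (@cdiffD (fun w => p.[w] * w)); last exact: cdiff_cst.
  exact: (@cdiffM _ id _ IH (@cdiff_id z)).
by apply/funext => w; rewrite !hornerE.
Qed.

Lemma cdiff_ccont f z : cdiff f z -> ccont f z.
Proof.
move=> /cdiffP[d hd] e e0; have [r r0 hr] := hd 1 ltr01.
have K0 : 0 < nm d + 1 by have := nm_ge0 d; lra.
exists (Num.min r (e / (nm d + 1))); first by rewrite lt_min r0 divr_gt0.
move=> w; rewrite lt_min => /andP[/hr h1]; rewrite ltr_pdivlMr// => h2.
have := nmD (f w - f z - d * (w - z)) (d * (w - z)); rewrite subrK nmM.
lra.
Qed.

Lemma ccontB f g z : ccont f z -> ccont g z -> ccont (fun w => f w - g w) z.
Proof.
move=> cf cg e e0; have e2 : 0 < e / 2 by lra.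
have [r r0 hr] := cf _ e2; have [r' r'0 hr'] := cg _ e2.
exists (Num.min r r'); first by rewrite lt_min r0.
move=> w; rewrite lt_min => /andP[/hr h1 /hr' h2].
rewrite (_ : _ - _ = (f w - f z) - (g w - g z)); last by ring.
have := nm_triB (f w - f z) (g w - g z); lra.
Qed.

Lemma ReD z w : complex.Re (z + w) = complex.Re z + complex.Re w.
Proof. by case: z w => a b [c d]. Qed.

Lemma ImD z w : complex.Im (z + w) = complex.Im z + complex.Im w.
Proof. by case: z w => a b [c d]. Qed.

Lemma ReN z : complex.Re (- z) = - complex.Re z.
Proof. by case: z. Qed.

Lemma ImN z : complex.Im (- z) = - complex.Im z.
Proof. by case: z. Qed.

End Calculus.
Arguments cdiff_cst {R} d z.
Arguments cdiff_id {R} z.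
Arguments cdiff_subr {R} d z.
Arguments cdiff_horner {R} p z.
Arguments cdiffD {R f g z} _ _.
Arguments cdiffB {R f g z} _ _.
Arguments cdiffM {R f g z} _ _.
Arguments cdiffV {R f z} _ _.
Arguments cdiffX {R f} n {z} _.
Arguments cdiff_near_eq {R} f {g z r} _ _ _.


(** * Closed squares and bisection *)

Section Squares.
Variable R : realType.
Local Notation C := R[i].
Implicit Types (p z w d v : C) (s : R).

Definition square p s z := complex.Re p <= complex.Re z <= complex.Re p + s /\
  complex.Im p <= complex.Im z <= complex.Im p + s.

(** Lower left corners of the four quarters: [b1] selects the right half, [b2] the upper half. *)
Definition qcorner p s (b1 b2 : bool) : C :=
  p + ((if b1 then s / 2 else 0) +i* (if b2 then s / 2 else 0))%C.

Lemma square_qcorner p s b1 b2 z : 0 < s ->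
  square (qcorner p s b1 b2) (s / 2) z -> square p s z.
Proof.
move=> s0; rewrite /square /qcorner !ReD !ImD /=.
by case: b1; case: b2 => -[/andP[? ?] /andP[? ?]]; split; apply/andP; split; lra.
Qed.

Lemma square_cover p s z : square p s z ->
  exists b1 b2, square (qcorner p s b1 b2) (s / 2) z.
Proof.
move=> [/andP[h1 h2] /andP[h3 h4]].
exists (complex.Re p + s / 2 < complex.Re z), (complex.Im p + s / 2 < complex.Im z).
rewrite /square /qcorner !ReD !ImD /=.
by case: ltP => ?; case: ltP => ?; split; apply/andP; split; lra.
Qed.

Lemma square_dist p s z w : 0 < s -> square p s z -> square p s w -> nm (z - w) <= 2 * s.
Proof.
move=> s0 [/andP[h1 h2] /andP[h3 h4]] [/andP[h5 h6] /andP[h7 h8]].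
apply: le_trans (nm_le_ReIm _) _; rewrite !raddfB /=.
have : `|complex.Re z - complex.Re w| <= s by rewrite ler_norml; apply/andP; split; lra.
have : `|complex.Im z - complex.Im w| <= s by rewrite ler_norml; apply/andP; split; lra.
lra.
Qed.

(** Compactness as bisection: a property inherited by some quarter persists in arbitrarily small
    squares around one point. Goursat's lemma and the existence of maxima on disks both rest on
    it. *)
Lemma quadtree (P : C -> R -> Prop) p0 s0 : 0 < s0 -> P p0 s0 ->
  (forall p s, 0 < s -> P p s -> exists b1 b2, P (qcorner p s b1 b2) (s / 2)) ->
  exists2 z, square p0 s0 z & forall e, 0 < e ->
    exists p s, [/\ P p s, 0 < s, s < e & square p s z].
Proof.
move=> s00 P0 Pstep.
(* Choice needs a total function, hence the implications; where they are vacuous the value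
   [(true, true)] is arbitrary. *)
have [b hb] : {b : C * R -> bool * bool & forall x, 0 < x.2 -> P x.1 x.2 ->
    P (qcorner x.1 x.2 (b x).1 (b x).2) (x.2 / 2)}.
  apply: (@choice _ _ (fun x b => 0 < x.2 -> P x.1 x.2 ->
    P (qcorner x.1 x.2 b.1 b.2) (x.2 / 2))) => -[p s] /=.
  have [s1|s1] := boolP (0 < s); last by exists (true, true).
  have [Pps|Pps] := pselect (P p s); last by exists (true, true).
  by have [b1 [b2 h]] := Pstep _ _ s1 Pps; exists (b1, b2).
pose u n := iter n (fun x : C * R => (qcorner x.1 x.2 (b x).1 (b x).2, x.2 / 2)) (p0, s0).
have uS n : u n.+1 = (qcorner (u n).1 (u n).2 (b (u n)).1 (b (u n)).2, (u n).2 / 2) by [].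
have u2 n : (u n).2 = s0 / 2 ^+ n.
  elim: n => [|n IH]; first by rewrite expr0 divr1.
  rewrite uS /= IH exprS; field.
  by rewrite expf_neq0.
have u2gt n : 0 < (u n).2 by rewrite u2 divr_gt0// exprn_gt0.
have Pu n : P (u n).1 (u n).2.
  by elim: n => [//|n IH]; rewrite uS /=; apply: hb.
have nest m n z : square (u (n + m)%N).1 (u (n + m)%N).2 z -> square (u m).1 (u m).2 z.
  elim: n => [//|n IH]; rewrite addSn uS /= => /square_qcorner h.
  exact: IH (h (u2gt _)).
have corner n : square (u n).1 (u n).2 (u n).1.
  by split; apply/andP; split=> //; have := u2gt n; lra.
have sqmn m n : square (u m).1 (u m).2 (u (maxn m n)).1.
  have -> : maxn m n = ((maxn m n - m) + m)%N by rewrite subnK// leq_maxl.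
  exact: nest (corner _).
have hiRe m n : complex.Re (u n).1 <= complex.Re (u m).1 + (u m).2.
  have [/andP[_ h] _] := sqmn m n; have [/andP[h' _] _] := sqmn n m.
  by move: h'; rewrite maxnC; lra.
have hiIm m n : complex.Im (u n).1 <= complex.Im (u m).1 + (u m).2.
  have [_ /andP[_ h]] := sqmn m n; have [_ /andP[h' _]] := sqmn n m.
  by move: h'; rewrite maxnC; lra.
(* The squares are nested, so each left edge lies to the left of every right edge, and the supremum
   of the left edges belongs to all squares; likewise vertically. *)
pose X := sup (range (fun n => complex.Re (u n).1)).
pose Y := sup (range (fun n => complex.Im (u n).1)).
have sq n : square (u n).1 (u n).2 (X +i* Y)%C.
  split; apply/andP; split => /=.
  - apply: ub_le_sup; last by exists n.
    by exists (complex.Re (u 0%N).1 + (u 0%N).2) => _ [m _ <-]; exact: hiRe.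
  - apply: ge_sup; first by exists (complex.Re (u n).1), n.
    by move=> _ [m _ <-]; exact: hiRe.
  - apply: ub_le_sup; last by exists n.
    by exists (complex.Im (u 0%N).1 + (u 0%N).2) => _ [m _ <-]; exact: hiIm.
  - apply: ge_sup; first by exists (complex.Im (u n).1), n.
    by move=> _ [m _ <-]; exact: hiIm.
exists (X +i* Y)%C; first exact: (sq 0%N).
move=> e e0; pose n := (Num.truncn (s0 / e)).+1.
exists (u n).1, (u n).2; split => //.
rewrite u2 ltr_pdivrMr ?exprn_gt0// mulrC -ltr_pdivrMr//.
have := truncnS_gt (s0 / e); move=> /lt_trans; apply.
by rewrite -natrX ltr_nat ltn_expl.
Qed.

End Squares.

(** * Midpoint sums along squares and Goursat's lemma *)

Section MidpointSums.
Variable R : realType.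
Local Notation C := R[i].
Implicit Types (f g : C -> C) (p z w d v : C) (s : R).

(** Riemann sum for the integral from [p] to [p + v], with 2^k equal pieces. Halving is built into
    the recursion, so that quartering a square acts on the sums exactly. *)
Fixpoint midsum f (k : nat) p v : C :=
  if k is k'.+1 then midsum f k' p (v / 2) + midsum f k' (p + v / 2) (v / 2)
  else v * f (p + v / 2).

(** Counterclockwise: bottom and right sides, then top and left sides with reversed sign. *)
Definition loopsum f k p s : C :=
  midsum f k p s%:C%C + midsum f k (p + s%:C%C) ('i%C * s%:C%C)
  - midsum f k (p + 'i%C * s%:C%C) s%:C%C - midsum f k p ('i%C * s%:C%C).

Lemma real_complex_half (t : R) : (t / 2)%:C%C = t%:C%C / 2 :> C.
Proof. by rewrite real_complexM fmorphV rmorph_nat. Qed.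

Lemma nm_half v : nm (v / 2) = nm v / 2.
Proof. by rewrite -(rmorph_nat (real_complex R)) -fmorphV nmM nm_real ger0_norm ?invr_ge0. Qed.

Lemma seg_half0 (P : C -> Prop) p v :
  (forall t : R, 0 <= t <= 1 -> P (p + t%:C%C * v)) ->
  forall t : R, 0 <= t <= 1 -> P (p + t%:C%C * (v / 2)).
Proof.
move=> h t /andP[t0 t1]; have := h (t / 2); rewrite real_complex_half.
rewrite (_ : t%:C%C / 2 * v = t%:C%C * (v / 2)); last by ring.
by apply; apply/andP; split; lra.
Qed.

Lemma seg_half1 (P : C -> Prop) p v :
  (forall t : R, 0 <= t <= 1 -> P (p + t%:C%C * v)) ->
  forall t : R, 0 <= t <= 1 -> P (p + v / 2 + t%:C%C * (v / 2)).
Proof.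
move=> h t /andP[t0 t1]; have := h ((1 + t) / 2); rewrite real_complex_half rmorphD rmorph1.
rewrite (_ : p + v / 2 + _ = p + (1 + t%:C%C) / 2 * v); last by field.
by apply; apply/andP; split; lra.
Qed.

Lemma seg_mid (P : C -> Prop) p v :
  (forall t : R, 0 <= t <= 1 -> P (p + t%:C%C * v)) -> P (p + v / 2).
Proof.
move=> h; have := h (1 / 2); rewrite real_complex_half rmorph1.
rewrite (_ : 1 / 2 * v = v / 2); last by ring.
by apply; apply/andP; split; lra.
Qed.

Lemma midsum_bound f (M : R) k p v :
  (forall t : R, 0 <= t <= 1 -> nm (f (p + t%:C%C * v)) <= M) ->
  nm (midsum f k p v) <= nm v * M.
Proof.
elim: k p v => [|k IH] p v h /=.
  rewrite nmM ler_wpM2l ?nm_ge0//; exact: (@seg_mid (fun z => nm (f z) <= M)).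
apply: le_trans (nmD _ _) _.
have := IH _ _ (@seg_half0 (fun z => nm (f z) <= M) _ _ h).
have := IH _ _ (@seg_half1 (fun z => nm (f z) <= M) _ _ h).
by rewrite nm_half; lra.
Qed.

Lemma midsum_linear f g d k p v :
  midsum (fun z => d * f z + g z) k p v = d * midsum f k p v + midsum g k p v.
Proof.
elim: k p v => [|k IH] p v /=; first by ring.
by rewrite !IH; ring.
Qed.

(** The midpoint rule is exact on affine functions, so a first-order expansion contributes nothing
    to a loop sum at any level. *)
Lemma midsum_affine c d k p v :
  midsum (fun z => c + d * z) k p v = v * (c + d * (p + v / 2)).
Proof.
elim: k p v => [//|k IH] p v /=.
by rewrite !IH; field.
Qed.

Lemma loopsum_linear f g d k p s :
  loopsum (fun z => d * f z + g z) k p s = d * loopsum f k p s + loopsum g k p s.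
Proof. by rewrite /loopsum !midsum_linear; ring. Qed.

Lemma loopsum_affine c d k p s : loopsum (fun z => c + d * z) k p s = 0.
Proof.
rewrite /loopsum !midsum_affine.
by set j := 'i%C; ring.
Qed.

Lemma qcornerE p s b1 b2 : qcorner p s b1 b2 =
  p + ((if b1 then s%:C%C / 2 else 0) + 'i%C * (if b2 then s%:C%C / 2 else 0)).
Proof.
by rewrite /qcorner; congr (_ + _); rewrite [LHS]complexE /=; case: b1; case: b2;
  rewrite ?real_complex_half ?rmorph0.
Qed.

(** The sums over each inner half-side occur twice with opposite signs, at the same sample points,
    and cancel identically. *)
Lemma loopsumS f k p s : loopsum f k.+1 p s =
  loopsum f k (qcorner p s false false) (s / 2) +
  loopsum f k (qcorner p s true false) (s / 2) +
  loopsum f k (qcorner p s false true) (s / 2) +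
  loopsum f k (qcorner p s true true) (s / 2).
Proof.
rewrite /loopsum !qcornerE !real_complex_half.
set t := s%:C%C; set j := 'i%C.
rewrite ?mulr0 ?addr0 ?add0r ![j * (t / 2)]mulrA.
have -> : p + t / 2 + t / 2 = p + t by field.
have -> : p + j * t / 2 + j * t / 2 = p + j * t by field.
have -> : p + (t / 2 + j * t / 2) + t / 2 = p + t + j * t / 2 by field.
have -> : p + (t / 2 + j * t / 2) + j * t / 2 = p + j * t + t / 2 by field.
have -> : p + t / 2 + j * t / 2 = p + (t / 2 + j * t / 2) by ring.
have -> : p + j * t / 2 + t / 2 = p + (t / 2 + j * t / 2) by ring.
rewrite /midsum -/midsum; ring.
Qed.

Definition on_rim (p : C) s z := square p s z /\
  [|| complex.Re z == complex.Re p, complex.Re z == complex.Re p + s,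
      complex.Im z == complex.Im p | complex.Im z == complex.Im p + s].

Lemma rim_sides (P : C -> Prop) p s : 0 < s -> (forall z, on_rim p s z -> P z) ->
  [/\ forall t : R, 0 <= t <= 1 -> P (p + t%:C%C * s%:C%C),
      forall t : R, 0 <= t <= 1 -> P (p + s%:C%C + t%:C%C * ('i%C * s%:C%C)),
      forall t : R, 0 <= t <= 1 -> P (p + 'i%C * s%:C%C + t%:C%C * s%:C%C) &
      forall t : R, 0 <= t <= 1 -> P (p + t%:C%C * ('i%C * s%:C%C))].
Proof.
move=> s0 h; split=> t /andP[t0 t1]; apply: h; rewrite /on_rim /square !ReD !ImD /=;
  (do ! rewrite ?mul0r ?mulr0 ?mul1r ?mulr1 ?addr0 ?add0r ?subr0 ?oppr0);
  have ts0 : 0 <= t * s by rewrite mulr_ge0// ltW.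
all: have ts1 : t * s <= s by rewrite ler_piMl// ltW.
all: split; last by rewrite ?eqxx ?orbT.
all: split; apply/andP; split; lra.
Qed.

Lemma loopsum_bound f (M : R) k p s : 0 < s ->
  (forall z, on_rim p s z -> nm (f z) <= M) -> nm (loopsum f k p s) <= 4 * s * M.
Proof.
move=> s0 h; rewrite /loopsum.
have [h1 h2 h3 h4] := @rim_sides (fun z => nm (f z) <= M) p s s0 h.
have := midsum_bound k h1; have := midsum_bound k h2.
have := midsum_bound k h3; have := midsum_bound k h4.
rewrite nmM nm_i mul1r nm_real gtr0_norm// => b4 b3 b2 b1.
apply: le_trans (nm_triB _ _) _.
have := nm_triB (midsum f k p s%:C%C + midsum f k (p + s%:C%C) ('i%C * s%:C%C))
  (midsum f k (p + 'i%C * s%:C%C) s%:C%C).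
have := nmD (midsum f k p s%:C%C) (midsum f k (p + s%:C%C) ('i%C * s%:C%C)).
lra.
Qed.

(* No limit of Riemann sums is taken: the pigeonhole step asks each estimate
   to fail for infinitely many k only. *)
Lemma goursat f p s : 0 < s -> (forall z, square p s z -> cdiff f z) ->
  forall e : R, 0 < e -> exists K, forall k, (K <= k)%N -> nm (loopsum f k p s) <= e * s ^+ 2.
Proof.
move=> s0 fd e e0; apply: contrapT => hno.
pose P q t := (forall z, square q t z -> square p s z) /\
  forall K, exists2 k, (K <= k)%N & e * t ^+ 2 < nm (loopsum f k q t).
have P0 : P p s.
  split=> // K; apply: contrapT => hK; apply: hno; exists K => k Kk.
  by rewrite leNgt; apply/negP => hk; apply: hK; exists k.
have Pstep q t : 0 < t -> P q t -> exists b1 b2, P (qcorner q t b1 b2) (t / 2).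
  move=> t0 [sub big]; apply: contrapT => hb.
  have {}hb b1 b2 : exists K, forall k, (K <= k)%N ->
      nm (loopsum f k (qcorner q t b1 b2) (t / 2)) <= e * (t / 2) ^+ 2.
    apply: contrapT => hK; apply: hb; exists b1, b2; split.
      by move=> z /(square_qcorner t0)/sub.
    move=> K; apply: contrapT => hk; apply: hK; exists K => k Kk.
    by rewrite leNgt; apply/negP => h; apply: hk; exists k.
  have [K1 h1] := hb false false; have [K2 h2] := hb true false.
  have [K3 h3] := hb false true; have [K4 h4] := hb true true.
  (* The level is taken positive, so that it can drop by one when the square is quartered. *)
  have [[//|k] kK] := big (K1 + K2 + K3 + K4).+1.
  rewrite loopsumS => hk.
  have {}h1 := h1 k (leq_trans (leq_trans (leq_addr _ _) (leq_trans (leq_addr _ _) (leq_addr _ _))) kK).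
  have {}h2 := h2 k (leq_trans (leq_trans (leq_addl _ _) (leq_trans (leq_addr _ _) (leq_addr _ _))) kK).
  have {}h3 := h3 k (leq_trans (leq_trans (leq_addl _ _) (leq_addr _ _)) kK).
  have {}h4 := h4 k (leq_trans (leq_addl _ _) kK).
  move: h1 h2 h3 h4 hk.
  set x1 := loopsum _ _ _ _; set x2 := loopsum _ _ _ _.
  set x3 := loopsum _ _ _ _; set x4 := loopsum _ _ _ _ => h1 h2 h3 h4.
  have := nmD (x1 + x2 + x3) x4; have := nmD (x1 + x2) x3; have := nmD x1 x2.
  rewrite (_ : e * t ^+ 2 = 4 * (e * (t / 2) ^+ 2)); last by field.
  lra.
have [z sqz hz] := quadtree s0 P0 Pstep.
have /cdiffP[d hd] := fd _ sqz.
(* The rim has length 4 t and distances in the square are at most 2 t, so e / 8 yields e t^2. *)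
have e8 : 0 < e / 8 by lra.
have [r r0 hr] := hd _ e8.
have r20 : 0 < r / 2 by lra.
have [q [t [[_ big] t0 tr sqt]]] := hz _ r20.
have [k _] := big 0%N; apply/negP; rewrite -leNgt.
(* Subtracting the affine expansion at [z] does not change the loop sum. *)
rewrite (_ : loopsum f k q t = loopsum (fun w => (-1) * ((f z - d * z) + d * w) + f w) k q t); last first.
  by rewrite loopsum_linear loopsum_affine mulr0 add0r.
apply: le_trans (@loopsum_bound _ (e / 8 * (2 * t)) _ _ _ t0 _) _; last first.
  by rewrite (_ : 4 * t * _ = e * t ^+ 2)//; field.
move=> w [sqw _]; have wz := square_dist t0 sqw sqt.
rewrite (_ : -1 * (f z - d * z + d * w) + f w = f w - f z - d * (w - z)); last by ring.
apply: le_trans (hr _ _) _; first by lra.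
by rewrite ler_wpM2l//; lra.
Qed.

End MidpointSums.

(** * Geometric sequences *)

Section GeometricGrowth.
Variable R : realType.
Implicit Types (x y c e : R).

Lemma bernoulli_ge x n : 0 <= x -> 1 + n%:R * x <= (1 + x) ^+ n.
Proof.
move=> x0; elim: n => [|n IH]; first by rewrite expr0 mul0r addr0.
rewrite exprS; apply: le_trans (ler_wpM2l _ IH); last by lra.
have := ler0n R n; rewrite -natr1 => n0.
have : 0 <= n%:R * x * x by rewrite !mulr_ge0.
lra.
Qed.

Lemma expr_unbounded x c : 1 < x -> exists n, c < x ^+ n.
Proof.
move=> x1; have h0 : 0 < x - 1 by lra.
exists (Num.truncn (c / (x - 1))).+1.
have := bernoulli_ge (Num.truncn (c / (x - 1))).+1 (ltW h0).
have := truncnS_gt (c / (x - 1)); rewrite ltr_pdivrMr// (_ : 1 + (x - 1) = x); last by ring.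
lra.
Qed.

Lemma expr_small x e : 0 <= x -> x < 1 -> 0 < e -> exists N, forall n, (N <= n)%N -> x ^+ n <= e.
Proof.
move=> x0 x1 e0; have [->|xn0] := eqVneq x 0.
  by exists 1%N => -[//|n] _; rewrite exprS mul0r ltW.
have xp : 0 < x by rewrite lt_neqAle eq_sym xn0.
have x1' : 1 < x^-1 by rewrite invf_gt1.
have [N hN] := expr_unbounded e^-1 x1'.
exists N => n Nn; apply: le_trans (_ : x ^+ N <= e).
  by rewrite ler_wiXn2l// ltW.
by rewrite -[e]invrK -[x ^+ N]invrK lef_pV2 ?posrE ?invr_gt0 ?exprn_gt0// -exprVn ltW.
Qed.

(** If x > y, the quotient of the powers is unbounded. This removes the constant from a maximum
    principle that holds for all powers of a function. *)
Lemma le_of_expr_le x y c : 0 <= y -> (forall n, x ^+ n <= c * y ^+ n) -> x <= y.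
Proof.
move=> y0 h; rewrite leNgt; apply/negP => xy.
have [y00|yn0] := eqVneq y 0.
  by have := h 1%N; rewrite y00 !expr1 mulr0; lra.
have yp : 0 < y by rewrite lt_neqAle eq_sym yn0.
have xy1 : 1 < x / y by rewrite ltr_pdivlMr// mul1r.
have [n] := expr_unbounded c xy1.
by apply/negP; rewrite -leNgt expr_div_n ler_pdivrMr ?exprn_gt0.
Qed.

End GeometricGrowth.

(** * Cauchy's formula and the maximum principle on squares *)

Section SquareMaximum.
Variable R : realType.
Local Notation C := R[i].
Implicit Types (f g : C -> C) (p z w d v a : C) (s : R).

Lemma goursat0 f p s : 0 < s -> (forall z, square p s z -> cdiff f z) ->
  forall e : R, 0 < e -> exists K, forall k, (K <= k)%N -> nm (loopsum f k p s) <= e.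
Proof.
move=> s0 fd e e0; have s2 : 0 < s ^+ 2 by rewrite exprn_gt0.
have [K hK] := goursat s0 fd (divr_gt0 e0 s2).
by exists K => k /hK; rewrite divfK// gt_eqF.
Qed.

(** Differentiability may fail at the corner [a]. Three quarters avoid [a] and have negligible loop
    sums; the fourth has [a] as a corner again. After m quarterings only a perimeter 4 s / 2^m times
    the local bound survives. *)
Lemma goursat_corner f a p s b1 b2 (M : R) m : 0 < s ->
  a = p + ((if b1 then s else 0) +i* (if b2 then s else 0))%C ->
  (forall z, square p s z -> z != a -> cdiff f z) ->
  (forall z, nm (z - a) <= 2 * (s / 2 ^+ m) -> nm (f z) <= M) ->
  forall e : R, 0 < e -> exists K, forall k, (K <= k)%N ->
    nm (loopsum f k p s) <= 4 * (s / 2 ^+ m) * M + e.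
Proof.
elim: m p s => [|m IH] p s s0 aE fd fb e e0.
  exists 0%N => k _; rewrite expr0 divr1 in fb *.
  have sqa : square p s a.
    by rewrite aE /square !ReD !ImD /=; case: b1 {aE}; case: b2;
      split; apply/andP; split; lra.
  apply: le_trans (@loopsum_bound _ _ M _ _ _ s0 _) _; last by lra.
  by move=> z [sqz _]; apply: fb; exact: square_dist sqz sqa.
have s20 : 0 < s / 2 by lra.
have e4 : 0 < e / 4 by lra.
have hq c1 c2 : exists K, forall k, (K <= k)%N ->
    nm (loopsum f k (qcorner p s c1 c2) (s / 2)) <=
    (if (c1, c2) == (b1, b2) then 4 * (s / 2 ^+ m.+1) * M else 0) + e / 4.
  have [/eqP[-> ->]|ne] := boolP ((c1, c2) == (b1, b2)).
    rewrite (_ : s / 2 ^+ m.+1 = s / 2 / 2 ^+ m); last by rewrite exprS invfM mulrA.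
    apply: IH => //.
    - rewrite aE /qcorner; case: b1 {fd aE}; case: b2; apply/eqP; rewrite eq_complex !ReD !ImD /=;
        apply/andP; split; apply/eqP; lra.
    - by move=> z /(square_qcorner s0); exact: fd.
    - by move=> z hz; apply: fb; rewrite exprS invfM [s * _]mulrA.
  rewrite add0r; apply: goursat0 => // z sqz; apply: fd; first exact: square_qcorner sqz.
  move: sqz ne; rewrite aE /square /qcorner !ReD !ImD /= => -[/andP[h1 h2] /andP[h3 h4]] ne.
  apply/eqP => zE; move: h1 h2 h3 h4; rewrite zE !ReD !ImD /=.
  by move: ne; clear -s0; case: b1; case: c1; case: b2; case: c2 => // _; lra.
have [K1 h1] := hq false false; have [K2 h2] := hq true false.
have [K3 h3] := hq false true; have [K4 h4] := hq true true.
exists (K1 + K2 + K3 + K4).+1 => -[//|k] kK.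
rewrite loopsumS.
have {}h1 := h1 k (leq_trans (leq_trans (leq_addr _ _) (leq_trans (leq_addr _ _) (leq_addr _ _))) kK).
have {}h2 := h2 k (leq_trans (leq_trans (leq_addl _ _) (leq_trans (leq_addr _ _) (leq_addr _ _))) kK).
have {}h3 := h3 k (leq_trans (leq_trans (leq_addl _ _) (leq_addr _ _)) kK).
have {}h4 := h4 k (leq_trans (leq_addl _ _) kK).
move: h1 h2 h3 h4; move: (4 * _ * M) => Z.
set x1 := loopsum _ _ _ _; set x2 := loopsum _ _ _ _.
set x3 := loopsum _ _ _ _; set x4 := loopsum _ _ _ _.
have := nmD (x1 + x2 + x3) x4; have := nmD (x1 + x2) x3; have := nmD x1 x2.
by clear -e0; case: b1; case: b2 => /=; rewrite /eq_op /=; lra.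
Qed.

Definition lcorner a s : C := a - (s +i* s)%C.

(** The centre is a corner of all four quarters, and a deep subdivision makes the surviving term of
    each negligible. *)
Lemma goursat_center f a s (M r : R) : 0 < s -> 0 < r ->
  (forall z, square (lcorner a s) (2 * s) z -> z != a -> cdiff f z) ->
  (forall z, nm (z - a) < r -> nm (f z) <= M) ->
  forall e : R, 0 < e -> exists K, forall k, (K <= k)%N ->
    nm (loopsum f k (lcorner a s) (2 * s)) <= e.
Proof.
move=> s0 r0 fd fb e e0.
have M0 : 0 <= M by apply: le_trans (fb a _); rewrite ?nm_ge0// subrr nm0.
have s20 : 0 < 2 * s by lra.
have [N hN] : exists N : nat, 2 * s / 2 ^+ N < r /\ 4 * (s / 2 ^+ N) * M <= e / 8.
  (* The sum of the two thresholds, so that one power of 2 exceeds both. *)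
  pose c := 2 * s / r + 32 * s * M / e.
  have c1 : 0 <= 2 * s / r by rewrite divr_ge0// ltW.
  have c2 : 0 <= 32 * s * M / e by rewrite divr_ge0 ?mulr_ge0// ltW.
  have two1 : 1 < 2 :> R by lra.
  have [N hN] := expr_unbounded c two1.
  have p0 : 0 < 2 ^+ N :> R by rewrite exprn_gt0.
  exists N; split.
    rewrite ltr_pdivrMr//; have : 2 * s / r < 2 ^+ N by move: hN; rewrite /c; lra.
    by rewrite ltr_pdivrMr//; lra.
  rewrite (_ : 4 * (s / 2 ^+ N) * M = 4 * s * M / 2 ^+ N); last by field; rewrite gt_eqF.
  rewrite ler_pdivrMr//.
  have : 32 * s * M / e <= 2 ^+ N by move: hN; rewrite /c; lra.
  by rewrite ler_pdivrMr//; lra.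
have e8 : 0 < e / 8 by lra.
have hq c1 c2 : exists K, forall k, (K <= k)%N ->
    nm (loopsum f k (qcorner (lcorner a s) (2 * s) c1 c2) s) <= e / 4.
  (* In the quarter [(c1, c2)] the centre is the corner [(~~ c1, ~~ c2)]. *)
  have [|||K hK] := @goursat_corner f a (qcorner (lcorner a s) (2 * s) c1 c2) s
    (~~ c1) (~~ c2) M N s0 _ _ _ _ e8.
  - rewrite /qcorner /lcorner; apply/eqP; rewrite eq_complex !ReD !ImD !ReN !ImN /=.
    by case: c1; case: c2; apply/andP; split; apply/eqP => /=; lra.
  - move=> z sqz; apply: fd; apply: (@square_qcorner _ _ _ c1 c2) => //.
    by rewrite (_ : 2 * s / 2 = s)//; field.
  - by move=> z hz; apply: fb; apply: le_lt_trans hz _; rewrite mulrA; exact: hN.1.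
  by exists K => k /hK; have := hN.2; lra.
have [K1 h1] := hq false false; have [K2 h2] := hq true false.
have [K3 h3] := hq false true; have [K4 h4] := hq true true.
exists (K1 + K2 + K3 + K4).+1 => -[//|k] kK.
rewrite loopsumS (_ : 2 * s / 2 = s); last by field.
have {}h1 := h1 k (leq_trans (leq_trans (leq_addr _ _) (leq_trans (leq_addr _ _) (leq_addr _ _))) kK).
have {}h2 := h2 k (leq_trans (leq_trans (leq_addl _ _) (leq_trans (leq_addr _ _) (leq_addr _ _))) kK).
have {}h3 := h3 k (leq_trans (leq_trans (leq_addl _ _) (leq_addr _ _)) kK).
have {}h4 := h4 k (leq_trans (leq_addl _ _) kK).
move: h1 h2 h3 h4.
set x1 := loopsum _ _ _ _; set x2 := loopsum _ _ _ _.
set x3 := loopsum _ _ _ _; set x4 := loopsum _ _ _ _.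
have := nmD (x1 + x2 + x3) x4; have := nmD (x1 + x2) x3; have := nmD x1 x2.
lra.
Qed.

Lemma midsum_Im_ge f d (m : R) k p v :
  (forall t : R, 0 <= t <= 1 -> m <= complex.Im (d * (v * f (p + t%:C%C * v)))) ->
  m <= complex.Im (d * midsum f k p v).
Proof.
have Im2 x y z : complex.Im (x * (y / 2 * z)) = complex.Im (x * (y * z)) / 2.
  rewrite (_ : x * (y / 2 * z) = x * (y * z) * (2^-1)%:C%C).
    by case: (x * (y * z)) => u1 u2 /=; ring.
  by rewrite fmorphV rmorph_nat; ring.
elim: k p v m => [|k IH] p v m h /=.
  exact: (@seg_mid _ (fun z => m <= complex.Im (d * (v * f z)))).
rewrite mulrDr ImD.
have := IH p (v / 2) (m / 2) _; have := IH (p + v / 2) (v / 2) (m / 2) _ => H1 H2.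
rewrite (_ : m = m / 2 + m / 2); last by field.
apply: lerD; [apply: H2|apply: H1] => t ht; rewrite Im2 ler_pM2r ?invr_gt0//.
  exact: (@seg_half0 _ (fun z => m <= complex.Im (d * (v * f z)))).
exact: (@seg_half1 _ (fun z => m <= complex.Im (d * (v * f z)))).
Qed.

Lemma square_rim_dist a s z : 0 < s -> on_rim (lcorner a s) (2 * s) z -> s <= nm (z - a).
Proof.
move=> s0 [_ /or4P]; rewrite /lcorner !raddfB /=.
have Hr : `|complex.Re z - complex.Re a| <= nm (z - a).
  by have := nm_ge_Re (z - a); rewrite raddfB.
have Hi : `|complex.Im z - complex.Im a| <= nm (z - a).
  by have := nm_ge_Im (z - a); rewrite raddfB.
have Hr' := ler_norm (complex.Re z - complex.Re a); have Hr2 := lerNnormlW (lexx `|complex.Re z - complex.Re a|).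
have Hi' := ler_norm (complex.Im z - complex.Im a); have Hi2 := lerNnormlW (lexx `|complex.Im z - complex.Im a|).
by case=> /eqP E; lra.
Qed.

(* The winding number of the square is 1; the crude bound 4 < 2 pi is all that is needed. *)
Lemma loopsum_kernel_ge a s k : 0 < s ->
  4 <= nm (loopsum (fun z => (z - a)^-1) k (lcorner a s) (2 * s)).
Proof.
move=> s0; set f := fun z => _; set p := lcorner a s; set u := (2 * s)%:C%C.
(* On each side the numerator of the imaginary part is at least 2 s^2, while x^2 + y^2 <= 2 s^2:
   every side contributes at least 1. *)
have main (d v : C) x y : `|x| <= s -> `|y| <= s ->
    2 * s ^+ 2 <= complex.Im (d * v) * x - complex.Re (d * v) * y ->
    forall z, z = a + (x +i* y)%C -> 1 <= complex.Im (d * (v * f z)).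
  move=> hx hy hxy z ->; rewrite /f (addrC a) addrK mulrA.
  have x2 : x ^+ 2 <= s ^+ 2 by rewrite -(real_normK (num_real x)) ler_sqr ?nnegrE// ltW.
  have y2 : y ^+ 2 <= s ^+ 2 by rewrite -(real_normK (num_real y)) ler_sqr ?nnegrE// ltW.
  have xy0 : 0 < x ^+ 2 + y ^+ 2.
    rewrite lt_neqAle addr_ge0 ?sqr_ge0// andbT eq_sym paddr_eq0 ?sqr_ge0//.
    apply/negP; rewrite !sqrf_eq0 => /andP[/eqP x0 /eqP y0].
    by move: hxy; rewrite x0 y0 !mulr0 subr0 => h; have := exprn_gt0 2 s0; lra.
  case: (d * v) hxy => c1 c2 /= hxy.
  rewrite (_ : _ + _ = (c2 * x - c1 * y) / (x ^+ 2 + y ^+ 2)); last first.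
    by field; rewrite gt_eqF.
  by rewrite ler_pdivlMr// mul1r; lra.
have tE (t : R) : a + Complex (- s + 2 * s * t) (- s) = p + t%:C%C * u.
  apply/eqP; rewrite eq_complex /p /lcorner !ReD !ImD !ReN !ImN /=.
  by apply/andP; split; apply/eqP; ring.
have tE2 (t : R) : a + Complex s (- s + 2 * s * t) = p + u + t%:C%C * ('i%C * u).
  apply/eqP; rewrite eq_complex /p /lcorner !ReD !ImD !ReN !ImN /=.
  by apply/andP; split; apply/eqP; ring.
have tE3 (t : R) : a + Complex (- s + 2 * s * t) s = p + 'i%C * u + t%:C%C * u.
  apply/eqP; rewrite eq_complex /p /lcorner !ReD !ImD !ReN !ImN /=.
  by apply/andP; split; apply/eqP; ring.
have tE4 (t : R) : a + Complex (- s) (- s + 2 * s * t) = p + t%:C%C * ('i%C * u).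
  apply/eqP; rewrite eq_complex /p /lcorner !ReD !ImD !ReN !ImN /=.
  by apply/andP; split; apply/eqP; ring.
have absr (t : R) : 0 <= t <= 1 -> `|- s + 2 * s * t| <= s.
  move=> /andP[t0 t1]; rewrite ler_norml.
  have : 0 <= s * t by rewrite mulr_ge0// ltW.
  have : s * t <= s by rewrite ler_piMr// ltW.
  by move=> ? ?; apply/andP; split; lra.
have sn : `|s| <= s by rewrite gtr0_norm.
have sn' : `|- s| <= s by rewrite normrN gtr0_norm.
have h1 : 1 <= complex.Im (1 * midsum f k p u).
  apply: midsum_Im_ge => t /absr ht; apply: (main _ _ _ _ ht sn'); last by rewrite -tE.
  by rewrite mul1r /=; lra.
have h2 : 1 <= complex.Im (1 * midsum f k (p + u) ('i%C * u)).
  apply: midsum_Im_ge => t /absr ht; apply: (main _ _ _ _ sn ht); last by rewrite -tE2.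
  by rewrite mul1r /=; lra.
have h3 : 1 <= complex.Im (-1 * midsum f k (p + 'i%C * u) u).
  apply: midsum_Im_ge => t /absr ht; apply: (main _ _ _ _ ht sn); last by rewrite -tE3.
  by rewrite mulN1r /=; lra.
have h4 : 1 <= complex.Im (-1 * midsum f k p ('i%C * u)).
  apply: midsum_Im_ge => t /absr ht; apply: (main _ _ _ _ sn' ht); last by rewrite -tE4.
  by rewrite mulN1r /=; lra.
apply: le_trans (le_trans (ler_norm _) (nm_ge_Im _)).
move: h1 h2 h3 h4; rewrite !mul1r !mulN1r /loopsum -/u !ImD; lra.
Qed.

(** Cauchy's formula with an inexact winding number: the loop sum of f(z) / (z - a) is f(a) times
    that of the kernel, up to a bounded difference quotient whose loop sum is negligible. It is at
    most 8 s * (M / s), the kernel sum is at least 4, and the quotient is the 2. *)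
Lemma square_max2 f a s (M : R) : 0 < s ->
  (forall z, square (lcorner a s) (2 * s) z -> cdiff f z) ->
  (forall z, on_rim (lcorner a s) (2 * s) z -> nm (f z) <= M) ->
  nm (f a) <= 2 * M.
Proof.
move=> s0 fd fM; set p := lcorner a s; have s20 : 0 < 2 * s by lra.
have sqa : square p (2 * s) a.
  by rewrite /p /lcorner /square !raddfB /=; split; apply/andP; split; lra.
have [d hd] := (cdiffP f a).1 (fd _ sqa).
have [r r0 hr] := hd 1 ltr01.
pose g z := (f z - f a) / (z - a).
have gb z : nm (z - a) < r -> nm (g z) <= nm d + 1.
  move=> /hr h; have [->|za] := eqVneq z a.
    by rewrite /g !subrr mul0r nm0 addr_ge0 ?nm_ge0.
  have n0 : 0 < nm (z - a) by rewrite nm_gt0 subr_eq0.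
  rewrite /g nmM nmV ler_pdivrMr//.
  have := nmD (f z - f a - d * (z - a)) (d * (z - a)); rewrite subrK nmM; lra.
have gd z : square p (2 * s) z -> z != a -> cdiff g z.
  move=> sqz za; apply: cdiffM; first by apply: cdiffB (fd _ sqz) (cdiff_cst _ _).
  by apply: cdiffV (cdiff_subr _ _); rewrite subr_eq0.
apply/ler_addgt0Pr => e e0.
have [K hK] := goursat_center s0 r0 gd gb e0.
have := hK K (leqnn K); have := @loopsum_kernel_ge a s K s0.
have b1 : nm (loopsum (fun z => f z * (z - a)^-1) K p (2 * s)) <= 8 * M.
  rewrite (_ : 8 * M = 4 * (2 * s) * (M / s)); last by field; rewrite gt_eqF.
  apply: loopsum_bound => // z hz; rewrite nmM nmV.
  have sz := square_rim_dist s0 hz.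
  have zp : 0 < nm (z - a) by apply: lt_le_trans sz.
  apply: ler_pM; rewrite ?invr_ge0 ?nm_ge0 ?fM//.
  by rewrite lef_pV2 ?posrE.
have E : loopsum (fun z => f z * (z - a)^-1) K p (2 * s) =
   f a * loopsum (fun z => (z - a)^-1) K p (2 * s) + loopsum g K p (2 * s).
  rewrite -loopsum_linear; congr (loopsum _ _ _ _); apply/funext => z.
  by rewrite /g mulrBl; ring.
move: b1; rewrite E -/p; set L := loopsum (fun z => (z - a)^-1) _ _ _; set G := loopsum g _ _ _.
move=> b1 b2 b3.
have := nm_triB (f a * L + G) G; rewrite addrK nmM.
have : nm (f a) * 4 <= nm (f a) * nm L by rewrite ler_wpM2l ?nm_ge0.
lra.
Qed.

(** For [f ^+ n] the cruder bound gives |f a|^n <= 2 M^n, and n-th roots remove the 2. *)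
Lemma square_max f a s (M : R) : 0 < s -> 0 <= M ->
  (forall z, square (lcorner a s) (2 * s) z -> cdiff f z) ->
  (forall z, on_rim (lcorner a s) (2 * s) z -> nm (f z) <= M) ->
  nm (f a) <= M.
Proof.
move=> s0 M0 fd fM; apply: (@le_of_expr_le _ _ _ 2) => // n.
have := @square_max2 (fun z => f z ^+ n) a s (M ^+ n) s0.
rewrite nmX; apply => z hz; first by apply: (cdiffX n); apply: fd.
by rewrite nmX lerXn2r ?nnegrE ?nm_ge0// fM.
Qed.

End SquareMaximum.

(** * Continuous functions of a complex variable *)

Section Continuity.
Variable R : realType.
Local Notation C := R[i].
Implicit Types (f g : C -> C) (z w a : C).

Lemma ccont_cst a z : ccont (fun=> a) z.
Proof. by move=> e e0; exists 1 => // w _; rewrite subrr nm0. Qed.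

Lemma ccont_id z : ccont id z.
Proof. by move=> e e0; exists e. Qed.

Lemma ccontD f g z : ccont f z -> ccont g z -> ccont (fun w => f w + g w) z.
Proof.
move=> cf cg e e0; have e2 : 0 < e / 2 by lra.
have [r r0 hr] := cf _ e2; have [r' r'0 hr'] := cg _ e2.
exists (Num.min r r'); first by rewrite lt_min r0.
move=> w; rewrite lt_min => /andP[/hr h1 /hr' h2].
rewrite (_ : _ - _ = (f w - f z) + (g w - g z)); last by ring.
have := nmD (f w - f z) (g w - g z); lra.
Qed.

Lemma ccontM f g z : ccont f z -> ccont g z -> ccont (fun w => f w * g w) z.
Proof.
move=> cf cg e e0.
set A := nm (f z); set B := nm (g z).
have [A0 B0] : 0 <= A /\ 0 <= B by split; exact: nm_ge0.
pose d := Num.min 1 (e / (A + B + 1)).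
have K0 : 0 < A + B + 1 by lra.
have d0 : 0 < d by rewrite lt_min ltr01 divr_gt0.
have d1 : d <= 1 by rewrite ge_min lexx.
have dK : d * (A + B + 1) <= e by rewrite -ler_pdivlMr// ge_min lexx orbT.
have [r r0 hr] := cf _ d0; have [r' r'0 hr'] := cg _ d0.
exists (Num.min r r'); first by rewrite lt_min r0.
move=> w; rewrite lt_min => /andP[/hr h1 /hr' h2].
rewrite (_ : _ - _ = (f w - f z) * (g w - g z) + f z * (g w - g z) + (f w - f z) * g z);
  last by ring.
set x := f w - f z in h1 *; set y := g w - g z in h2 *.
have := nmD (x * y + f z * y) (x * g z); have := nmD (x * y) (f z * y).
rewrite !nmM -/A -/B.
have xy : nm x * nm y <= d * nm y by rewrite ler_wpM2r ?nm_ge0 ?ltW.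
have dy : d * nm y <= 1 * nm y by rewrite ler_wpM2r ?nm_ge0.
have ay : A * nm y <= A * d := ler_wpM2l A0 (ltW h2).
have bx : nm x * B <= d * B := ler_wpM2r B0 (ltW h1).
lra.
Qed.

Lemma ccontX f n z : ccont f z -> ccont (fun w => f w ^+ n) z.
Proof.
move=> fz; elim: n => [|n IH]; first exact: ccont_cst.
rewrite (_ : (fun w => _) = fun w => f w * f w ^+ n); first exact: ccontM.
by apply/funext => w; rewrite exprS.
Qed.

Lemma ccont_nm f z : ccont f z -> ccont (fun w => (nm (f w))%:C%C) z.
Proof.
move=> cf e e0; have [r r0 hr] := cf _ e0; exists r => // w /hr hw.
rewrite -rmorphB nm_real; apply: le_lt_trans hw.
rewrite ler_norml; have := nm_triB2 (f w) (f z); have := nm_triB2 (f z) (f w).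
by rewrite nmB; move=> ? ?; apply/andP; split; lra.
Qed.

Lemma ccont_near_eq f g z (r : R) : 0 < r ->
  (forall w, nm (w - z) < r -> f w = g w) -> ccont f z -> ccont g z.
Proof.
move=> r0 fg cf e e0; have [r' r'0 hr'] := cf _ e0.
exists (Num.min r r'); first by rewrite lt_min r0.
move=> w; rewrite lt_min => /andP[h1 h2]; rewrite -fg// -fg ?hr'//.
by rewrite subrr nm0.
Qed.

(** Serves to extend identities obtained after division by Q to a zero of Q. *)
Lemma ccont_eq_off f g z : ccont f z -> ccont g z ->
  (exists2 r : R, 0 < r & forall w, nm (w - z) < r -> w != z -> f w = g w) -> f z = g z.
Proof.
move=> cf cg [r r0 fg]; apply/eqP; rewrite -subr_eq0 -nm_eq0 eq_le nm_ge0 andbT.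
apply/ler_addgt0Pr => e e0; rewrite add0r.
have [r' r'0 hr'] := ccontB cf cg e0.
pose t := Num.min r r' / 2.
have m0 : 0 < Num.min r r' by rewrite lt_min r0.
have t0 : 0 < t by rewrite divr_gt0.
have tm : t < Num.min r r' by rewrite /t; lra.
have nt : nm (z + t%:C%C - z) = t by rewrite (addrC z) addrK nm_real gtr0_norm.
have := hr' (z + t%:C%C); rewrite nt fg; last 2 first.
- by rewrite nt; move: tm; rewrite lt_min => /andP[].
- by rewrite -subr_eq0 -nm_eq0 nt gt_eqF.
move: tm; rewrite lt_min => /andP[_ tm] /(_ tm).
by rewrite subrr sub0r nmN => /ltW.
Qed.

End Continuity.
Arguments ccont_cst {R} a z.
Arguments ccont_id {R} z.

(** * The maximum principle on disks *)

Section DiskMaximum.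
Variable R : realType.
Local Notation C := R[i].
Implicit Types (f g : C -> C) (z w a : C) (rho : R).

(** Bisection on the property that every value of [u] on the disk is matched or exceeded in the
    square. If all four quarters failed, the largest of the four witnessing values would contradict
    it. *)
Lemma disk_max_attained (u : C -> R) rho : 0 < rho ->
  (forall z, nm z <= rho -> ccont (fun w => (u w)%:C%C) z) ->
  exists2 z0, nm z0 <= rho & forall w, nm w <= rho -> u w <= u z0.
Proof.
move=> rho0 uc.
pose P p s := forall w, nm w <= rho -> exists z, [/\ square p s z, nm z <= rho & u w <= u z].
have s0 : 0 < 2 * rho by lra.
have P0 : P (lcorner 0 rho) (2 * rho).
  move=> w hw; exists w; split => //; rewrite /square /lcorner !ReD !ImD !ReN !ImN /=.
  have := le_trans (nm_ge_Re w) hw; have := le_trans (nm_ge_Im w) hw.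
  by rewrite !ler_norml => /andP[? ?] /andP[? ?]; split; apply/andP; split; lra.
have Pstep p s : 0 < s -> P p s -> exists b1 b2, P (qcorner p s b1 b2) (s / 2).
  move=> sp hP; apply: contrapT => hb.
  have {}hb b1 b2 : exists2 w, nm w <= rho &
      forall z, square (qcorner p s b1 b2) (s / 2) z -> nm z <= rho -> u z < u w.
    apply: contrapT => hw; apply: hb; exists b1, b2 => w wr.
    apply: contrapT => hz; apply: hw; exists w => // z sqz zr.
    by rewrite ltNge; apply/negP => h; apply: hz; exists z.
  have mx x y : nm x <= rho -> nm y <= rho ->
      exists2 w, nm w <= rho & u x <= u w /\ u y <= u w.
    move=> hx hy; have [h|h] := leP (u x) (u y); first by exists y.
    by exists x => //; split => //; exact: ltW.
  have [w1 r1 h1] := hb false false; have [w2 r2 h2] := hb true false.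
  have [w3 r3 h3] := hb false true; have [w4 r4 h4] := hb true true.
  have [w5 r5 [h51 h52]] := mx _ _ r1 r2; have [w6 r6 [h63 h64]] := mx _ _ r3 r4.
  have [w r7 [h75 h76]] := mx _ _ r5 r6.
  have [z [sqz zr zw]] := hP _ r7.
  have [b1 [b2 sqb]] := square_cover sqz.
  by case: b1 sqb; case: b2 => sqb;
    [have := h4 _ sqb zr|have := h2 _ sqb zr|have := h3 _ sqb zr|have := h1 _ sqb zr]; lra.
have [z _ hz] := quadtree s0 P0 Pstep.
have zr : nm z <= rho.
  rewrite leNgt; apply/negP => h; have e0 : 0 < (nm z - rho) / 2 by lra.
  have [p [s [hP sp se sqz]]] := hz _ e0.
  have [|w [sqw wr _]] := hP 0; first by rewrite nm0 ltW.
  have := square_dist sp sqz sqw; have := nm_triB2 z w; lra.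
exists z => // w wr; apply/ler_addgt0Pr => e e0.
have [r r0 hr] := uc _ zr _ e0.
have r20 : 0 < r / 2 by lra.
have [p [s [hP sp se sqz]]] := hz _ r20.
have [y [sqy yr wy]] := hP _ wr.
have := hr y; rewrite -rmorphB nm_real => hy.
have := le_lt_trans (ler_norm _) (hy _).
have := square_dist sp sqy sqz => d1 d2.
have yz : nm (y - z) < r by lra.
by have := d2 yz; lra.
Qed.

Lemma disk_bounded f rho : 0 < rho -> (forall z, nm z <= rho -> ccont f z) ->
  exists2 M, 0 <= M & forall z, nm z <= rho -> nm (f z) <= M.
Proof.
move=> rho0 fc; have [|z0 _ h] := @disk_max_attained (fun z => nm (f z)) rho rho0.
  by move=> z /fc; exact: ccont_nm.
by exists (nm (f z0)) => //; exact: nm_ge0.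
Qed.

(* Maximising |f|^2 (1 + eps |z|^2): at an interior maximum z0, multiplying f by
   1 + c (z - z0) would create a strict local maximum of the modulus. *)
Lemma disk_max_cdiff f rho (M : R) : 0 < rho -> 0 <= M ->
  (forall z, nm z <= rho -> cdiff f z) ->
  (forall z, nm z = rho -> nm (f z) <= M) ->
  forall a, nm a <= rho -> nm (f a) <= M.
Proof.
move=> rho0 M0 fd fM a ar; rewrite -ler_sqr ?nnegrE ?nm_ge0//.
suff key (eps : R) : 0 < eps -> nm (f a) ^+ 2 <= M ^+ 2 * (1 + eps * rho ^+ 2).
  apply/ler_addgt0Pr => e e0.
  have K1 : 0 <= M ^+ 2 * rho ^+ 2 by rewrite mulr_ge0// sqr_ge0.
  have K0 : 0 < M ^+ 2 * rho ^+ 2 + 1 by lra.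
  apply: le_trans (key _ (divr_gt0 e0 K0)) _.
  rewrite mulrDr mulr1 lerD2l (_ : _ * _ = e * (M ^+ 2 * rho ^+ 2) / (M ^+ 2 * rho ^+ 2 + 1)).
    by rewrite ler_pdivrMr// ler_wpM2l ?lerDl// ltW.
  by move: (M ^+ 2 * rho ^+ 2 + 1) => K; ring.
move=> e0.
pose psi z : R := 1 + eps * nm z ^+ 2.
have psi1 z : 1 <= psi z by rewrite /psi lerDl mulr_ge0 ?sqr_ge0// ltW.
have psiB z : nm z <= rho -> psi z <= 1 + eps * rho ^+ 2.
  by move=> h; rewrite lerD2l ler_pM2l// lerXn2r ?nnegrE ?nm_ge0// ltW.
pose u z : R := nm (f z) ^+ 2 * psi z.
have uc z : nm z <= rho -> ccont (fun w => (u w)%:C%C) z.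
  move=> /fd/cdiff_ccont/ccont_nm fc.
  rewrite (_ : (fun w => _) = fun w => (nm (f w))%:C%C ^+ 2 *
      (1 + eps%:C%C * (nm w)%:C%C ^+ 2)); last first.
    by apply/funext => w; rewrite /u /psi rmorphM rmorphXn rmorphD rmorphM rmorphXn rmorph1.
  apply: ccontM; first exact: ccontX.
  apply: ccontD; first exact: ccont_cst.
  apply: ccontM; first exact: ccont_cst.
  exact/ccontX/ccont_nm/ccont_id.
have [z0 z0r hz0] := disk_max_attained rho0 uc.
have [z0b|z0b] := eqVneq (nm z0) rho.
  apply: le_trans (_ : u a <= _).
    by rewrite /u ler_peMr ?sqr_ge0.
  apply: le_trans (hz0 _ ar) _; rewrite /u.
  apply: ler_pM; rewrite ?sqr_ge0 ?psiB//; first by rewrite (le_trans ler01).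
  by rewrite lerXn2r ?nnegrE ?nm_ge0// fM.
have z0l : nm z0 < rho by rewrite lt_neqAle z0b.
have [f0|f0] := eqVneq (f z0) 0.
  have ua : u a <= 0 by have := hz0 _ ar; rewrite {2}/u f0 nm0 expr0n mul0r.
  apply: le_trans (_ : u a <= _); first by rewrite /u ler_peMr ?sqr_ge0.
  apply: le_trans ua _; rewrite mulr_ge0 ?sqr_ge0// addr_ge0// mulr_ge0 ?sqr_ge0//.
  exact: ltW.
exfalso.
(* Points of a square of side 2 s are at most 4 s apart, so the square stays inside the disk. *)
pose s := (rho - nm z0) / 4; have s0 : 0 < s by rewrite /s; lra.
have s20 : 0 < 2 * s by lra.
have sq0 : square (lcorner z0 s) (2 * s) z0.
  by rewrite /square /lcorner !ReD !ImD !ReN !ImN /=; split; apply/andP; split; lra.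
have sqr z : square (lcorner z0 s) (2 * s) z -> nm z <= rho.
  move=> sqz; have := square_dist s20 sqz sq0; have := nm_triB2 z z0.
  by rewrite /s; lra.
(* With this [c], |1 + c (z - z0)|^2 agrees with psi z / psi z0 to first order at [z0] and falls
   short of it by eps |z - z0|^2 / (psi z0)^2. *)
pose k := eps / psi z0; pose c := k%:C%C * (z0^*)%C.
pose g z := (f z * (1 + c * (z - z0))) ^+ 2.
have gd z : square (lcorner z0 s) (2 * s) z -> cdiff g z.
  move=> /sqr/fd fz; apply: cdiffX; apply: (cdiffM fz).
  apply: (cdiffD (cdiff_cst 1 z)); exact: (cdiffM (cdiff_cst c z) (cdiff_subr z0 z)).
pose B := 1 + eps * rho ^+ 2.
have B1 : 1 <= B by rewrite /B lerDl mulr_ge0 ?sqr_ge0// ltW.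
have Bp : 0 < B by lra.
(* The relative deficit on the rim, where |z - z0| >= s and both values of [psi] are at most [B]. *)
pose kap := eps * s ^+ 2 / B ^+ 2.
have B20 : 0 < B ^+ 2 by rewrite exprn_gt0//; lra.
have kap0 : 0 < kap by rewrite divr_gt0// mulr_gt0// exprn_gt0.
have sr : s <= rho by rewrite /s; have := nm_ge0 z0; lra.
have kap1 : kap <= 1.
  rewrite ler_pdivrMr// mul1r; apply: le_trans (_ : B <= _); last by rewrite expr2 ler_peMl//; lra.
  have : eps * s ^+ 2 <= eps * rho ^+ 2 by rewrite ler_pM2l// lerXn2r ?nnegrE// ltW.
  by rewrite /B; lra.
have F0 : 0 < nm (f z0) ^+ 2 by rewrite exprn_gt0// nm_gt0.
have := @square_max _ g z0 s (nm (f z0) ^+ 2 * (1 - kap)) s0 _ gd.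
rewrite {2}/g subrr mulr0 addr0 mulr1 nmX => hh.
have {hh} : nm (f z0) ^+ 2 <= nm (f z0) ^+ 2 * (1 - kap).
  apply: hh; first by rewrite mulr_ge0 ?sqr_ge0//; lra.
  move=> z hz; have sz := square_rim_dist s0 hz; have zr := sqr _ hz.1.
  rewrite /g exprMn nmM nmX nmX.
  have p0 : 0 < psi z0 by have := psi1 z0; lra.
  have pz : 0 < psi z by have := psi1 z; lra.
  have E : nm (1 + c * (z - z0)) ^+ 2 =
      psi z / psi z0 * (1 - eps * nm (z - z0) ^+ 2 / (psi z0 * psi z)).
    have -> : psi z / psi z0 * (1 - eps * nm (z - z0) ^+ 2 / (psi z0 * psi z)) =
      psi z / psi z0 - eps * nm (z - z0) ^+ 2 / psi z0 ^+ 2.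
      by field; rewrite !gt_eqF.
    have n0 : psi z0 != 0 by rewrite gt_eqF.
    have D : psi z = psi z0 + eps * (2 * (complex.Re z0 * complex.Re (z - z0) +
        complex.Im z0 * complex.Im (z - z0)) + nm (z - z0) ^+ 2).
      by rewrite /psi !nm_sqr !ReD !ImD !ReN !ImN; ring.
    have D0 : eps * nm z0 ^+ 2 = psi z0 - 1 by rewrite /psi; ring.
    rewrite D nm_sqr [nm (z - z0) ^+ 2]nm_sqr /c /k; move: D0; rewrite nm_sqr.
    move: (psi z0) n0 => q q0; case: (z - z0) => h1 h2; case: (z0) => x y /= D0.
    rewrite !mul0r !subr0 !addr0 !add0r.
    have -> : q = eps * (x ^+ 2 + y ^+ 2) + 1 by rewrite D0; ring.
    by field; rewrite D0 subrK.
  have h1 : 1 - eps * nm (z - z0) ^+ 2 / (psi z0 * psi z) <= 1 - kap.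
    rewrite lerD2l lerN2 /kap; apply: ler_pM.
    - by rewrite mulr_ge0 ?sqr_ge0// ltW.
    - by rewrite invr_ge0 ltW.
    - by rewrite ler_pM2l// lerXn2r ?nnegrE ?nm_ge0// ltW.
    - rewrite lef_pV2 ?posrE ?mulr_gt0//.
      by rewrite expr2; apply: ler_pM; [exact: ltW|exact: ltW|exact: psiB|exact: psiB].
  rewrite E mulrA.
  have h2 : nm (f z) ^+ 2 * (psi z / psi z0) <= nm (f z0) ^+ 2.
    by rewrite mulrA ler_pdivrMr//; exact: hz0.
  have h3 : 0 <= nm (f z) ^+ 2 * (psi z / psi z0) by rewrite mulr_ge0 ?sqr_ge0// divr_ge0// ltW.
  apply: le_trans (ler_wpM2l h3 h1) _.
  by rewrite ler_wpM2r// subr_ge0.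
rewrite mulrBr mulr1 => ?; have := mulr_gt0 F0 kap0; lra.
Qed.

Lemma avoid_points (es : seq C) a (r : R) : 0 < r ->
  exists t : R, [/\ 0 < t, t < r & a + t%:C%C \notin es].
Proof.
elim: es r => [|e es IH] r r0; first by exists (r / 2); split => //; lra.
have [t [t0 tr te]] := IH _ r0.
have [E|ne] := eqVneq (a + t%:C%C) e; last by exists t; split; rewrite // inE negb_or ne.
have [t' [t'0 t't t'e]] := IH _ t0; exists t'; split => //; first exact: lt_trans tr.
rewrite inE negb_or t'e andbT -E; apply/negP => /eqP/addrI/complexI tt.
by rewrite tt ltxx in t't.
Qed.

(** Continuity suffices because the difference quotient at [a] is [f] itself. *)
Lemma cdiff_mul_sub f a : ccont f a -> cdiff (fun z => f z * (z - a)) a.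
Proof.
move=> fc; apply/cdiffP; exists (f a) => e e0; have [r r0 hr] := fc _ e0.
exists r => // w /hr hw; rewrite subrr mulr0 subr0 -mulrBl nmM ler_wpM2r ?nm_ge0//.
exact: ltW.
Qed.

(** Multiplying [f ^+ n] by the product of the z - e over the exceptional points makes it
    differentiable there too, and n-th roots remove the factor. The exceptional points themselves
    follow by continuity. *)
Lemma disk_max f (es : seq C) rho (M : R) : 0 < rho -> 0 <= M ->
  (forall z, nm z <= rho -> ccont f z) ->
  (forall z, nm z <= rho -> z \notin es -> cdiff f z) ->
  (forall z, nm z = rho -> nm (f z) <= M) ->
  forall a, nm a < rho -> nm (f a) <= M.
Proof.
move=> rho0 M0 fc fd fM.
pose E z : C := \prod_(e <- es) (z - e).
have Ed s z : cdiff (fun z => \prod_(e <- s) (z - e)) z.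
  elim: s => [|e s IH].
    rewrite (_ : (fun z => _) = fun=> 1); first exact: cdiff_cst.
    by apply/funext => w; rewrite big_nil.
  rewrite (_ : (fun z => _) = fun z => (z - e) * \prod_(e <- s) (z - e)).
    exact: (cdiffM (cdiff_subr e z) IH).
  by apply/funext => w; rewrite big_cons.
have Fd n z : nm z <= rho -> cdiff (fun z => f z ^+ n * E z) z.
  move=> zr; have [zin|zout] := boolP (z \in es); last first.
    exact: (cdiffM (cdiffX n (fd _ zr zout)) (Ed es z)).
  rewrite (_ : (fun z => _) = fun w => f w ^+ n * (w - z) * \prod_(e <- rem z es) (w - e)).
    apply: cdiffM (Ed _ z); apply: cdiff_mul_sub; exact/ccontX/fc.
  by apply/funext => w; rewrite /E (perm_big _ (perm_to_rem zin)) big_cons mulrA.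
have [L L0 EL] : exists2 L : R, 0 <= L & forall z, nm z <= rho -> nm (E z) <= L.
  by apply: disk_bounded => // z _; exact: cdiff_ccont (Ed es z).
have off a : nm a <= rho -> a \notin es -> nm (f a) <= M.
  move=> ar aout; have Ea : 0 < nm (E a).
    rewrite nm_gt0 /E prodf_seq_neq0; apply/allP => e ein; rewrite subr_eq0 /=.
    by apply: contra aout => /eqP ->.
  apply: (@le_of_expr_le _ _ _ (L / nm (E a))) => // n.
  rewrite mulrAC ler_pdivlMr// -nmX -nmM.
  apply: (disk_max_cdiff (f := fun z => f z ^+ n * E z) rho0) => //.
  - by rewrite mulr_ge0// exprn_ge0.
  - exact: Fd.
  - move=> z zr; rewrite nmM nmX mulrC; apply: ler_pM; rewrite ?exprn_ge0 ?nm_ge0//.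
      by rewrite EL// zr.
    by rewrite lerXn2r ?nnegrE ?nm_ge0// fM.
move=> a ar; apply/ler_addgt0Pr => e e0.
have [r r0 hr] := fc _ (ltW ar) _ e0.
have m0 : 0 < Num.min r (rho - nm a) by rewrite lt_min r0 subr_gt0.
have [t [t0 tm tes]] := avoid_points es a m0.
move: tm; rewrite lt_min => /andP[tr tr'].
have nt : nm (a + t%:C%C - a) = t by rewrite (addrC a) addrK nm_real gtr0_norm.
have h1 := hr (a + t%:C%C); rewrite nt in h1; have {}h1 := h1 tr.
have h2 : nm (a + t%:C%C) <= rho.
  by apply: le_trans (nmD _ _) _; rewrite nm_real gtr0_norm//; lra.
have := off _ h2 tes; have := nm_triB2 (f a) (f (a + t%:C%C)); rewrite nmB; lra.
Qed.

End DiskMaximum.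

(** * Cauchy's criterion *)

Section Completeness.
Variable R : realType.
Local Notation C := R[i].

Lemma real_cauchy_seq (u : nat -> R) :
  (forall e, 0 < e -> exists N, forall m n, (N <= m)%N -> (N <= n)%N -> `|u m - u n| <= e) ->
  exists l, forall e, 0 < e -> exists N, forall n, (N <= n)%N -> `|u n - l| <= e.
Proof.
move=> hu; have cu : cvg (u @ \oo).
  apply: cauchy_cvg; apply: cauchy_exP => e e0.
  have e2 : 0 < e / 2 by rewrite divr_gt0.
  have [N hN] := hu _ e2; exists (u N); exists N => // n Nn.
  change (`|u N - u n| < e); apply: le_lt_trans (hN _ _ (leqnn N) Nn) _; lra.
exists (lim (u @ \oo)) => e e0.
have /cvgrPdist_le/(_ _ e0)[N _ hN] := cu.
by exists N => n /hN; rewrite distrC.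
Qed.

Lemma complex_cauchy_seq (u : nat -> C) :
  (forall e, 0 < e -> exists N, forall m n, (N <= m)%N -> (N <= n)%N -> nm (u m - u n) <= e) ->
  exists l, forall e, 0 < e -> exists N, forall n, (N <= n)%N -> nm (u n - l) <= e.
Proof.
move=> hu.
have [x hx] : exists l, forall e, 0 < e -> exists N, forall n, (N <= n)%N ->
    `|complex.Re (u n) - l| <= e.
  apply: real_cauchy_seq => e /hu[N hN]; exists N => m n Nm Nn.
  by apply: le_trans (hN _ _ Nm Nn); have := nm_ge_Re (u m - u n); rewrite ReD ReN.
have [y hy] : exists l, forall e, 0 < e -> exists N, forall n, (N <= n)%N ->
    `|complex.Im (u n) - l| <= e.
  apply: real_cauchy_seq => e /hu[N hN]; exists N => m n Nm Nn.
  by apply: le_trans (hN _ _ Nm Nn); have := nm_ge_Im (u m - u n); rewrite ImD ImN.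
exists (Complex x y) => e e0; have e2 : 0 < e / 2 by lra.
have [N1 h1] := hx _ e2; have [N2 h2] := hy _ e2; exists (N1 + N2)%N => n hn.
apply: le_trans (nm_le_ReIm _) _; rewrite ReD ReN ImD ImN /=.
have := h1 n (leq_trans (leq_addr _ _) hn); have := h2 n (leq_trans (leq_addl _ _) hn); lra.
Qed.

Lemma complex_cauchy_at0 (phi : C -> C) :
  (forall e : R, 0 < e -> exists2 r : R, 0 < r & forall w w', w != 0 -> w' != 0 ->
    nm w < r -> nm w' < r -> nm (phi w - phi w') <= e) ->
  exists l, forall e : R, 0 < e -> exists2 r : R, 0 < r & forall w, w != 0 ->
    nm w < r -> nm (phi w - l) <= e.
Proof.
move=> hphi; pose v n : C := (n.+1%:R^-1 : R)%:C%C.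
have v0 n : v n != 0 by rewrite -nm_eq0 nm_real normr_eq0 invr_eq0 pnatr_eq0.
have vr r : 0 < r -> exists N, forall n, (N <= n)%N -> nm (v n) < r.
  move=> r0; exists (Num.truncn r^-1) => n hn.
  rewrite nm_real ger0_norm ?invr_ge0// invf_plt ?posrE ?ltr0n//.
  by apply: lt_le_trans (truncnS_gt _) _; rewrite ler_nat ltnS.
have [|l hl] := @complex_cauchy_seq (fun n => phi (v n)).
  move=> e /hphi[r /vr[N hN] hr]; exists N => m n Nm Nn.
  by apply: hr => //; exact: hN.
exists l => e e0; have e2 : 0 < e / 2 by lra.
have [r r0 hr] := hphi _ e2; have [N1 h1] := vr _ r0; have [N2 h2] := hl _ e2.
exists r => // w w0 wr; pose n := (N1 + N2)%N.
have := hr _ _ w0 (v0 n) wr (h1 n (leq_addr _ _)).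
have := h2 n (leq_addl _ _); have := nm_dist_tri (phi (v n)) (phi w) l; lra.
Qed.

End Completeness.

(** * Removable singularities and Taylor tails *)

Section Taylor.
Variable R : realType.
Local Notation C := R[i].
Implicit Types (f g : C -> C) (z w a d : C) (rho : R).

Definition divdiff f a d z := if z == a then d else (f z - f a) / (z - a).

Lemma divdiff_near f a d z w : z != a -> nm (w - z) < nm (z - a) ->
  (f w - f a) / (w - a) = divdiff f a d w.
Proof.
move=> za h; rewrite /divdiff ifN//; apply/negP => /eqP wa.
by rewrite wa nmB ltxx in h.
Qed.

Lemma cdiff_divdiff f a d z : z != a -> cdiff f z -> cdiff (divdiff f a d) z.
Proof.
move=> za fz; have r0 : 0 < nm (z - a) by rewrite nm_gt0 subr_eq0.
apply: (cdiff_near_eq (fun w => (f w - f a) / (w - a)) r0).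
  by move=> w; exact: divdiff_near.
apply: (cdiffM (cdiffB fz (cdiff_cst _ _))).
by apply: cdiffV (cdiff_subr _ _); rewrite subr_eq0.
Qed.

Lemma ccont_divdiff f a d z : z != a -> ccont f z -> ccont (divdiff f a d) z.
Proof.
move=> za fz; have r0 : 0 < nm (z - a) by rewrite nm_gt0 subr_eq0.
apply: (@ccont_near_eq _ (fun w => (f w - f a) / (w - a)) _ _ _ r0).
  by move=> w; exact: divdiff_near.
apply: (ccontM (ccontB fz (ccont_cst _ _))); apply: cdiff_ccont.
by apply: cdiffV (cdiff_subr _ _); rewrite subr_eq0.
Qed.

Lemma ccont_divdiff_at f a d : cderiv f a d -> ccont (divdiff f a d) a.
Proof.
move=> hd e e0; have e2 : 0 < e / 2 by lra.
have [r r0 hr] := hd _ e2; exists r => // w /hr hw.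
rewrite /divdiff eqxx; case: eqVneq => [_|wa]; first by rewrite subrr nm0.
have n0 : 0 < nm (w - a) by rewrite nm_gt0 subr_eq0.
rewrite (_ : _ - d = (f w - f a - d * (w - a)) / (w - a)); last by field; rewrite subr_eq0.
by rewrite nmM nmV ltr_pdivrMr//; apply: le_lt_trans hw _; rewrite ltr_pM2r//; lra.
Qed.

(** The quotients phi(w) = (g w - g 0) / w are Cauchy as w tends to 0: phi w - phi w' is the value
    at 0 of a difference of two divided differences, which is small on |z| = 1/2 when w and w' are
    close to 0, hence small at 0 by the maximum principle. *)
Lemma removable_singularity g : (forall z, nm z < 1 -> ccont g z) ->
  (forall z, nm z < 1 -> z != 0 -> cdiff g z) -> cdiff g 0.
Proof.
move=> gc gd; have half0 : 0 < 1 / 2 :> R by lra.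
have [|B B0 gB] := @disk_bounded _ g (1 / 2) half0.
  by move=> z hz; apply: gc; lra.
pose phi w := (g w - g 0) / w.
have [|l hl] := @complex_cauchy_at0 _ phi.
  move=> e e0.
  have e1 : 0 < e / 64 by lra.
  have lt01' : nm (0 : C) < 1 by rewrite nm0.
  have [r1 r10 hr1] := gc 0 lt01' _ e1.
  (* On |z| = 1/2 the denominators have modulus at least 1/16; the two parts of the numerator are
     each at most e / 32. *)
  pose r := Num.min (Num.min r1 (1 / 4)) (e / (128 * (B + 1))).
  have B1 : 0 < 128 * (B + 1) by lra.
  have r4 : 0 < 1 / 4 :> R by lra.
  have eB := divr_gt0 e0 B1.
  have r0 : 0 < r by rewrite !lt_min r10 r4 eB.
  exists r => // w w' w0 w'0; rewrite /r !lt_min => /andP[/andP[wr1 wq] wB] /andP[/andP[w'r1 w'q] w'B].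
  have w1 : nm w < 1 by lra.
  have w'1 : nm w' < 1 by lra.
  have /cdiffP[d hd] := gd w w1 w0; have /cdiffP[d' hd'] := gd w' w'1 w'0.
  pose G z := divdiff g w d z - divdiff g w' d' z.
  have -> : phi w - phi w' = G 0.
    rewrite /G /divdiff !ifN 1?eq_sym// /phi; field.
    by rewrite ?oppr_eq0 w0 ?w'0.
  have cdw v e' z : nm v < 1 -> v != 0 -> cderiv g v e' -> nm z < 1 -> ccont (divdiff g v e') z.
    move=> v1 v0 he' z1; have [->|zv] := eqVneq z v; first exact: ccont_divdiff_at.
    by apply: ccont_divdiff => //; exact: gc.
  (* [G] is only known to be continuous at these points: at 0 because of [g], at w and w' because of
     the divided differences. *)
  apply: (@disk_max _ G [:: 0; w; w'] (1 / 2)) => //.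
  - exact: ltW.
  - move=> z hz; apply: ccontB; apply: cdw => //; clear - hz; lra.
  - move=> z hz; rewrite !inE !negb_or => /and3P[z0 zw zw'].
    have z1 : nm z < 1 by clear - hz; lra.
    by apply: cdiffB; apply: cdiff_divdiff => //; exact: gd.
  - move=> z hz.
    have n1 : 1 / 4 <= nm (z - w) by have := nm_triB2 z w; clear - hz wq; lra.
    have n2 : 1 / 4 <= nm (z - w') by have := nm_triB2 z w'; clear - hz w'q; lra.
    have n3 : nm (z - w) <= 1 by have := nm_triB z w; clear - hz wq; lra.
    have p1 : 0 < nm (z - w) by clear - n1; lra.
    have p2 : 0 < nm (z - w') by clear - n2; lra.
    have zw : z - w != 0 by rewrite -nm_gt0.
    have zw' : z - w' != 0 by rewrite -nm_gt0.
    have E : G z = ((g z - g w) * (w - w') - (g w - g w') * (z - w)) / ((z - w) * (z - w')).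
      have zw0 : z != w by rewrite -subr_eq0.
      have zw'0 : z != w' by rewrite -subr_eq0.
      rewrite /G /divdiff (negbTE zw0) (negbTE zw'0).
      by field; rewrite ?zw ?zw'.
    rewrite E nmM nmV nmM ler_pdivrMr ?mulr_gt0//.
    have q : 1 / 16 <= nm (z - w) * nm (z - w').
      rewrite (_ : 1 / 16 = 1 / 4 * (1 / 4)); last by field.
      by apply: ler_pM => //; lra.
    have eq1 : e * (1 / 16) <= e * (nm (z - w) * nm (z - w')) by rewrite ler_pM2l.
    have b1 : nm (g z - g w) <= 2 * B.
      have gz := gB z; have gw := gB w; have := nm_triB (g z) (g w).
      have := gz _; have := gw _; rewrite hz; move=> Hw Hz Ht.
      have w2 : nm w <= 1 / 2 by clear - wq; lra.
      by have := Hw w2; have := Hz (lexx _); move: Ht; clear; lra.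
    have b2 : nm (w - w') <= nm w + nm w' := nm_triB _ _.
    have b3 : nm (g w - g w') <= e / 32.
      have g1 := hr1 w; have g2 := hr1 w'; rewrite !subr0 in g1 g2.
      have := g1 wr1; have := g2 w'r1; have := nm_dist_tri (g 0) (g w) (g w'); rewrite (nmB (g 0)).
      by clear; lra.
    have b4 : 2 * B * (nm w + nm w') <= e / 32.
      move: wB w'B; rewrite !ltr_pdivlMr// => h1 h2.
      by have := nm_ge0 w; have := nm_ge0 w'; move: h1 h2; clear; lra.
    have b5 : nm (g z - g w) * nm (w - w') <= 2 * B * (nm w + nm w').
      by apply: ler_pM; rewrite ?nm_ge0.
    have b6 : nm (g w - g w') * nm (z - w) <= e / 32 * 1.
      by apply: ler_pM; rewrite ?nm_ge0.
    have := nm_triB ((g z - g w) * (w - w')) ((g w - g w') * (z - w)); rewrite !nmM.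
    by move: eq1 b4 b5 b6; clear; lra.
  - by rewrite nm0.
apply/cdiffP; exists l => e e0; have [r r0 hr] := hl _ e0; exists r => // w; rewrite !subr0 => wr.
have [->|w0] := eqVneq w 0; first by rewrite subrr mulr0 subrr nm0 mulr0.
have := hr _ w0 wr; rewrite (_ : g w - g 0 - l * w = (phi w - l) * w); last by rewrite /phi; field.
by rewrite nmM ler_pM2r ?nm_gt0.
Qed.

Definition holo f := forall z, nm z < 1 -> cdiff f z.

Lemma holo_div_z f : holo f -> exists2 g, holo g & forall z, f z = f 0 + z * g z.
Proof.
move=> fd; have n01 : nm (0 : C) < 1 by rewrite nm0.
have /cdiffP[d hd] := fd _ n01.
exists (divdiff f 0 d); last first.
  move=> z; rewrite /divdiff; case: eqVneq => [->|z0]; first by rewrite mul0r addr0.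
  by rewrite subr0 mulrC divfK// addrC subrK.
have off z : nm z < 1 -> z != 0 -> cdiff (divdiff f 0 d) z.
  by move=> z1 z0; apply: cdiff_divdiff => //; exact: fd.
move=> z z1; have [->|z0] := eqVneq z 0; last exact: off.
apply: removable_singularity => // w w1; have [->|w0] := eqVneq w 0.
  exact: ccont_divdiff_at.
exact/cdiff_ccont/off.
Qed.

(** [F n] is the tail f_n and [F n 0] the coefficient a_n, so neither higher derivatives nor
    convergent series are needed. *)
Definition taylor_chain (F : nat -> C -> C) :=
  (forall n, holo (F n)) /\ (forall n z, F n z = F n 0 + z * F n.+1 z).

Lemma taylor_chain_exists f : holo f -> exists2 F, taylor_chain F & F 0%N = f.
Proof.
move=> fd; have [D hD] : {D : (C -> C) -> (C -> C) & forall f, holo f ->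
    holo (D f) /\ forall z, f z = f 0 + z * D f z}.
  apply: (@choice _ _ (fun f g => holo f -> holo g /\ forall z, f z = f 0 + z * g z)) => h.
  have [hh|nh] := pselect (holo h); last by exists h.
  by have [g gd gE] := holo_div_z hh; exists g.
exists (fun n => iter n D f); last by [].
have H n : holo (iter n D f).
  by elim: n => [|n IH]; [exact: fd|exact: (hD _ IH).1].
by split; [exact: H|move=> n; exact: (hD _ (H n)).2].
Qed.

Lemma taylor_chain_poly F n : taylor_chain F ->
  exists2 p : {poly C}, (size p <= n)%N & forall z, F 0%N z = p.[z] + z ^+ n * F n z.
Proof.
move=> [_ hF]; elim: n => [|n [p ps pE]].
  by exists 0; rewrite ?size_poly0// => z; rewrite horner0 add0r mul1r.
exists (p + (F n 0)%:P * 'X^n).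
  rewrite (leq_trans (size_polyD _ _))// geq_max (leq_trans ps)//=.
  rewrite (leq_trans (size_polyMleq _ _))// size_polyXn addnS /=.
  by rewrite (leq_trans (leq_add (size_polyC_leq1 _) (leqnn _))).
move=> z; rewrite pE hF !hornerE exprS; ring.
Qed.

Lemma holo_max f rho (M : R) : 0 < rho -> rho < 1 -> 0 <= M -> holo f ->
  (forall z, nm z = rho -> nm (f z) <= M) -> forall a, nm a <= rho -> nm (f a) <= M.
Proof.
move=> r0 r1 M0 fd fM; apply: disk_max_cdiff => // z zr.
by apply: fd; exact: le_lt_trans r1.
Qed.

Lemma holo_bounded f rho : 0 < rho -> rho < 1 -> holo f ->
  exists2 M, 0 <= M & forall z, nm z <= rho -> nm (f z) <= M.
Proof.
move=> r0 r1 fd; apply: disk_bounded => // z zr; apply: cdiff_ccont.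
by apply: fd; exact: le_lt_trans r1.
Qed.

(** As [f] vanishes near 0, all f / z^k are holomorphic, and the maximum principle on |z| = t gives
    |f a| <= M (|a| / t)^k. *)
Lemma holo_identity f rho : 0 < rho -> holo f ->
  (forall z, nm z <= rho -> f z = 0) -> forall z, nm z < 1 -> f z = 0.
Proof.
move=> r0 fd f0 a a1; have [ar|ar] := leP (nm a) rho; first exact: f0.
pose t := (nm a + 1) / 2.
have [ta t1] : nm a < t /\ t < 1 by rewrite /t; split; lra.
have t0 : 0 < t by have := nm_ge0 a; lra.
have [M M0 hM] := holo_bounded t0 t1 fd.
apply/eqP; rewrite -nm_eq0 eq_le nm_ge0 andbT.
have key k : nm (f a) <= M * (nm a / t) ^+ k.
  have gd : holo (fun z => f z / z ^+ k).
    move=> z z1; have [zr|zr] := leP (nm z) (rho / 2).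
      have r20 : 0 < rho / 2 by lra.
      apply: (cdiff_near_eq (fun=> 0) r20); last exact: cdiff_cst.
      move=> w wz; rewrite f0 ?mul0r//; have := nm_triB2 w z; lra.
    apply: (cdiffM (fd _ z1)); apply: cdiffV; last exact/cdiffX/cdiff_id.
    by rewrite expf_neq0// -nm_gt0; lra.
  have tk : 0 < t ^+ k by rewrite exprn_gt0.
  rewrite (_ : M * _ = M / t ^+ k * nm a ^+ k); last by rewrite expr_div_n; ring.
  have := @holo_max (fun z => f z / z ^+ k) t (M / t ^+ k) t0 t1 _ gd _ a (ltW ta).
  have ak : 0 < nm a ^+ k by rewrite exprn_gt0//; lra.
  rewrite nmM nmV nmX ler_pdivrMr//; apply.
    by rewrite divr_ge0// ltW.
  by move=> z zt; rewrite nmM nmV nmX zt ler_pM2r ?invr_gt0// hM// zt.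
apply/ler_addgt0Pr => e e0; rewrite add0r.
have K0 : 0 < M + 1 by lra.
have q1 : nm a / t < 1 by rewrite ltr_pdivrMr// mul1r.
have q0 : 0 <= nm a / t by rewrite divr_ge0 ?nm_ge0// ltW.
have [N hN] := expr_small q0 q1 (divr_gt0 e0 K0).
apply: le_trans (key N) _; have := hN N (leqnn N); rewrite ler_pdivlMr// => h.
have : 0 <= (nm a / t) ^+ N by rewrite exprn_ge0.
lra.
Qed.

(** Peeling off one constant term, h = p(0) + z h_1, costs a factor 2 / rho by the maximum
    principle. This replaces Cauchy's estimates; the exponential loss is later beaten by theta^N. *)
Lemma poly_part_bound rho (M : R) m : 0 < rho -> rho < 1 ->
  forall (h u : C -> C) (p : {poly C}), holo u -> (size p <= m)%N ->
  (forall z, nm z < 1 -> h z = p.[z] + z ^+ m * u z) ->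
  (forall z, nm z <= rho -> nm (h z) <= M) ->
  (forall z, nm z <= rho -> nm (u z) <= (2 / rho) ^+ m * M) /\
  (forall z, nm z <= 1 -> nm p.[z] <= m%:R * (2 / rho) ^+ m * M).
Proof.
move=> r0 r1.
have q1 : 1 <= 2 / rho by rewrite ler_pdivlMr//; lra.
elim: m M => [|m IH] M h u p ud ps hE hM.
  move: ps; rewrite leqn0 size_poly_eq0 => /eqP p0; split.
    move=> z zr; have := hM z zr; rewrite hE; last by apply: le_lt_trans r1.
    by rewrite p0 horner0 add0r !expr0 !mul1r.
  by move=> z _; rewrite p0 horner0 nm0 !mul0r.
have n0r : nm (0 : C) <= rho by rewrite nm0 ltW.
have M0 : 0 <= M := le_trans (nm_ge0 _) (hM _ n0r).
pose p' := p %/ 'X.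
have pE : p = p' * 'X + (p.[0])%:P.
  have := divp_eq p 'X; rewrite -{3}['X]subr0 -polyC0 modp_XsubC; exact.
have p's : (size p' <= m)%N.
  by rewrite /p' size_divp ?polyX_eq0// size_polyX /= leq_subLR add1n.
pose h1 z := p'.[z] + z ^+ m * u z.
have h1d : holo h1.
  move=> z z1; apply: (cdiffD (cdiff_horner _ _)).
  exact: (cdiffM (cdiffX m (cdiff_id z)) (ud _ z1)).
have hE1 z : nm z < 1 -> h z = p.[0] + z * h1 z.
  by move=> z1; rewrite hE// {1}pE !hornerE /h1 exprS; ring.
have p0M : nm p.[0] <= M.
  have n01 : nm (0 : C) < 1 by rewrite nm0.
  by have := hM _ n0r; rewrite hE1// mul0r addr0.
have h1M z : nm z <= rho -> nm (h1 z) <= 2 / rho * M.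
  apply: holo_max => //; first by rewrite mulr_ge0//; lra.
  move=> w wr; have w1 : nm w < 1 by rewrite wr.
  have := hM w; rewrite wr => /(_ (lexx _)) hw.
  have : nm (w * h1 w) <= 2 * M.
    have -> : w * h1 w = h w - p.[0] by rewrite hE1//; ring.
    have := nm_triB (h w) p.[0]; lra.
  by rewrite nmM wr mulrAC ler_pdivlMr// mulrC.
have [H1 H2] := IH _ h1 u p' ud p's (fun z _ => erefl) h1M.
split=> [z zr|z z1].
  by apply: le_trans (H1 z zr) _; rewrite exprSr mulrA.
rewrite {1}pE !hornerE; apply: le_trans (nmD _ _) _; rewrite nmM.
have a1 : nm p'.[z] * nm z <= m%:R * (2 / rho) ^+ m * (2 / rho * M).
  have H2z := H2 _ z1; rewrite -[leRHS]mulr1; apply: ler_pM => //; exact: nm_ge0.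
have a2 : M <= (2 / rho) ^+ m.+1 * M by rewrite ler_peMl// exprn_ege1.
rewrite -natr1 mulrDl mul1r mulrDl.
apply: lerD; last exact: le_trans p0M a2.
by apply: le_trans a1 _; rewrite exprSr !mulrA.
Qed.

End Taylor.

(** * Zeros, Blaschke products and small combinations of tails *)

Section Zeros.
Variable R : realType.
Local Notation C := R[i].
Implicit Types (f g h : C -> C) (z w a : C).

Lemma conjc_factor_id (T : R) z w :
  nm ((T ^+ 2)%:C%C - (w^*)%C * z) ^+ 2 - T ^+ 2 * nm (z - w) ^+ 2 =
  (T ^+ 2 - nm z ^+ 2) * (T ^+ 2 - nm w ^+ 2).
Proof.
rewrite !nm_sqr; case: z => x y; case: w => u v /=; ring.
Qed.

Lemma nm_conjc z : nm (z^*)%C = nm z.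
Proof. by case: z => x y; rewrite /nm /= sqrrN. Qed.

Lemma conjc_factor_circle (T : R) z w : 0 < T -> nm z = T ->
  nm ((T ^+ 2)%:C%C - (w^*)%C * z) = T * nm (z - w).
Proof.
move=> T0 zT; apply/eqP; rewrite -(@eqrXn2 _ 2) ?nm_ge0//; last by rewrite mulr_ge0 ?nm_ge0// ltW.
by rewrite exprMn -subr_eq0 conjc_factor_id zT subrr mul0r.
Qed.

(** In the identity for Blaschke factors the right side is at least (T^2 - r^2)^2, while the
    denominator has modulus at most 2 T^2. Their ratio [q] gives theta = sqrt (1 - q), uniformly in
    z and w. *)
Lemma blaschke_contraction (r T : R) : 0 < r -> r < T ->
  exists theta : R, [/\ 0 <= theta, theta < 1 & forall z w, nm z <= r -> nm w <= r ->
    T * nm (z - w) <= theta * nm ((T ^+ 2)%:C%C - (w^*)%C * z)].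
Proof.
move=> r0 rT; have T0 : 0 < T by lra.
have T2 : 0 < T ^+ 2 by rewrite exprn_gt0.
have T4 : 0 < 4 * T ^+ 2 ^+ 2 by rewrite mulr_gt0// exprn_gt0.
have rT2 : r ^+ 2 < T ^+ 2 by rewrite ltr_sqr ?nnegrE// ltW.
pose q := (T ^+ 2 - r ^+ 2) ^+ 2 / (4 * T ^+ 2 ^+ 2).
have q0 : 0 < q by rewrite divr_gt0// exprn_gt0// subr_gt0.
have q1 : q <= 1.
  rewrite ler_pdivrMr// mul1r (_ : 4 * _ = (2 * T ^+ 2) ^+ 2); last by ring.
  rewrite lerXn2r ?nnegrE; [|lra|lra|].
    by [].
  by have := sqr_ge0 r; lra.
exists (Num.sqrt (1 - q)); split; first exact: sqrtr_ge0.
  by rewrite -[ltRHS]sqrtr1 ltr_sqrt//; lra.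
move=> z w zr wr; set A := nm (_%:C%C - _).
have z2 : nm z ^+ 2 <= r ^+ 2 by rewrite lerXn2r ?nnegrE ?nm_ge0// ltW.
have w2 : nm w ^+ 2 <= r ^+ 2 by rewrite lerXn2r ?nnegrE ?nm_ge0// ltW.
have A2 : A <= 2 * T ^+ 2.
  apply: le_trans (nm_triB _ _) _; rewrite nm_real gtr0_norm// nmM nm_conjc.
  have : nm w * nm z <= T * T by apply: ler_pM; rewrite ?nm_ge0//; lra.
  rewrite -expr2; lra.
have A0 : 0 <= A := nm_ge0 _.
rewrite -ler_sqr ?nnegrE ?mulr_ge0 ?sqrtr_ge0 ?nm_ge0//; last exact: ltW.
rewrite !exprMn sqr_sqrtr; last by lra.
have := conjc_factor_id T z w; rewrite -/A => E.
have E1 : (T ^+ 2 - r ^+ 2) * (T ^+ 2 - r ^+ 2) <= (T ^+ 2 - nm z ^+ 2) * (T ^+ 2 - nm w ^+ 2).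
  by apply: ler_pM; lra.
have E2 : A ^+ 2 * q <= (T ^+ 2 - r ^+ 2) ^+ 2.
  rewrite /q mulrCA ler_piMr ?sqr_ge0// ler_pdivrMr// mul1r.
  rewrite (_ : 4 * _ = (2 * T ^+ 2) ^+ 2); last by ring.
  by rewrite lerXn2r ?nnegrE//; lra.
by rewrite -expr2 in E1; lra.
Qed.

(** One zero at a time: away from the new zero [a] the previous quotient is divided by a power of z
    - a, and near [a] the local factor g is divided by the product over the other zeros, which does
    not vanish there. *)
Lemma holo_factor_zeros h (s : seq C) (m : C -> nat) : holo h -> uniq s ->
  (forall z, z \in s -> nm z < 1) ->
  (forall z, z \in s -> exists2 e : R, 0 < e & exists2 g,
     forall w, nm (w - z) < e -> cdiff g w &
     forall w, nm (w - z) < e -> nm w < 1 -> h w = (w - z) ^+ m z * g w) ->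
  exists2 G, holo G & forall w, nm w < 1 -> h w = (\prod_(z <- s) (w - z) ^+ m z) * G w.
Proof.
move=> hd; elim: s => [|a s IH] /=.
  by move=> _ _ _; exists h => // w _; rewrite big_nil mul1r.
move=> /andP[as_ us] s1 hs.
have [||G' Gd GE] := IH us.
- by move=> z zs; apply: s1; rewrite inE zs orbT.
- by move=> z zs; apply: hs; rewrite inE zs orbT.
have a1 : nm a < 1 by apply: s1; rewrite inE eqxx.
have [e e0 [g gd gE]] := hs a (mem_head _ _).
pose Pi w : C := \prod_(z <- s) (w - z) ^+ m z.
have Pid z : cdiff Pi z.
  rewrite /Pi; elim: (s) => [|b t IHt].
    rewrite (_ : (fun w => _) = fun=> 1); first exact: cdiff_cst.
    by apply/funext => w; rewrite big_nil.
  rewrite (_ : (fun w => _) = fun w => (w - b) ^+ m b * \prod_(z <- t) (w - z) ^+ m z).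
    exact: (cdiffM (cdiffX _ (cdiff_subr b z)) IHt).
  by apply/funext => w; rewrite big_cons.
have Pia : Pi a != 0.
  rewrite /Pi prodf_seq_neq0; apply/allP => z zs /=; rewrite expf_neq0// subr_eq0.
  by apply: contra as_ => /eqP ->.
have [r r0 hr] : exists2 r : R, 0 < r & forall w, nm (w - a) < r -> Pi w != 0.
  have Pa0 : 0 < nm (Pi a) by rewrite nm_gt0.
  have [r r0 hr] := cdiff_ccont (Pid a) Pa0; exists r => // w /hr hw.
  by rewrite -nm_gt0; have := nm_triB2 (Pi a) (Pi w); rewrite nmB; lra.
pose G w := if w == a then g w / Pi w else G' w / (w - a) ^+ m a.
have Gnear w : nm (w - a) < e -> nm (w - a) < r -> nm w < 1 -> g w / Pi w = G w.
  move=> we wr w1; rewrite /G; case: eqVneq => [//|wa].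
  have wa0 : (w - a) ^+ m a != 0 by rewrite expf_neq0// subr_eq0.
  have := gE w we w1; rewrite GE// -/(Pi w) => E.
  apply: (mulfI (hr w wr)); rewrite mulrCA divff ?hr// mulr1 mulrA E mulrAC.
  by rewrite divff// mul1r.
exists G.
  move=> z z1; have [->|za] := eqVneq z a.
    have m0 : 0 < Num.min e (Num.min r (1 - nm a)) by rewrite !lt_min e0 r0 subr_gt0.
    apply: (cdiff_near_eq (fun w => g w / Pi w) m0).
      move=> w; rewrite !lt_min => /andP[we /andP[wr w1]]; apply: Gnear => //.
      by have := nm_triB2 w a; lra.
    apply: (cdiffM (gd _ _) (cdiffV Pia (Pid a))).
    by rewrite subrr nm0.
  have za0 : 0 < nm (z - a) by rewrite nm_gt0 subr_eq0.
  apply: (cdiff_near_eq (fun w => G' w / (w - a) ^+ m a) za0).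
    move=> w wz; rewrite /G ifN//; apply/negP => /eqP wa; move: wz.
    by rewrite wa nmB ltxx.
  apply: (cdiffM (Gd _ z1)); apply: cdiffV; last exact: (cdiffX _ (cdiff_subr a z)).
  by rewrite expf_neq0// subr_eq0.
move=> w w1; rewrite big_cons -/(Pi w) /G; case: eqVneq => [E|wa].
  rewrite E gE ?subrr ?nm0//; first by rewrite -mulrA [Pi a * _]mulrCA divff// mulr1.
have wa0 : (w - a) ^+ m a != 0 by rewrite expf_neq0// subr_eq0.
by rewrite GE// -/(Pi w); field.
Qed.

Lemma prod_exprMl (K : comRingType) (s : seq C) (m : C -> nat) (x : K) (F : C -> K) :
  \prod_(z <- s) (x * F z) ^+ m z = x ^+ (\sum_(z <- s) m z)%N * \prod_(z <- s) F z ^+ m z.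
Proof.
elim: s => [|a s IH]; first by rewrite !big_nil expr0 mul1r.
by rewrite !big_cons IH exprMn exprD; ring.
Qed.

Lemma ler_prod_expr (s : seq C) (m : C -> nat) (F G : C -> R) :
  (forall z, z \in s -> 0 <= F z <= G z) ->
  \prod_(z <- s) F z ^+ m z <= \prod_(z <- s) G z ^+ m z.
Proof.
move=> h; rewrite !big_seq; apply: ler_prod => z /h /andP[F0 FG].
by rewrite exprn_ge0//= lerXn2r// nnegrE// (le_trans F0).
Qed.

(** Each factor w - z is exchanged for its Blaschke denominator. This multiplies the modulus by T^N
    on |w| = T, and by at least (T / theta)^N, in multiplied-out form, on the smaller disk. *)
Lemma zeros_bound (r T theta H : R) h (s : seq C) (m : C -> nat) : 0 < r -> r < T -> T < 1 ->
  0 <= theta -> (forall z w, nm z <= r -> nm w <= r ->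
    T * nm (z - w) <= theta * nm ((T ^+ 2)%:C%C - (w^*)%C * z)) ->
  holo h -> uniq s -> (forall z, z \in s -> nm z <= r) ->
  (forall z, z \in s -> exists2 e : R, 0 < e & exists2 g,
     forall w, nm (w - z) < e -> cdiff g w &
     forall w, nm (w - z) < e -> nm w < 1 -> h w = (w - z) ^+ m z * g w) ->
  (forall z, nm z = T -> nm (h z) <= H) -> 0 <= H ->
  forall a, nm a <= r -> nm (h a) <= theta ^+ (\sum_(z <- s) m z)%N * H.
Proof.
move=> r0 rT T1 th0 hth hd us sr hs hH H0 a ar; set N := (\sum_(z <- s) _)%N.
have T0 : 0 < T by lra.
have [|G Gd GE] := holo_factor_zeros hd us _ hs.
  by move=> z /sr zr; lra.
pose Bl w : C := \prod_(z <- s) ((T ^+ 2)%:C%C - (z^*)%C * w) ^+ m z.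
have Bld z : cdiff Bl z.
  rewrite /Bl; elim: (s) => [|b t IHt].
    rewrite (_ : (fun w => _) = fun=> 1); first exact: cdiff_cst.
    by apply/funext => w; rewrite big_nil.
  rewrite (_ : (fun w => _) = fun w => ((T ^+ 2)%:C%C - (b^*)%C * w) ^+ m b *
      \prod_(z <- t) ((T ^+ 2)%:C%C - (z^*)%C * w) ^+ m z).
    apply: (cdiffM (cdiffX _ _) IHt); apply: (cdiffB (cdiff_cst _ _)).
    exact: (cdiffM (cdiff_cst _ _) (cdiff_id z)).
  by apply/funext => w; rewrite big_cons.
have Phid : holo (fun w => Bl w * G w) by move=> z z1; exact: (cdiffM (Bld z) (Gd _ z1)).
have TN : 0 < T ^+ N by rewrite exprn_gt0.
have nmP (F : C -> C) : nm (\prod_(z <- s) F z ^+ m z) = \prod_(z <- s) nm (F z) ^+ m z.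
  by rewrite nm_prod; apply: eq_bigr => z _; rewrite nmX.
have bound : nm (Bl a * G a) <= T ^+ N * H.
  apply: (@holo_max _ (fun w => Bl w * G w) T) => //; last by lra.
    by rewrite mulr_ge0// ltW.
  move=> z zT; have z1 : nm z < 1 by rewrite zT.
  rewrite nmM /Bl nmP (eq_bigr (fun w => (T * nm (z - w)) ^+ m w)).
    rewrite prod_exprMl -/N -mulrA ler_pM2l// -nmP -nmM -GE//; exact: hH.
  by move=> w _; rewrite conjc_factor_circle.
have a1 : nm a < 1 by lra.
rewrite -(ler_pM2l TN) GE// nmM nmP mulrA -prod_exprMl.
apply: le_trans (_ : \prod_(z <- s) (theta * nm ((T ^+ 2)%:C%C - (z^*)%C * a)) ^+ m z * nm (G a) <= _).
  rewrite ler_wpM2r ?nm_ge0//; apply: ler_prod_expr => z /sr zr.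
  by rewrite mulr_ge0 ?nm_ge0 ?hth// ltW.
by rewrite prod_exprMl -/N -mulrA -nmP -nmM mulrCA ler_wpM2l// exprn_ge0.
Qed.

Definition many_zeros f (r : R) := forall A : nat, exists n0, forall n, (n0 <= n)%N ->
  exists P Q k, [/\ in_R_n1 n P Q, has_zeros_ge f r P Q k & (A * n <= k)%N].

(** All that the coefficient argument retains of the zeros. The two conclusions concern the first
    two coefficients of u; the pair may depend on n and [d], and quantifying over bounds [M] makes
    the statement invariant under scaling of Q. *)
Definition small_combination (F : nat -> C -> C) (T : R) := forall d : R, 0 < d ->
  exists n0, forall n, (n0 <= n)%N -> exists al be : C, 0 < nm al + nm be /\
  forall M : R, (forall z, nm z <= T -> nm (al * F n z + be * F n.+1 z) <= M) ->
  nm (al * F n 0 + be * F n.+1 0) <= d ^+ n * M /\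
  nm (al * F n.+1 0 + be * F n.+2 0) <= d ^+ n * M.

Lemma exprMn_cube (x y : R) n : (x * y ^+ 3) ^+ n = x ^+ n * y ^+ (3 * n).
Proof. by rewrite exprMn exprM. Qed.

Lemma horner_deg1 (Q : {poly C}) w : (size Q <= 2)%N -> Q.[w] = Q`_1 * w + Q`_0.
Proof. by move=> /horner_coef_wide ->; rewrite !big_ord_recl big_ord0 /= expr0 expr1; ring. Qed.

Lemma coef_deg1_gt0 (Q : {poly C}) : (size Q <= 2)%N -> Q != 0 -> 0 < nm Q`_1 + nm Q`_0.
Proof.
move=> Qs Q0; rewrite lt_neqAle addr_ge0 ?nm_ge0// andbT eq_sym paddr_eq0 ?nm_ge0//.
apply: contra Q0; rewrite !nm_eq0 => /andP[/eqP q1 /eqP q0].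
apply/eqP/polyP => -[|[|i]]; rewrite coef0//.
by rewrite nth_default// (leq_trans Qs).
Qed.

(** The local factorization is given only where Q is nonzero. Q has at most one zero, possibly [z]
    itself, and continuity covers it once denominators are cleared. *)
Lemma local_zero_clear f (P Q : {poly C}) z m : holo f -> (size Q <= 2)%N -> Q != 0 ->
  zero_order_ge f P Q z m ->
  exists2 e : R, 0 < e & exists2 g, forall w, nm (w - z) < e -> cdiff g w &
    forall w, nm (w - z) < e -> nm w < 1 -> Q.[w] * f w - P.[w] = (w - z) ^+ m * g w.
Proof.
move=> fd Qs Q0 [e e0 [g [gd gE]]]; exists e => //; exists (fun w => g w * Q.[w]).
  move=> w we; apply: (cdiffM _ (cdiff_horner Q w)); apply: gd.
  by rewrite normr_nm ltcR.
have main w : nm (w - z) < e -> nm w < 1 -> Q.[w] != 0 ->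
    Q.[w] * f w - P.[w] = (w - z) ^+ m * (g w * Q.[w]).
  move=> we w1 Qw; have := gE w; rewrite !normr_nm !ltcR => /(_ we w1 Qw) E.
  by rewrite mulrA -E; field.
move=> w we w1; have [Qw|] := eqVneq Q.[w] 0; last exact: main.
apply: (@ccont_eq_off _ (fun w => Q.[w] * f w - P.[w]) (fun w => (w - z) ^+ m * (g w * Q.[w])) w).
- apply: cdiff_ccont; apply: (cdiffB _ (cdiff_horner P w)).
  exact: (cdiffM (cdiff_horner Q w) (fd _ w1)).
- apply: cdiff_ccont; apply: (cdiffM (cdiffX _ (cdiff_subr z w))).
  by apply: (cdiffM _ (cdiff_horner Q w)); apply: gd; rewrite normr_nm ltcR.
exists (Num.min (e - nm (w - z)) (1 - nm w)); first by rewrite lt_min !subr_gt0 we.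
move=> v; rewrite lt_min => /andP[v1 v2] vw; apply: main.
- by have := nm_dist_tri w v z; lra.
- by have := nm_triB2 v w; lra.
apply/negP => /eqP Qv; have := coef_deg1_gt0 Qs Q0.
rewrite !horner_deg1// in Qw Qv.
have : Q`_1 * (v - w) = 0.
  transitivity ((Q`_1 * v + Q`_0) - (Q`_1 * w + Q`_0)); first by ring.
  by rewrite Qv Qw subrr.
move/eqP; rewrite mulf_eq0 subr_eq0 (negbTE vw) orbF => /eqP q1.
by move: Qw; rewrite q1 mul0r add0r => ->; rewrite nm0 addr0 ltxx.
Qed.

(** Let X be the maximum of |h| on |z| <= r. Bounding the polynomial part of h by X gives X <=
    theta^N ((n+1) c^(n+1) X + M). Many zeros make the coefficient of X at most 1/2, so X <= 2
    theta^N M, and the coefficients of u are at most c^(n+2) X. *)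
Lemma many_zeros_small_combination F (r T : R) : taylor_chain F ->
  0 < r -> r < T -> T < 1 -> many_zeros (F 0%N) r -> small_combination F T.
Proof.
move=> hF r0 rT T1 hz d d0; have [Fd FE] := hF.
have [th [th0 th1 hth]] := blaschke_contraction r0 rT.
pose c := 2 / r; have c1 : 1 <= c by rewrite /c ler_pdivlMr//; lra.
have c0 : 0 <= c by lra.
pose d' := Num.min d 1.
have [d'0 d'd d'1] : [/\ 0 < d', d' <= d & d' <= 1].
  by rewrite /d' lt_min d0 ltr01 !ge_min !lexx orbT.
have c3 : 0 < 8 * c ^+ 3 by rewrite mulr_gt0// exprn_gt0//; lra.
(* [c ^+ 3] pays for c^(n+2) <= c^(3 n); the 8 pays for n + 1 <= 2^n and the constants 2, leaving at
   most d^n. *)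
pose eta := d' / (8 * c ^+ 3).
have eta0 : 0 < eta by rewrite divr_gt0.
have [A hA] := expr_small th0 th1 eta0.
(* Positive n is needed for n + 2 <= 3 n and 2 <= 2^n. *)
have [n0 hn0] := hz A; exists n0.+1 => -[//|n'] nn0; set n := n'.+1.
have n1 : (0 < n)%N by [].
have [P [Q [k [[Ps Qs Q0] [s [m [us sr hs ks]]] Ak]]]] := hn0 n (ltnW nn0).
set N := (\sum_(z <- s) m z)%N in ks.
have thN : th ^+ N <= eta ^+ n.
  apply: le_trans (_ : th ^+ (A * n) <= _).
    by rewrite ler_wiXn2l ?(leq_trans Ak)// ltW.
  by rewrite exprM lerXn2r ?nnegrE ?exprn_ge0 ?hA// ltW.
have thN0 : 0 <= th ^+ N by rewrite exprn_ge0.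
exists Q`_1, Q`_0; split; first exact: coef_deg1_gt0.
move=> M hM; set al := Q`_1 in hM *; set be := Q`_0 in hM *.
pose u z := al * F n z + be * F n.+1 z.
pose u1 z := al * F n.+1 z + be * F n.+2 z.
have cd a b i j : holo (fun z => a * F i z + b * F j z).
  move=> z z1; apply: (cdiffD (cdiffM (cdiff_cst _ _) (Fd i z z1)) (cdiffM (cdiff_cst _ _) (Fd j z z1))).
have [Sn Sns SnE] := taylor_chain_poly n hF.
have [Sm Sms SmE] := taylor_chain_poly n.+1 hF.
pose h z := Q.[z] * F 0%N z - P.[z].
have hd : holo h.
  move=> z z1; apply: (cdiffB _ (cdiff_horner P z)).
  exact: (cdiffM (cdiff_horner Q z) (Fd 0%N z z1)).
(* In Q f the term al z f is truncated one order earlier than be f, so that both leave a remainder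
   divisible by z^(n+1). *)
pose p := al *: (Sn * 'X) + be *: Sm - P.
have ps : (size p <= n.+1)%N.
  rewrite (leq_trans (size_polyD _ _))// geq_max size_polyN Ps andbT.
  rewrite (leq_trans (size_polyD _ _))// geq_max !(leq_trans (size_scale_leq _ _))//.
  rewrite (leq_trans (size_polyMleq _ _))// size_polyX addn2 /=.
  exact: Sns.
have hE z : nm z < 1 -> h z = p.[z] + z ^+ n.+1 * u z.
  move=> _; rewrite /h horner_deg1// -/al -/be.
  transitivity (al * z * (Sn.[z] + z ^+ n * F n z) +
    be * (Sm.[z] + z ^+ n.+1 * F n.+1 z) - P.[z]); first by rewrite -SnE -SmE; ring.
  by rewrite /p /u hornerD hornerN hornerD !hornerZ hornerM hornerX [z ^+ n.+1]exprS; ring.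
have r1 : r < 1 := lt_trans rT T1.
have [x0 x0r hx0] : exists2 x0, nm x0 <= r & forall w, nm w <= r -> nm (h w) <= nm (h x0).
  apply: disk_max_attained => // z zr; apply: ccont_nm; apply: cdiff_ccont; apply: hd; exact: le_lt_trans r1.
set X := nm (h x0) in hx0.
have X0 : 0 <= X := nm_ge0 _.
have [Hu Hp] := poly_part_bound r0 r1 (cd al be n n.+1) ps hE hx0.
rewrite -/c in Hu Hp.
have T0 : 0 < T := lt_trans r0 rT.
have n0T : nm (0 : C) <= T by rewrite nm0 ltW.
have M0 : 0 <= M := le_trans (nm_ge0 _) (hM _ n0T).
have hT z : nm z = T -> nm (h z) <= n.+1%:R * c ^+ n.+1 * X + M.
  move=> zT; rewrite hE ?zT//; apply: le_trans (nmD _ _) _; apply: lerD.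
    by apply: Hp; rewrite zT ltW.
  rewrite nmM nmX zT; apply: le_trans (hM z _); last by rewrite zT.
  by rewrite ler_piMl ?nm_ge0// exprn_ile1// ltW.
have XN : X <= th ^+ N * (n.+1%:R * c ^+ n.+1 * X + M).
  apply: (zeros_bound r0 rT T1 th0 hth hd us _ _ hT).
  - by move=> z /sr; rewrite normr_nm lecR.
  - by move=> z zs; exact: (@local_zero_clear _ P Q z (m z) (Fd 0%N) Qs Q0 (hs z zs)).
  - by apply: addr_ge0 => //; apply: mulr_ge0 => //; apply: mulr_ge0 => //; exact: exprn_ge0.
  - exact: x0r.
have n3 : (n.+2 <= 3 * n)%N by rewrite /n; clear; lia.
have cn : c ^+ n.+1 <= c ^+ (3 * n) := ler_weXn2l c1 (ltnW n3).
have cn2 : c ^+ n.+2 <= c ^+ (3 * n) := ler_weXn2l c1 n3.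
have etaE : eta * c ^+ 3 = d' / 8 by rewrite /eta; field; rewrite gt_eqF// (lt_le_trans ltr01 c1).
have B1 : th ^+ N * (n.+1%:R * c ^+ n.+1) <= 1 / 2.
  have h1 : n.+1%:R <= 2 ^+ n :> R by rewrite -natrX ler_nat ltn_expl.
  apply: le_trans (_ : eta ^+ n * (2 ^+ n * c ^+ (3 * n)) <= _).
    apply: ler_pM => //; first by apply: mulr_ge0 => //; exact: exprn_ge0.
    by apply: ler_pM => //; exact: exprn_ge0.
  rewrite mulrCA -exprMn_cube -exprMn.
  rewrite etaE; apply: le_trans (_ : (1 / 2) ^+ n <= _).
    by clear - d'0 d'1; rewrite lerXn2r ?nnegrE//; lra.
  have [hf0 hf1] : 0 <= 1 / 2 :> R /\ 1 / 2 <= 1 :> R by clear; split; lra.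
  by rewrite /n exprS; apply: ler_piMr => //; exact: exprn_ile1.
have X2 : X <= 2 * th ^+ N * M.
  have : th ^+ N * (n.+1%:R * c ^+ n.+1) * X <= 1 / 2 * X by rewrite ler_wpM2r.
  by move: XN; clear; lra.
have cX : c ^+ n.+2 * X <= d ^+ n * M.
  apply: le_trans (_ : c ^+ (3 * n) * (2 * eta ^+ n * M) <= _).
    apply: ler_pM => //; first exact: exprn_ge0.
    by apply: le_trans X2 _; rewrite ler_wpM2r// ler_wpM2l.
  have -> : c ^+ (3 * n) * (2 * eta ^+ n * M) = 2 * (eta * c ^+ 3) ^+ n * M.
    by rewrite exprMn_cube; move: (eta ^+ n) (c ^+ (3 * n)) => x y; ring.
  rewrite ler_wpM2r// etaE; apply: le_trans (_ : 2 ^+ n * (d' / 8) ^+ n <= _).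
    have [tw1 d80] : 1 <= 2 :> R /\ 0 <= d' / 8 by clear - d'0; split; lra.
    apply: ler_wpM2r; first exact: exprn_ge0.
    by rewrite /n exprS; apply: ler_peMr => //; exact: exprn_ege1.
  by clear - d'0 d'd d0; rewrite -exprMn lerXn2r ?nnegrE//; lra.
have Hu1 z : nm z <= r -> nm (u z) <= c ^+ n.+1 * X := Hu z.
have n0r : nm (0 : C) <= r by rewrite nm0 ltW.
split.
  apply: le_trans (Hu1 _ n0r) _; apply: le_trans cX.
  by rewrite ler_wpM2r// ler_weXn2l.
(* The second coefficient of u: one more constant term is peeled off. *)
have uE z : nm z < 1 -> u z = ((u 0)%:P).[z] + z ^+ 1 * u1 z.
  by move=> _; rewrite hornerC expr1 /u /u1 (FE n z) (FE n.+1 z); ring.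
have [H1 _] := poly_part_bound r0 r1 (cd al be n.+1 n.+2) (size_polyC_leq1 (u 0)) uE Hu1.
apply: le_trans (H1 _ n0r) _; rewrite expr1 -/c mulrA -exprS.
exact: cX.
Qed.

End Zeros.

(** * Sup norms of the Taylor tails *)

Section ChainNorms.
Variable R : realType.
Local Notation C := R[i].
Implicit Types (F : nat -> C -> C) (s : nat -> R).

Definition chain_norm F (T : R) s := forall n,
  (forall z, nm z <= T -> nm (F n z) <= s n) /\
  (forall M, (forall z, nm z <= T -> nm (F n z) <= M) -> s n <= M).

Lemma chain_norm_exists F (T : R) : 0 < T -> T < 1 -> taylor_chain F ->
  exists s, chain_norm F T s.
Proof.
move=> T0 T1 [Fd _].
have [s hs] : {s : nat -> R & forall n, (forall z, nm z <= T -> nm (F n z) <= s n) /\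
    (forall M, (forall z, nm z <= T -> nm (F n z) <= M) -> s n <= M)}.
  apply: (@choice _ _ (fun n x => (forall z, nm z <= T -> nm (F n z) <= x) /\
    (forall M, (forall z, nm z <= T -> nm (F n z) <= M) -> x <= M))) => n.
  have [|x xT hx] := @disk_max_attained _ (fun z => nm (F n z)) T T0.
    by move=> z zT; apply/ccont_nm/cdiff_ccont/Fd; exact: le_lt_trans T1.
  by exists (nm (F n x)); split => // M; apply.
by exists s.
Qed.

(** Any loss c K^n is absorbed by d^n. The rate d depends on K and e only; the spare 2^n takes care
    of c. *)
Lemma absorb_powers (K e : R) : 0 < K -> 0 < e -> exists2 d : R, 0 < d &
  forall c, exists n0, forall n, (n0 <= n)%N -> c * (d ^+ n * K ^+ n) <= e ^+ n.
Proof.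
move=> K0 e0; exists (e / (2 * K)); first by rewrite divr_gt0// mulr_gt0.
move=> c; have two1 : 1 < 2 :> R by lra.
have [N hN] := expr_unbounded c two1; exists N => n Nn.
rewrite -exprMn (_ : e / (2 * K) * K = e / 2); last by field; rewrite gt_eqF.
rewrite expr_div_n mulrCA ler_piMr ?exprn_ge0 ?ltW//.
rewrite ltr_pdivrMr ?exprn_gt0// mul1r; apply: lt_le_trans hN _.
by rewrite ler_weXn2l// ltW.
Qed.

Section Norms.
Variables (F : nat -> C -> C) (T : R) (s : nat -> R).
Hypotheses (T0 : 0 < T) (T1 : T < 1) (hF : taylor_chain F) (hs : chain_norm F T s).

Lemma chain_norm_coef n : nm (F n 0) <= s n.
Proof. by apply: (hs n).1; rewrite nm0 ltW. Qed.

Lemma chain_norm_ge0 n : 0 <= s n.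
Proof. exact: le_trans (nm_ge0 _) (chain_norm_coef n). Qed.

Lemma chain_norm_le n : s n <= nm (F n 0) + T * s n.+1.
Proof.
apply: (hs n).2 => z zT; rewrite hF.2; apply: le_trans (nmD _ _) _; rewrite lerD2l nmM.
by apply: ler_pM; rewrite ?nm_ge0// (hs n.+1).1.
Qed.

Lemma chain_norm_leD n : s n <= nm (F n 0) + s n.+1.
Proof.
apply: le_trans (chain_norm_le n) _; rewrite lerD2l ler_piMl ?chain_norm_ge0//.
exact: ltW.
Qed.

Lemma chain_norm_succ n : s n.+1 <= (nm (F n 0) + s n) / T.
Proof.
have M0 : 0 <= (nm (F n 0) + s n) / T.
  by rewrite divr_ge0 ?addr_ge0 ?nm_ge0 ?chain_norm_ge0// ltW.
apply: (hs n.+1).2 => z zT; apply: (holo_max T0 T1 M0 (hF.1 n.+1)) => // w wT.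
rewrite ler_pdivlMr// -wT mulrC -nmM.
have -> : w * F n.+1 w = F n w - F n 0 by rewrite [F n w]hF.2; ring.
apply: le_trans (nm_triB _ _) _; rewrite addrC lerD2l.
by apply: (hs n).1; rewrite wT.
Qed.

Lemma chain_norm_zero n : s n = 0 -> forall z, nm z < 1 -> F n z = 0.
Proof.
move=> sn; apply: (holo_identity T0 (hF.1 n)) => z zT.
by apply/eqP; rewrite -nm_eq0 eq_le nm_ge0 -sn (hs n).1.
Qed.

(* If the norms outgrew all coefficients from some rank on, the coefficients would be
   summable on a disk of radius rho > T, forcing s n <= B / rho ^ n; but s n would
   grow at a rate close to 1 / T. *)
Lemma infinitely_many_good (C0 : R) : 4 / T <= C0 ->
  forall m, exists2 n, (m <= n)%N & s n.+1 <= C0 ^+ n * nm (F n 0).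
Proof.
move: (T0) (T1) => T0' T1' hC m; apply: contrapT => hno.
have bad n : (m <= n)%N -> C0 ^+ n * nm (F n 0) < s n.+1.
  by move=> mn; rewrite ltNge; apply/negP => h; apply: hno; exists n.
have T4 : 4 < 4 / T by rewrite ltr_pdivlMr//; lra.
have C0gt : 0 < C0 by lra.
have CT : 4 <= C0 * T by move: hC; rewrite ler_pdivrMr.
have up n : s n <= (2 / T) ^+ n * s 0%N.
  elim: n => [|n IH]; first by rewrite expr0 mul1r.
  apply: le_trans (chain_norm_succ n) _.
  apply: le_trans (_ : 2 / T * s n <= _).
    rewrite mulrAC ler_pM2r ?invr_gt0//; have := chain_norm_coef n; lra.
  by rewrite exprS -[leRHS]mulrA ler_pM2l ?divr_gt0.
pose K := 2 / T * s 0%N.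
have K0 : 0 <= K by rewrite mulr_ge0 ?chain_norm_ge0// divr_ge0// ltW.
(* Norms grow at most like (2 / T)^n and C0 >= 4 / T, hence the ratio 1/2. *)
have cf n : (m <= n)%N -> nm (F n 0) <= K * (1 / 2) ^+ n.
  move=> mn; have Cn : 0 < C0 ^+ n by rewrite exprn_gt0.
  rewrite -(ler_pM2l Cn); apply: le_trans (ltW (bad n mn)) _.
  apply: le_trans (up n.+1) _.
  have -> : (2 / T) ^+ n.+1 * s 0%N = K * (2 / T) ^+ n by rewrite exprS /K; ring.
  rewrite mulrCA ler_wpM2l// -exprMn lerXn2r ?nnegrE; [|by rewrite divr_ge0// ltW|lra|].
    by [].
  by rewrite ler_pdivrMr//; lra.
have [rho [rT r1]] : exists rho, T < rho /\ rho < 1.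
  by exists ((T + 1) / 2); split; lra.
have r0 : 0 < rho by lra.
have [B' B'0 hB'] := holo_bounded r0 r1 (hF.1 m).
(* Passing from z^k F_k to z^(k+1) F_(k+1) removes a_k z^k; the last term keeps account of the
   geometric series still to be spent. *)
have E n z : nm z <= rho -> nm (z ^+ (m + n) * F (m + n)%N z) <= B' + 2 * K - 2 * K * (1 / 2) ^+ (m + n).
  move=> zr; have z1 : nm z <= 1 by lra.
  have zk k : nm z ^+ k <= 1 by rewrite exprn_ile1 ?nm_ge0.
  elim: n => [|n IH].
    rewrite addn0 nmM nmX; have p1 : (1 / 2) ^+ m <= 1 :> R by rewrite exprn_ile1//; lra.
    have : K * (1 / 2) ^+ m <= K * 1 by rewrite ler_wpM2l.
    have : nm z ^+ m * nm (F m z) <= 1 * B' by apply: ler_pM; rewrite ?exprn_ge0 ?nm_ge0 ?hB'.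
    lra.
  have -> : z ^+ (m + n.+1) * F (m + n.+1)%N z =
      z ^+ (m + n) * F (m + n)%N z - z ^+ (m + n) * F (m + n)%N 0.
    by rewrite addnS [F (m + n)%N z]hF.2 exprS; ring.
  apply: le_trans (nm_triB _ _) _; rewrite [nm (_ * F _ 0)]nmM nmX.
  have h1 : nm z ^+ (m + n) * nm (F (m + n)%N 0) <= 1 * (K * (1 / 2) ^+ (m + n)).
    by apply: ler_pM; rewrite ?exprn_ge0 ?nm_ge0// cf// leq_addr.
  by rewrite addnS exprS; move: IH h1; move: ((1 / 2) ^+ (m + n)) => y; lra.
pose B := B' + 2 * K; have B0 : 0 <= B by rewrite /B; lra.
have hi n : (m <= n)%N -> s n <= B / rho ^+ n.
  move=> mn; have rn : 0 < rho ^+ n by rewrite exprn_gt0.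
  apply: (hs n).2 => z zT.
  have zr : nm z <= rho by lra.
  apply: (holo_max r0 r1 _ (hF.1 n)) zr; first by rewrite divr_ge0// ltW.
  move=> w wr; rewrite ler_pdivlMr// mulrC -wr -nmX -nmM.
  have wr' : nm w <= rho by rewrite wr.
  have := E (n - m)%N w wr'; rewrite subnKC// => h; apply: le_trans h _.
  have hf : 0 <= 1 / 2 :> R by lra.
  have : 0 <= 2 * K * (1 / 2) ^+ n by apply: mulr_ge0; [exact: mulr_ge0|exact: exprn_ge0].
  by rewrite /B; lra.
have [rho' [r'E rr' r'0]] : exists rho', [/\ rho' = (T + rho) / 2, rho' < rho & 0 < rho'].
  by exists ((T + rho) / 2); split; lra.
have Ci : 0 <= C0^-1 by rewrite invr_ge0 ltW.
have Ci1 : C0^-1 < 1 by rewrite invf_lt1//; lra.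
have g0 : 0 < (rho - T) / 2 by lra.
have [N hN] := expr_small Ci Ci1 g0.
(* The coefficient is eventually negligible against [s n.+1], so any rate above [T], here [rho'], is
   allowed. *)
have lo n : (m + N <= n)%N -> s n <= rho' * s n.+1.
  move=> mn; apply: le_trans (chain_norm_le n) _.
  have Cn : 0 < C0 ^+ n by rewrite exprn_gt0.
  have h1 : nm (F n 0) <= C0^-1 ^+ n * s n.+1.
    rewrite exprVn ler_pdivlMl//; apply/ltW/bad; exact: leq_trans (leq_addr _ _) mn.
  have h2 : C0^-1 ^+ n * s n.+1 <= (rho - T) / 2 * s n.+1.
    rewrite ler_wpM2r ?chain_norm_ge0// hN//; exact: leq_trans (leq_addl _ _) mn.
  by rewrite r'E; lra.
pose M := (m + N).+1.
have sM : 0 < s M.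
  apply: le_lt_trans (bad (m + N)%N (leq_addr _ _)).
  by rewrite mulr_ge0 ?nm_ge0// exprn_ge0// ltW.
have it j : s M <= rho' ^+ j * s (M + j)%N.
  elim: j => [|j IH]; first by rewrite addn0 mul1r.
  apply: le_trans IH _; rewrite exprSr -mulrA ler_wpM2l ?exprn_ge0 ?(ltW r'0)//.
  by rewrite addnS; apply: lo; exact: leq_trans (leqnSn _) (leq_addr _ _).
have fin j : s M <= B / rho ^+ M * (rho' / rho) ^+ j.
  apply: le_trans (it j) _.
  apply: le_trans (_ : rho' ^+ j * (B / rho ^+ (M + j)) <= _).
    rewrite ler_wpM2l ?exprn_ge0 ?(ltW r'0)// hi//.
    by apply: leq_trans (leq_addr _ _); apply: leqW; exact: leq_addr.
  rewrite exprD expr_div_n.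
  have := expf_neq0 M (lt0r_neq0 r0); have := expf_neq0 j (lt0r_neq0 r0).
  move: (rho ^+ M) (rho ^+ j) (rho' ^+ j) => x y w y0 x0.
  by rewrite le_eqVlt; apply/orP; left; apply/eqP; field; rewrite ?x0 ?y0.
have q0 : 0 <= rho' / rho by rewrite divr_ge0 ?ltW.
have q1 : rho' / rho < 1 by rewrite ltr_pdivrMr// mul1r.
pose L := B / rho ^+ M + 1.
have BM : 0 <= B / rho ^+ M by rewrite divr_ge0// exprn_ge0// ltW.
have L0 : 0 < L by rewrite /L; lra.
have e1 : 0 < s M / (2 * L) by rewrite divr_gt0// mulr_gt0.
have [J hJ] := expr_small q0 q1 e1.
have h1 := hJ J (leqnn J).
have : s M <= L * (s M / (2 * L)).
  apply: le_trans (fin J) _; apply: ler_pM => //; last by rewrite /L; lra.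
  exact: exprn_ge0.
rewrite (_ : L * _ = s M / 2); first lra.
by field; rewrite gt_eqF.
Qed.

End Norms.
End ChainNorms.

(** * Inequalities for three consecutive coefficients *)

Section ThreeTerms.
Variable R : realType.
Local Notation C := R[i].
Implicit Types (a e al be : C).

(** Eliminating al yields be times the determinant. And be cannot be tiny compared with al: since
    |a1| <= E |a0|, smallness of al a0 + be a1 forces |al| to be at most about E |be|. *)
Lemma hankel_small a0 a1 a2 al be (eta E : R) : 0 < nm a0 -> 0 < nm al + nm be ->
  0 <= eta -> eta <= 1 / 2 -> 1 <= E -> nm a1 <= E * nm a0 ->
  nm (al * a0 + be * a1) <= eta * nm a0 * (nm al + nm be) ->
  nm (al * a1 + be * a2) <= eta * nm a0 * (nm al + nm be) ->
  nm (a2 * a0 - a1 * a1) <= 2 * eta * (1 + E) ^+ 2 * nm a0 ^+ 2.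
Proof.
set A := nm a0; set S := nm al + nm be => A0 S0 e0 e1 E1 h1 u0 u1.
have al1 : nm al * A <= nm be * (E * A) + eta * A * S.
  have := nm_triB (al * a0 + be * a1) (be * a1); rewrite addrK !nmM -/A => h.
  have : nm be * nm a1 <= nm be * (E * A) by rewrite ler_wpM2l ?nm_ge0.
  lra.
have al2 : nm al <= nm be * E + eta * S.
  by rewrite -(ler_pM2r A0); lra.
have S2 : S <= 2 * (1 + E) * nm be.
  have : eta * S <= 1 / 2 * S by rewrite ler_wpM2r// ltW.
  by move: al2; rewrite /S; lra.
have b0 : 0 < nm be.
  have : 0 < 2 * (1 + E) * nm be by lra.
  by rewrite pmulr_rgt0//; lra.
have D : nm be * nm (a2 * a0 - a1 * a1) <= (1 + E) * A * (eta * A * S).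
  rewrite -nmM (_ : be * _ = a0 * (al * a1 + be * a2) - a1 * (al * a0 + be * a1)); last by ring.
  apply: le_trans (nm_triB _ _) _; rewrite !nmM -/A.
  have : A * nm (al * a1 + be * a2) <= A * (eta * A * S) by rewrite ler_pM2l.
  have : nm a1 * nm (al * a0 + be * a1) <= E * A * (eta * A * S).
    by apply: ler_pM; rewrite ?nm_ge0.
  lra.
rewrite -(ler_pM2l b0); apply: le_trans D _.
have c0 : 0 <= (1 + E) * A * (eta * A).
  by apply: mulr_ge0; apply: mulr_ge0 => //; [lra|exact: ltW|exact: ltW].
have := ler_wpM2l c0 S2.
rewrite (_ : nm be * _ = (1 + E) * A * (eta * A) * (2 * (1 + E) * nm be)); last by ring.
by rewrite [(1 + E) * A * (eta * A * S)]mulrA.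
Qed.

(** The same elimination with errors measured against a2, the form from which convergence of the
    ratios is derived. *)
Lemma hankel_small_rel a0 a1 a2 al be (eta E : R) : 0 < nm a0 -> 0 < nm al + nm be ->
  0 <= eta -> 1 <= E -> eta * E ^+ 2 <= 1 / 2 -> nm a1 <= E * nm a0 -> nm a2 <= E * nm a1 ->
  nm (al * a0 + be * a1) <= eta * nm a2 * (nm al + nm be) ->
  nm (al * a1 + be * a2) <= eta * nm a2 * (nm al + nm be) ->
  nm (a2 * a0 - a1 * a1) <= 2 * eta * (1 + E) ^+ 2 * (nm a0 * nm a2).
Proof.
set A := nm a0; set Z := nm a2; set S := nm al + nm be => A0 S0 e0 E1 e1 h1 h2 u0 u1.
have Z0 : 0 <= Z := nm_ge0 _.
have ZA : Z <= E ^+ 2 * A.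
  apply: le_trans h2 _; rewrite expr2 -mulrA ler_wpM2l//; lra.
have al1 : nm al * A <= nm be * (E * A) + 1 / 2 * S * A.
  have := nm_triB (al * a0 + be * a1) (be * a1); rewrite addrK !nmM -/A => h.
  have : nm be * nm a1 <= nm be * (E * A) by rewrite ler_wpM2l ?nm_ge0.
  have : eta * Z * S <= 1 / 2 * S * A.
    rewrite [leRHS]mulrAC ler_wpM2r ?(ltW S0)//.
    apply: le_trans (_ : eta * (E ^+ 2 * A) <= _); first by rewrite ler_wpM2l.
    by rewrite mulrA ler_wpM2r// ltW.
  lra.
have al2 : nm al <= nm be * E + 1 / 2 * S.
  by rewrite -(ler_pM2r A0); lra.
have S2 : S <= 2 * (1 + E) * nm be by move: al2; rewrite /S; lra.
have b0 : 0 < nm be.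
  have : 0 < 2 * (1 + E) * nm be by lra.
  by rewrite pmulr_rgt0//; lra.
have D : nm be * nm (a2 * a0 - a1 * a1) <= (1 + E) * A * (eta * Z * S).
  rewrite -nmM (_ : be * _ = a0 * (al * a1 + be * a2) - a1 * (al * a0 + be * a1)); last by ring.
  apply: le_trans (nm_triB _ _) _; rewrite !nmM -/A.
  have : A * nm (al * a1 + be * a2) <= A * (eta * Z * S) by rewrite ler_pM2l.
  have : nm a1 * nm (al * a0 + be * a1) <= E * A * (eta * Z * S).
    by apply: ler_pM; rewrite ?nm_ge0.
  lra.
rewrite -(ler_pM2l b0); apply: le_trans D _.
have c0 : 0 <= (1 + E) * A * (eta * Z).
  by apply: mulr_ge0; apply: mulr_ge0 => //; [lra|exact: ltW].
have := ler_wpM2l c0 S2.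
rewrite (_ : nm be * _ = (1 + E) * A * (eta * Z) * (2 * (1 + E) * nm be)); last by ring.
by rewrite [(1 + E) * A * (eta * Z * S)]mulrA.
Qed.

(** The second relation makes |be| at least about 8 K |al|, the first makes it at most about 2 K
    |al|; with eta this small, both would vanish. *)
Lemma no_small_combination a0 a1 a2 al be (eta K : R) : 0 < nm a1 -> 0 < nm al + nm be ->
  1 <= K -> 0 <= eta -> eta * (6 * K + 5) <= 1 ->
  nm a0 <= 2 * K * nm a1 -> 8 * K * nm a2 <= nm a1 ->
  nm (al * a0 + be * a1) <= eta * nm a1 * (nm al + nm be) ->
  nm (al * a1 + be * a2) <= eta * nm a1 * (nm al + nm be) -> False.
Proof.
set Y := nm a1; set S := nm al + nm be => Y0 S0 K1 e0 e1 h0 h2 u0 u1.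
have K0 : 0 < 8 * K by lra.
have al2 : 8 * K * nm al <= nm be + 8 * K * (eta * S).
  have := nm_triB (al * a1 + be * a2) (be * a2); rewrite addrK !nmM -/Y => h.
  have hb : nm be * (8 * K * nm a2) <= nm be * Y by rewrite ler_wpM2l ?nm_ge0.
  have h3 : 8 * K * (nm al * Y) <= 8 * K * (nm (al * a1 + be * a2) + nm be * nm a2).
    by rewrite ler_pM2l.
  have h4 : 8 * K * nm (al * a1 + be * a2) <= 8 * K * (eta * Y * S) by rewrite ler_pM2l.
  by rewrite -(ler_pM2r Y0); lra.
have be2 : nm be <= 2 * K * nm al + eta * S.
  have := nm_triB (al * a0 + be * a1) (al * a0); rewrite addrAC subrr add0r !nmM -/Y => h.
  have hb : nm al * nm a0 <= nm al * (2 * K * Y) by rewrite ler_wpM2l ?nm_ge0.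
  by rewrite -(ler_pM2r Y0); lra.
have ha : nm al <= K * nm al by rewrite ler_peMl ?nm_ge0.
have hS : eta * S <= K * (eta * S) by rewrite ler_peMl// mulr_ge0// ltW.
have : S * (eta * (6 * K + 5)) <= S * 1 by rewrite ler_wpM2l// ltW.
have al0 := nm_ge0 al; have be0 := nm_ge0 be.
have SE : S = nm al + nm be by [].
have eS : 0 <= eta * S by rewrite mulr_ge0// ltW.
lra.
Qed.

(** The first relation forces |be e0| and |ga a0| to agree within a factor 2. Then |ga a1| >= c |ga
    a0| is of order c |be e0|, and the second relation hands this lower bound on to |be e1|. *)
Lemma coefficient_growth e0 e1 (a0 a1 be ga : C) (eta c : R) :
  0 < nm e0 -> 0 < nm a0 -> 0 < nm be + nm ga -> 0 < c ->
  0 <= eta -> eta * (6 + 12 / c) <= 1 -> c * nm a0 <= nm a1 ->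
  nm (be * e0 + ga * a0) <= eta * (nm be * nm e0 + nm ga * nm a0) ->
  nm (be * e1 + ga * a1) <= eta * (nm be * nm e0 + nm ga * nm a0) ->
  c / 4 * nm e0 <= nm e1.
Proof.
move=> E0 A0 S0 c0 et0 et1 h1.
set x := nm be * nm e0; set y := nm ga * nm a0 => u0 u1.
have x0 : 0 <= x by rewrite mulr_ge0 ?nm_ge0.
have y0 : 0 <= y by rewrite mulr_ge0 ?nm_ge0.
have ic : 0 < c^-1 by rewrite invr_gt0.
have [t1 t2] : eta * 6 <= 1 /\ eta * 12 <= c.
  split.
    have : 0 <= eta * (12 / c) by rewrite mulr_ge0// divr_ge0// ltW.
    lra.
  have : eta * (12 / c) <= 1 by lra.
  by rewrite mulrA ler_pdivrMr// mul1r.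
have hx := nm_triB (be * e0 + ga * a0) (be * e0); rewrite addrAC subrr add0r !nmM -/x -/y in hx.
have hy := nm_triB (be * e0 + ga * a0) (ga * a0); rewrite addrK !nmM -/x -/y in hy.
have s6 : eta * (x + y) <= (x + y) / 6.
  have : eta * 6 * (x + y) <= 1 * (x + y) by rewrite ler_wpM2r// addr_ge0.
  lra.
have xp : 0 < x.
  rewrite lt_neqAle x0 andbT eq_sym; apply/negP => /eqP x00.
  have y00 : y = 0 by lra.
  have b0 : nm be = 0 by move/eqP: x00; rewrite mulf_eq0 [nm e0 == _]gt_eqF// orbF => /eqP.
  have g0 : nm ga = 0 by move/eqP: y00; rewrite mulf_eq0 [nm a0 == _]gt_eqF// orbF => /eqP.
  by lra.
have y2 : x / 2 <= y by lra.
have y3 : y <= 2 * x by lra.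
have h3 := nm_triB (be * e1 + ga * a1) (be * e1); rewrite addrAC subrr add0r !nmM in h3.
have ya : c * y <= nm ga * nm a1.
  by rewrite /y mulrCA ler_wpM2l ?nm_ge0.
have bp : 0 < nm be.
  by rewrite lt_neqAle nm_ge0 andbT eq_sym; apply/negP => /eqP b0; move: xp; rewrite /x b0 mul0r ltxx.
have k1 : eta * (x + y) <= c * x / 4.
  have : eta * 12 * (x + y) <= c * (x + y) by rewrite ler_wpM2r// addr_ge0.
  have : c * y <= c * (2 * x) by rewrite ler_pM2l.
  lra.
have k2 : c * (x / 2) <= c * y by rewrite ler_pM2l.
rewrite -(ler_pM2l bp) (_ : nm be * (c / 4 * nm e0) = c * x / 4); last by rewrite /x; field.
lra.
Qed.

End ThreeTerms.

(** * Limits of sequences with superexponentially small relative increments *)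

Section RatioLimit.
Variable R : realType.
Local Notation C := R[i].

(** Increments are measured against the later term, so boundedness comes first: e = 1/4 traps q
    within half of |q N| around q N. Then telescoping gives the rate e^n for each e <= 1/2. *)
Lemma ratio_limit (q : nat -> C) (n1 : nat) :
  (forall n, (n1 <= n)%N -> 0 < nm (q n)) ->
  (forall e : R, 0 < e -> e <= 1 -> exists n2, forall n, (n2 <= n)%N ->
    nm (q n - q n.+1) <= e ^+ n * nm (q n.+1)) ->
  exists l c B n3, [/\ 0 < c, c <= nm l,
    forall n, (n3 <= n)%N -> c <= nm (q n) <= B &
    forall e : R, 0 < e -> e <= 1 / 2 -> exists N, forall n, (N <= n)%N ->
      nm (q n - l) <= 2 * B * e ^+ n].
Proof.
move=> q0 hq.
have [f0 [f1 f2]] : 0 < 1 / 4 :> R /\ 1 / 4 <= 1 :> R /\ 0 <= 1 / 2 :> R by split; [|split]; lra.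
have [n2 h2] := hq _ f0 f1.
(* The 2 ensures (1/4)^N <= 1/16, which keeps the total drift below [P] / 2. *)
pose N := (n1 + n2 + 2)%N.
have [Nn1 Nn2 N2] : [/\ (n1 <= N)%N, (n2 <= N)%N & (2 <= N)%N].
  by rewrite /N; split; clear; lia.
pose P := nm (q N); have P0 : 0 < P := q0 _ Nn1.
have main j : nm (q (N + j)%N - q N) <= P * (1 / 2 - 1 / 2 * (1 / 2) ^+ j).
  elim: j => [|j IH]; first by rewrite addn0 subrr nm0 expr0 mulr1 subrr mulr0.
  have jp : 0 < (1 / 2) ^+ j :> R by rewrite exprn_gt0//; lra.
  have b1 : nm (q (N + j)%N) <= 3 / 2 * P.
    have := nm_triB2 (q (N + j)%N) (q N); rewrite -/P.
    have : 0 <= P * (1 / 2) ^+ j by rewrite mulr_ge0// ltW.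
    lra.
  have h := h2 (N + j)%N (leq_trans Nn2 (leq_addr _ _)).
  have pw : (1 / 4) ^+ (N + j) <= 1 / 16 * (1 / 2) ^+ j :> R.
    rewrite exprD; apply: ler_pM; rewrite ?exprn_ge0 ?(ltW f0)//.
      apply: le_trans (_ : (1 / 4) ^+ 2 <= _); first by rewrite ler_wiXn2l// ltW.
      by rewrite expr2; lra.
    by rewrite lerXn2r ?nnegrE ?(ltW f0)//; lra.
  rewrite addnS exprS.
  set x := q (N + j)%N in IH b1 h *; set y := q (N + j).+1 in h *.
  set w := (1 / 4) ^+ (N + j) in pw h; set v := (1 / 2) ^+ j in IH jp pw *.
  have v1 : v <= 1 by rewrite exprn_ile1//; lra.
  have y0 := nm_ge0 y.
  have wy : w * nm y <= 1 / 16 * v * nm y by rewrite ler_wpM2r.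
  have vy : v * nm y <= 1 * nm y by rewrite ler_wpM2r.
  have y1 : nm y <= 2 * P by have := nm_triB2 y x; rewrite (nmB y x); lra.
  have vy2 : v * nm y <= v * (2 * P) by rewrite ler_pM2l.
  have vP : 0 <= v * P by rewrite mulr_ge0 ?ltW.
  have := nm_dist_tri x y (q N); rewrite (nmB y x); lra.
pose B := 3 / 2 * P; pose c := P / 2.
have bnd n : (N <= n)%N -> c <= nm (q n) <= B.
  move=> Nn; have := main (n - N)%N; rewrite subnKC// => h.
  have : 0 <= P * (1 / 2) ^+ (n - N) by rewrite mulr_ge0 ?exprn_ge0// ltW.
  have := nm_triB2 (q n) (q N); have := nm_triB2 (q N) (q n); rewrite (nmB (q N)) -/P /c /B => *.
  by apply/andP; split; lra.
have B0 : 0 < B by rewrite /B; lra.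
have tele (e : R) : 0 < e -> e <= 1 / 2 -> exists M, forall n k, (M <= n)%N ->
    nm (q (n + k)%N - q n) <= 2 * B * e ^+ n.
  move=> e0 e1; have e2 : e <= 1 by lra.
  have [M hM] := hq _ e0 e2; exists (M + N)%N => n k Mn.
  have Mn1 : (M <= n)%N := leq_trans (leq_addr _ _) Mn.
  have Mn2 : (N <= n)%N := leq_trans (leq_addl _ _) Mn.
  have en : 0 <= e ^+ n by rewrite exprn_ge0// ltW.
  suff : nm (q (n + k)%N - q n) <= B * e ^+ n * (2 - 2 * (1 / 2) ^+ k).
    have : 0 <= B * e ^+ n * (1 / 2) ^+ k.
      by apply: mulr_ge0; [apply: mulr_ge0 => //; exact: ltW|exact: exprn_ge0].
    lra.
  elim: k => [|k IH]; first by rewrite addn0 subrr nm0 expr0 mulr1 subrr mulr0.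
  have h := hM (n + k)%N (leq_trans Mn1 (leq_addr _ _)).
  have /andP[_ bk] := bnd (n + k).+1 (leqW (leq_trans Mn2 (leq_addr _ _))).
  have pw : e ^+ (n + k) * nm (q (n + k).+1) <= e ^+ n * (1 / 2) ^+ k * B.
    apply: ler_pM; rewrite ?nm_ge0 ?exprn_ge0 ?(ltW e0)//.
    by rewrite exprD ler_wpM2l// lerXn2r ?nnegrE// ltW.
  rewrite addnS exprS; have := nm_dist_tri (q (n + k)%N) (q (n + k).+1) (q n).
  rewrite (nmB (q (n + k).+1) (q (n + k)%N)); lra.
have [|l hl] := @complex_cauchy_seq _ q.
  move=> e e0.
  have hf : 0 < 1 / 2 :> R by lra.
  have [M hM] := tele _ hf (lexx _).
  have hf1 : 1 / 2 < 1 :> R by lra.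
  have e4 : 0 < e / (4 * B) by rewrite divr_gt0// mulr_gt0.
  have [M' hM'] := expr_small f2 hf1 e4.
  pose n := (M + M')%N; exists n.
  have ee : 2 * B * (1 / 2) ^+ n <= e / 2.
    have := hM' n (leq_addl _ _); rewrite ler_pdivlMr ?mulr_gt0//; lra.
  have hn k : (n <= k)%N -> nm (q k - q n) <= e / 2.
    by move=> nk; have := hM n (k - n)%N (leq_addr _ _); rewrite subnKC//; lra.
  move=> i j ni nj; have := hn i ni; have := hn j nj; rewrite (nmB (q j)).
  have := nm_dist_tri (q n) (q i) (q j); lra.
have appr (e : R) : 0 < e -> e <= 1 / 2 -> exists M, forall n, (M <= n)%N ->
    nm (q n - l) <= 2 * B * e ^+ n.
  move=> e0 e1; have [M hM] := tele e e0 e1; exists M => n Mn.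
  apply/ler_addgt0Pr => x x0; have [L hL] := hl _ x0.
  have := hM n L Mn; have := hL (n + L)%N (leq_addl _ _).
  have := nm_dist_tri (q (n + L)%N) (q n) l; rewrite (nmB (q n) (q (n + L)%N)); lra.
exists l, c, B, N; split => //; first by rewrite /c; lra.
apply/ler_addgt0Pr => x x0; have [L hL] := hl _ x0.
have := hL (N + L)%N (leq_addl _ _).
have /andP[h _] := bnd (N + L)%N (leq_addr _ _).
have := nm_triB2 (q (N + L)%N) l; lra.
Qed.

End RatioLimit.

(** * Spreading goodness, and the limit of the coefficient ratios *)

Section Coefficients.
Variable R : realType.
Local Notation C := R[i].
Variables (F : nat -> C -> C) (T : R) (s : nat -> R).
Hypotheses (T0 : 0 < T) (T1 : T < 1) (hF : taylor_chain F) (hs : chain_norm F T s).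
Hypothesis hsc : small_combination F T.
Hypothesis s_gt0 : forall n, 0 < s n.

Local Notation a n := (F n 0).

(* Keeps the section variables, which [lra] cannot do without. *)
Ltac lra_of_goal := clear - F T s T0 T1 hF hs hsc s_gt0; lra.

Definition good (D : R) n := s n.+1 <= D ^+ n * nm (a n).

Lemma good_coef_gt0 D n : 0 < D -> good D n -> 0 < nm (a n).
Proof.
move=> D0 /(lt_le_trans (s_gt0 n.+1)).
by rewrite pmulr_rgt0// exprn_gt0.
Qed.

Lemma good_norm D n : 1 <= D -> good D n -> s n <= 2 * D ^+ n * nm (a n).
Proof.
move=> D1 gn; have := chain_norm_leD T0 T1 hF hs n.
have : nm (a n) <= D ^+ n * nm (a n) by rewrite ler_peMl ?nm_ge0// exprn_ege1.
by move: gn; rewrite /good; lra.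
Qed.

Lemma small_combination_norm (d : R) : 0 < d -> exists n0, forall n, (n0 <= n)%N ->
  exists al be : C, 0 < nm al + nm be /\ forall S, s n <= S -> s n.+1 <= S ->
    nm (al * a n + be * a n.+1) <= d ^+ n * (S * (nm al + nm be)) /\
    nm (al * a n.+1 + be * a n.+2) <= d ^+ n * (S * (nm al + nm be)).
Proof.
move=> d0; have [n0 h0] := hsc d0; exists n0 => n /h0[al [be [ab h]]].
exists al, be; split => // S S1 S2; apply: h => z zT.
apply: le_trans (nmD _ _) _; rewrite !nmM mulrDr ![S * _]mulrC.
by apply: lerD; rewrite ler_wpM2l ?nm_ge0//; [apply: le_trans S1|apply: le_trans S2]; exact: (hs _).1.
Qed.

(** The required lower bound for |a_(n+1) / a_n| decreases with n from at most k to k / 2. Each step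
    releases room proportional to (1/2)^n, which pays for the Hankel error, so the statement
    reproduces itself with fixed [k] and [D]. *)
Lemma good_forward (D k : R) : 0 < k -> k <= 1 -> 1 <= D -> 4 / (T * k) <= D ->
  exists n0, forall n, (n0 <= n)%N -> good D n ->
    k * (1 / 2 + (1 / 2) ^+ n.+1) * nm (a n) <= nm (a n.+1) ->
    good D n.+1 /\ k * (1 / 2 + (1 / 2) ^+ n.+2) * nm (a n.+1) <= nm (a n.+2).
Proof.
move: (T0) (T1) => T0' T1' k0 k1 D1 hD.
have D0 : 0 < D by lra.
have D3 : 0 < D ^+ 3 by rewrite exprn_gt0.
have hf : 0 < 1 / 2 :> R by lra.
have [d d0 hd] := absorb_powers D3 hf.
(* The room released is k^2 h / 8 times |a_n|^2 with h = (1/2)^n, and the Hankel error is 16 w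
   |a_n|^2: hence 128. *)
have [N hN] := hd (128 / k ^+ 2); have [n0 h0] := small_combination_norm d0.
exists (N + n0)%N => n Nn gn.
have {}hN := hN n (leq_trans (leq_addr _ _) Nn).
have [al [be [ab hab]]] := h0 n (leq_trans (leq_addl _ _) Nn).
have A0 := good_coef_gt0 D0 gn; have sn := good_norm D1 gn.
have E1 : 1 <= D ^+ n by rewrite exprn_ege1.
have s1 : s n.+1 <= D ^+ n * nm (a n) := gn.
have S2 : s n.+1 <= 2 * D ^+ n * nm (a n).
  by apply: le_trans s1 _; rewrite -mulrA; have := mulr_gt0 (lt_le_trans ltr01 E1) A0; lra.
have [u0 u1] := hab _ sn S2.
have A1s : nm (a n.+1) <= D ^+ n * nm (a n).
  exact: le_trans (chain_norm_coef T0 hs n.+1) s1.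
pose w := d ^+ n * (D ^+ 3) ^+ n.
have k2 : 0 < k ^+ 2 by rewrite exprn_gt0.
pose h := (1 / 2) ^+ n : R.
have h0' : 0 < h by rewrite exprn_gt0.
have h1 : h <= 1 by rewrite exprn_ile1//; lra.
have wk : 128 * w <= k ^+ 2 * h.
  by move: hN; rewrite -/w -/h mulrAC ler_pdivrMr//; lra.
have w0 : 0 <= w by rewrite mulr_ge0 ?exprn_ge0// ltW.
have dn : 0 <= d ^+ n by rewrite exprn_ge0// ltW.
have wE : w = d ^+ n * D ^+ n * D ^+ n ^+ 2.
  by rewrite /w exprAC; ring.
pose eta := 2 * (d ^+ n * D ^+ n).
have Dn0 : 0 <= D ^+ n := le_trans ler01 E1.
have eta0 : 0 <= eta by rewrite mulr_ge0// mulr_ge0.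
have etaw : eta <= 2 * w.
  rewrite /eta ler_pM2l// wE ler_peMr//; last by rewrite exprn_ege1.
  by rewrite mulr_ge0.
have kk : k ^+ 2 * h <= 1 * 1.
  by apply: ler_pM; rewrite ?(ltW h0') ?(ltW k2)// exprn_ile1// ltW.
have eta1 : eta <= 1 / 2 by move: etaw wk kk; lra_of_goal.
have HH := @hankel_small _ (a n) (a n.+1) (a n.+2) al be eta (D ^+ n) A0 ab eta0 eta1 E1 A1s.
have etaE : eta * nm (a n) * (nm al + nm be) =
  d ^+ n * (2 * D ^+ n * nm (a n) * (nm al + nm be)) by rewrite /eta; ring.
rewrite etaE in HH; have {}HH := HH u0 u1.
set A := nm (a n) in A0 sn S2 A1s s1 HH *; set A1 := nm (a n.+1) in A1s *; set A2 := nm (a n.+2).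
have H2 : nm (a n.+2 * a n - a n.+1 * a n.+1) <= 16 * w * A ^+ 2.
  apply: le_trans HH _; rewrite ler_wpM2r ?sqr_ge0//.
  have -> : 16 * w = 2 * eta * (2 * D ^+ n) ^+ 2 by rewrite wE /eta; ring.
  rewrite ler_wpM2l//; first by rewrite mulr_ge0.
  by rewrite lerXn2r ?nnegrE//; move: E1; lra_of_goal.
have {H2} : A1 ^+ 2 - 16 * w * A ^+ 2 <= A2 * A.
  have := nm_triB2 (a n.+1 * a n.+1) (a n.+2 * a n); rewrite nmB !nmM -/A -/A1 -/A2 -expr2.
  by move: H2; lra_of_goal.
rewrite [(1 / 2) ^+ n.+2]exprS [(1 / 2) ^+ n.+1]exprS -/h => H2 HA1.
have kA : k / 2 * A <= A1.
  apply: le_trans HA1; rewrite ler_pM2r//.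
  have : 0 <= k * h by rewrite mulr_ge0 ?ltW.
  by lra_of_goal.
have kA0 : 0 < k / 2 * A by rewrite mulr_gt0// divr_gt0.
split.
  rewrite /good; apply: le_trans (chain_norm_succ T0 T1 hF hs n.+1) _.
  rewrite -/A1 ler_pdivrMr//.
  have : D ^+ n * (2 * A) <= D ^+ n * (T * D * A1).
    rewrite ler_wpM2l//.
    have : 4 <= D * (T * k) by move: hD; rewrite ler_pdivrMr// mulr_gt0.
    have TD : 0 < T * D by rewrite mulr_gt0.
    have := ler_wpM2l (ltW TD) kA.
    have : 4 * A <= D * (T * k) * A -> T * D * (k / 2 * A) <= T * D * A1 -> 2 * A <= T * D * A1 by lra_of_goal.
    move=> HX HY HZ; apply: HX HY; by rewrite ler_wpM2r// ltW.
  have := chain_norm_coef T0 hs n.+1; rewrite -/A1 exprS; move: s1; lra_of_goal.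
rewrite -(ler_pM2r A0); apply: le_trans H2.
have p1 : k / 2 * A * (k * h / 4 * A) <= A1 * (A1 - k * (1 / 2 + 1 / 2 * (1 / 2 * h)) * A).
  apply: ler_pM; rewrite ?(ltW kA0)//; last by move: HA1; lra_of_goal.
  by rewrite mulr_ge0 ?(ltW A0)// divr_ge0// mulr_ge0// ltW.
have p2 : 16 * w * A ^+ 2 <= k ^+ 2 * h / 8 * A ^+ 2.
  by rewrite ler_wpM2r ?sqr_ge0//; move: wk; lra_of_goal.
by move: p1 p2; lra_of_goal.
Qed.

(** If n were not good, |a_n| would be at most 2 K |a_(n+1)|; together with the drop from a_(n+1) to
    a_(n+2) this excludes any small combination. *)
Lemma good_backward (K : R) : 1 <= K -> exists n0, forall n, (n0 <= n)%N -> good K n.+1 ->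
  8 * K * nm (a n.+2) <= nm (a n.+1) -> good K n.
Proof.
move=> K1; have K0 : 0 < K by lra.
have hf : 0 < 1 / 2 :> R by lra.
have [d d0 hd] := absorb_powers K0 hf.
have [N hN] := hd (4 * K * (6 * K + 5)); have [n0 h0] := small_combination_norm d0.
exists (N + n0)%N => n Nn gn h8; apply: contrapT => /negP; rewrite -ltNge => ngn.
have {}hN := hN n (leq_trans (leq_addr _ _) Nn).
have [al [be [ab hab]]] := h0 n (leq_trans (leq_addl _ _) Nn).
have Y0 := good_coef_gt0 K0 gn; have sn := good_norm K1 gn.
have Kn : 0 < K ^+ n by rewrite exprn_gt0.
have Kn1 : 1 <= K ^+ n by rewrite exprn_ege1.
set Y := nm (a n.+1) in Y0 sn h8.
have x2 : nm (a n) <= 2 * K * Y.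
  rewrite -(ler_pM2l Kn); apply: le_trans (ltW ngn) _.
  by apply: le_trans sn _; rewrite exprS; lra.
have KY : K * Y <= K * Y * K ^+ n by rewrite ler_peMr// mulr_ge0// ltW.
have S1 : s n <= 4 * (K * K ^+ n) * Y.
  apply: le_trans (chain_norm_leD T0 T1 hF hs n) _.
  by move: sn; rewrite exprS; lra.
have S2 : s n.+1 <= 4 * (K * K ^+ n) * Y.
  apply: le_trans sn _; rewrite exprS.
  have : 0 <= K * K ^+ n * Y by rewrite !mulr_ge0// ltW.
  lra.
have [u0 u1] := hab _ S1 S2.
have dn : 0 <= d ^+ n by rewrite exprn_ge0// ltW.
apply: (@no_small_combination _ (a n) (a n.+1) (a n.+2) al be (d ^+ n * (4 * (K * K ^+ n))) K) => //.
- by rewrite mulr_ge0// mulr_ge0// mulr_ge0// ltW.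
- have -> : d ^+ n * (4 * (K * K ^+ n)) * (6 * K + 5) = 4 * K * (6 * K + 5) * (d ^+ n * K ^+ n) by ring.
  by apply: le_trans hN _; rewrite exprn_ile1//; lra.
- by rewrite -[leRHS]mulrA -/Y; move: u0; rewrite !mulrA.
- by rewrite -[leRHS]mulrA -/Y; move: u1; rewrite !mulrA.
Qed.

(** Either some late good n has ratio at least 1 / (8 K), and goodness spreads forward from it; or
    all late good n have a smaller ratio, and goodness descends from arbitrarily large good ranks to
    every late n. *)
Lemma eventually_good : exists D n1, 1 <= D /\ forall n, (n1 <= n)%N -> good D n.
Proof.
move: (T0) (T1) => T0' T1'.
pose K := 4 / T.
have K4 : 4 < K by rewrite /K ltr_pdivlMr//; lra.
have K0 : 0 < 8 * K by lra.
have inf := infinitely_many_good T0 T1 hF hs (lexx K).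
pose k := (8 * K)^-1.
have k0 : 0 < k by rewrite invr_gt0.
have k1 : k <= 1 by rewrite invf_le1//; lra.
pose D := 4 / (T * k).
have KD : K <= D.
  rewrite /D /K ler_pM2l// lef_pV2 ?posrE ?mulr_gt0//.
  by rewrite ler_piMr// ltW.
have D1 : 1 <= D by lra.
have [cA|cB] := pselect (forall m, exists2 n, (m <= n)%N & good K n /\ k * nm (a n) <= nm (a n.+1)).
  have [n0 hn0] := good_forward k0 k1 D1 (lexx D).
  have [n nn0 [gn kn]] := cA n0.
  have all_ j : good D (n + j) /\
      k * (1 / 2 + (1 / 2) ^+ (n + j).+1) * nm (a (n + j)%N) <= nm (a (n + j).+1).
    elim: j => [|j [IH1 IH2]].
      rewrite addn0; split.
        apply: le_trans gn _; rewrite ler_wpM2r ?nm_ge0// lerXn2r ?nnegrE//; lra.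
      apply: le_trans kn; rewrite ler_wpM2r ?nm_ge0// ler_piMr ?(ltW k0)//.
      have [hf0 hf1] : 0 <= 1 / 2 :> R /\ 1 / 2 <= 1 :> R by split; lra.
      have : (1 / 2) ^+ n <= 1 :> R by rewrite exprn_ile1.
      by rewrite exprS; lra.
    rewrite addnS; apply: hn0 => //; exact: leq_trans nn0 (leq_addr _ _).
  exists D, n; split => // i ni; have [] := all_ (i - n)%N; by rewrite subnKC.
have [m hm] : exists m, forall n, (m <= n)%N -> good K n -> 8 * K * nm (a n.+1) <= nm (a n).
  apply: contrapT => hm; apply: cB => m; apply: contrapT => hn; apply: hm; exists m => n mn gn.
  rewrite leNgt; apply/negP => lt; apply: hn; exists n => //; split => //.
  by rewrite /k ler_pdivrMl// ltW.
have K1 : 1 <= K by lra.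
have [n0 hn0] := good_backward K1.
exists K, (m + n0)%N; split => // n mn.
have [i ni gi] := inf n.
have down j : (j <= i - n)%N -> good K (i - j).
  elim: j => [_|j IH jn]; first by rewrite subn0.
  have E : (i - j = (i - j.+1).+1)%N by move: jn ni; clear; lia.
  have {IH} := IH (ltnW jn); rewrite E => gj.
  have b1 : (m + n0 <= i - j.+1)%N by move: mn jn ni; clear; lia.
  apply: hn0 => //; first exact: leq_trans (leq_addl _ _) b1.
  by apply: hm => //; apply: leqW; exact: leq_trans (leq_addr _ _) b1.
by have := down (i - n)%N (leqnn _); rewrite subKn.
Qed.

(** Divided by |a_n a_(n+1)| this bounds the increment of the ratios. The error must be relative to
    a_(n+2), as goodness bounds later coefficients by earlier ones but not conversely. *)
Lemma ratio_step (D : R) n1 : 1 <= D -> (forall n, (n1 <= n)%N -> good D n) ->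
  forall e : R, 0 < e -> e <= 1 -> exists n2, forall n, (n2 <= n)%N ->
    nm (a n.+2 * a n - a n.+1 * a n.+1) <= e ^+ n * (nm (a n) * nm (a n.+2)).
Proof.
move=> D1 gD e e0 e1; have D0 : 0 < D by lra.
have D3 : 0 < D ^+ 3 by rewrite exprn_gt0.
have [d d0 hd] := absorb_powers D3 e0.
have [N hN] := hd (64 * D ^+ 4); have [n0 h0] := hsc d0.
exists (N + n0 + n1)%N => n Nn.
have {}hN := hN n (leq_trans (leq_addr _ _) (leq_trans (leq_addr _ _) Nn)).
have [al [be [ab hab]]] := h0 n (leq_trans (leq_addl _ _) (leq_trans (leq_addr _ _) Nn)).
have n1n : (n1 <= n)%N := leq_trans (leq_addl _ _) Nn.
have g0 := gD n n1n; have g1 := gD n.+1 (leqW n1n); have g2 := gD n.+2 (leqW (leqW n1n)).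
have A0 := good_coef_gt0 D0 g0; have A1 := good_coef_gt0 D0 g1; have A2 := good_coef_gt0 D0 g2.
have s2 := good_norm D1 g2.
set S := nm al + nm be in ab.
set u0 := al * a n + be * a n.+1 in hab; set u1 := al * a n.+1 + be * a n.+2 in hab.
pose X := 2 * D ^+ n.+2 * nm (a n.+2) * S.
have E2 : 1 <= D ^+ n.+2 by rewrite exprn_ege1.
have s3 : s n.+3 <= 2 * D ^+ n.+2 * nm (a n.+2).
  apply: le_trans g2 _; rewrite -[leRHS]mulrA.
  have : 0 <= D ^+ n.+2 * nm (a n.+2) by rewrite mulr_ge0 ?ltW//; lra.
  lra.
(* Only the tails from n + 2 on are estimated by norms. The leading terms [u0] and [u1] stay on the
   right with factor d^n and are absorbed. *)
have [v0 v1] : nm u0 <= d ^+ n * (nm u0 + nm u1 + X) /\ nm u1 <= d ^+ n * (nm u0 + nm u1 + X).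
  apply: hab => z zT.
  have -> : al * F n z + be * F n.+1 z =
      u0 + z * u1 + z ^+ 2 * (al * F n.+2 z + be * F n.+3 z).
    by rewrite (hF.2 n z) (hF.2 n.+1 z) (hF.2 n.+2 z) /u0 /u1; ring.
  have z1 : nm z <= 1 by apply: le_trans zT _; exact: ltW.
  apply: le_trans (nmD _ _) _; apply: lerD.
    apply: le_trans (nmD _ _) _; rewrite lerD2l nmM ler_piMl ?nm_ge0//.
  rewrite nmM nmX; apply: le_trans (_ : nm (al * F n.+2 z + be * F n.+3 z) <= _).
    by rewrite ler_piMl ?nm_ge0// exprn_ile1 ?nm_ge0.
  apply: le_trans (nmD _ _) _; rewrite !nmM /X /S mulrDr ![2 * D ^+ n.+2 * _ * _]mulrC.
  by apply: lerD; rewrite ler_wpM2l ?nm_ge0//; [apply: le_trans s2|apply: le_trans s3]; exact: (hs _).1.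
have dn : 0 <= d ^+ n by rewrite exprn_ge0// ltW.
have en : e ^+ n <= 1 by rewrite exprn_ile1// ltW.
have DE : D ^+ 4 * (D ^+ 3) ^+ n = D ^+ n.+2 * D ^+ n.+1 ^+ 2.
  by rewrite -!exprM -!exprD; congr (_ ^+ _); clear; lia.
have D64 : 64 * (d ^+ n * (D ^+ n.+2 * D ^+ n.+1 ^+ 2)) <= e ^+ n by rewrite -DE; lra.
have E1 : 1 <= D ^+ n.+1 by rewrite exprn_ege1.
have E12 : 1 <= D ^+ n.+1 ^+ 2 by rewrite exprn_ege1.
have d64 : 64 * d ^+ n <= 1.
  have : d ^+ n * 1 <= d ^+ n * (D ^+ n.+2 * D ^+ n.+1 ^+ 2).
    by rewrite ler_wpM2l// mulr_ege1.
  lra.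
pose eta := 8 * (d ^+ n * D ^+ n.+2).
have eta0 : 0 <= eta by rewrite mulr_ge0// mulr_ge0//; lra.
have X0 : 0 <= X by apply: mulr_ge0; [apply: mulr_ge0|]; [apply: mulr_ge0|..] => //;
  [exact: le_trans ler01 E2|exact: ltW|exact: ltW].
have uX : nm u0 + nm u1 <= 4 * d ^+ n * X.
  have := nm_ge0 u0; have := nm_ge0 u1 => p1 p0.
  have : 64 * d ^+ n * (nm u0 + nm u1) <= 1 * (nm u0 + nm u1) by rewrite ler_wpM2r// addr_ge0.
  by move: v0 v1 p0 p1; lra_of_goal.
have XE : 4 * d ^+ n * X = eta * nm (a n.+2) * S by rewrite /X /eta; ring.
rewrite XE in uX.
have w0 : nm u0 <= eta * nm (a n.+2) * S by have := nm_ge0 u1; move: uX; lra_of_goal.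
have w1 : nm u1 <= eta * nm (a n.+2) * S by have := nm_ge0 u0; move: uX; lra_of_goal.
have etaE : eta * D ^+ n.+1 ^+ 2 <= 1 / 2.
  have -> : eta * D ^+ n.+1 ^+ 2 = 8 * (d ^+ n * (D ^+ n.+2 * D ^+ n.+1 ^+ 2)) by rewrite /eta; ring.
  by move: D64 en; lra_of_goal.
have a1 : nm (a n.+1) <= D ^+ n.+1 * nm (a n).
  apply: le_trans (chain_norm_coef T0 hs n.+1) _; apply: le_trans g0 _.
  by rewrite ler_wpM2r ?nm_ge0// ler_weXn2l.
have a2 : nm (a n.+2) <= D ^+ n.+1 * nm (a n.+1).
  exact: le_trans (chain_norm_coef T0 hs n.+2) g1.
have HH := hankel_small_rel A0 ab eta0 E1 etaE a1 a2 w0 w1.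
apply: le_trans HH _; rewrite ler_wpM2r ?mulr_ge0 ?nm_ge0//.
apply: le_trans D64.
have -> : 64 * (d ^+ n * (D ^+ n.+2 * D ^+ n.+1 ^+ 2)) = 2 * eta * (2 * D ^+ n.+1) ^+ 2.
  by rewrite /eta; ring.
rewrite ler_wpM2l//; first by rewrite mulr_ge0.
by rewrite lerXn2r ?nnegrE//; move: E1; lra_of_goal.
Qed.

Lemma coefficient_ratio_limit : exists D l c B n1, [/\ 1 <= D, 0 < c, c <= nm l,
  forall n, (n1 <= n)%N -> [/\ 0 < nm (a n), good D n, c * nm (a n) <= nm (a n.+1) &
    nm (a n.+1) <= B * nm (a n)] &
  forall e : R, 0 < e -> e <= 1 / 2 -> exists N, forall n, (N <= n)%N ->
    nm (a n.+1 - l * a n) <= 2 * B * e ^+ n * nm (a n)].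
Proof.
have [D [n1 [D1 gD]]] := eventually_good.
have D0 : 0 < D by lra.
have ap n : (n1 <= n)%N -> 0 < nm (a n) by move=> /gD; exact: good_coef_gt0.
pose q n := a n.+1 / a n.
have qE n : (n1 <= n)%N -> nm (q n) = nm (a n.+1) / nm (a n) by rewrite /q nmM nmV.
have q0 n : (n1 <= n)%N -> 0 < nm (q n).
  by move=> h; rewrite qE// divr_gt0 ?ap// leqW.
have [|l [c [B [n3 [c0 cl cB lim]]]]] := ratio_limit q0.
  move=> e e0 e1; have [n2 h2] := ratio_step D1 gD e0 e1.
  exists (n1 + n2)%N => n nn.
  have n1n : (n1 <= n)%N := leq_trans (leq_addr _ _) nn.
  have {}h2 := h2 n (leq_trans (leq_addl _ _) nn).
  have p0 := ap n n1n; have p1 := ap n.+1 (leqW n1n); have p2 := ap n.+2 (leqW (leqW n1n)).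
  have z0 : a n != 0 by rewrite -nm_gt0.
  have z1 : a n.+1 != 0 by rewrite -nm_gt0.
  rewrite (qE n.+1) ?(leqW n1n)// nmB.
  rewrite (_ : q n.+1 - q n = (a n.+2 * a n - a n.+1 * a n.+1) / (a n.+1 * a n)); last first.
    by rewrite /q; field; rewrite ?z0 ?z1.
  rewrite nmM nmV nmM ler_pdivrMr ?mulr_gt0//.
  apply: le_trans h2 _; rewrite le_eqVlt; apply/orP; left; apply/eqP.
  by field; rewrite gt_eqF.
exists D, l, c, B, (n1 + n3)%N; split => //.
  move=> n nn; have n1n : (n1 <= n)%N := leq_trans (leq_addr _ _) nn.
  have /andP[h1 h2] := cB n (leq_trans (leq_addl _ _) nn); have p0 := ap n n1n.
  by move: h1 h2; rewrite qE// ler_pdivlMr// ler_pdivrMr// => h1 h2; split => //; exact: gD.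
move=> e e0 e1; have [N hN] := lim e e0 e1; exists (n1 + N)%N => n nn.
have p0 := ap n (leq_trans (leq_addr _ _) nn).
have z0 : a n != 0 by rewrite -nm_gt0.
rewrite (_ : a n.+1 - l * a n = (q n - l) * a n); last by rewrite /q; field.
by rewrite nmM ler_pM2r// hN// (leq_trans (leq_addl _ _) nn).
Qed.

End Coefficients.

(** * Rationality, and the hypothesis on zero counts *)

Section Rationality.
Variable R : realType.
Local Notation C := R[i].

(** Its coefficients are e_n = a_(n+1) - l a_n; its initial function G_0 satisfies (1 - l z) f = a_0
    + z G_0. *)
Lemma shifted_chain (F : nat -> C -> C) l : taylor_chain F ->
  taylor_chain (fun n z => F n.+1 z - l * F n z).
Proof.
move=> [Fd FE]; split.
  move=> n z z1; apply: (cdiffB (Fd n.+1 z z1)).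
  exact: (cdiffM (cdiff_cst l z) (Fd n z z1)).
by move=> n z; rewrite {1}(FE n.+1 z) (FE n z); ring.
Qed.

Lemma chain_poly_of_zero_norm (F : nat -> C -> C) T s n : 0 < T -> taylor_chain F ->
  chain_norm F T s -> s n = 0 -> exists p : {poly C}, forall z, nm z < 1 -> F 0%N z = p.[z].
Proof.
move=> T0 hF hs sn; have [p _ pE] := taylor_chain_poly n hF; exists p => z z1.
by rewrite pE (chain_norm_zero T0 hF hs sn)// mulr0 addr0.
Qed.

Lemma shifted_chain_poly (F : nat -> C -> C) (T : R) (s : nat -> R) : 0 < T -> T < 1 ->
  taylor_chain F -> chain_norm F T s -> small_combination F T -> (forall n, 0 < s n) ->
  exists2 l, l != 0 & exists p : {poly C}, forall z, nm z < 1 -> F 1%N z - l * F 0%N z = p.[z].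
Proof.
move=> T0 T1 hF hs hsc s0.
have [D [l [c [B [n1 [D1 c0 cl hn1 lim]]]]]] := coefficient_ratio_limit T0 T1 hF hs hsc s0.
exists l; first by rewrite -nm_gt0; lra.
pose G n z := F n.+1 z - l * F n z.
have hG : taylor_chain G := shifted_chain l hF.
have [t ht] := chain_norm_exists T0 T1 hG.
(* A vanishing norm makes the new function a polynomial; the rest refutes the other case. *)
have [[n tn]|tn0] := pselect (exists n, t n = 0).
  exact: (chain_poly_of_zero_norm T0 hG ht tn).
exfalso.
have t0 n : 0 < t n.
  rewrite lt_neqAle (chain_norm_ge0 T0 ht) andbT eq_sym; apply/negP => /eqP h.
  by apply: tn0; exists n.
have [h1 _ hc hB] := hn1 n1 (leqnn _).
have B0 : 0 < B.
  have : 0 < B * nm (F n1 0) by apply: lt_le_trans hB; apply: lt_le_trans hc; rewrite mulr_gt0.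
  by rewrite pmulr_lgt0.
(* The summands provide infinitely many good ranks, the propagation of goodness under growth by c /
   4, and the comparison with [D]. *)
pose K := 4 / T + 8 / (T * c) + D.
have q1 : 0 < 4 / T by rewrite divr_gt0.
have q2 : 0 < 8 / (T * c) by rewrite divr_gt0// mulr_gt0.
have K4 : 4 / T <= K by rewrite /K; lra.
have K8 : 8 / (T * c) <= K by rewrite /K; lra.
have KD : D <= K by rewrite /K; lra.
have K1 : 1 <= K by lra.
have K0 : 0 < K by lra.
have hf : 0 < 1 / 2 :> R by lra.
have [d d0 hd] := absorb_powers K0 hf.
have [N1 hN1] := hd (2 * (6 + 12 / c)).
have [N2 hN2] := hsc d d0.
have cB : 0 < c / (8 * B) by rewrite divr_gt0// mulr_gt0.
(* Makes e_(m+j) at most a constant times (c / 8)^j, as |a_(m+j)| grows at most like B^j; this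
   contradicts the lower bound (c / 4)^j. *)
pose e := Num.min (1 / 2) (c / (8 * B)).
have e0 : 0 < e by rewrite lt_min hf.
have e1 : e <= 1 / 2 by rewrite ge_min lexx.
have e2 : B * e <= c / 8.
  have : e <= c / (8 * B) by rewrite ge_min lexx orbT.
  by rewrite ler_pdivlMr ?mulr_gt0//; lra.
have [N3 hN3] := lim e e0 e1.
have [m mN gm] := infinitely_many_good T0 T1 hG ht K4 (n1 + N1 + N2 + N3)%N.
have [m1 mN1 mN2 mN3] : [/\ (n1 <= m)%N, (N1 <= m)%N, (N2 <= m)%N & (N3 <= m)%N].
  by move: mN; clear; split; lia.
pose en n := nm (G n 0).
have step n : (m <= n)%N -> t n.+1 <= K ^+ n * en n ->
    t n.+2 <= K ^+ n.+1 * en n.+1 /\ c / 4 * en n <= en n.+1.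
  move=> mn gn.
  have [a0 gD hc' _] := hn1 n (leq_trans m1 mn).
  have [al [be [ab hab]]] := hN2 n (leq_trans mN2 mn).
  have hN := hN1 n (leq_trans mN1 mn).
  have Kn1 : 1 <= K ^+ n by rewrite exprn_ege1.
  have en0 : 0 < en n.
    by have := lt_le_trans (t0 n.+1) gn; rewrite pmulr_rgt0// exprn_gt0.
  (* The change of pair turning al F_n + be F_(n+1) into be G_n + ga F_n. *)
  pose ga := al + be * l.
  have abg : 0 < nm be + nm ga.
    rewrite lt_neqAle addr_ge0 ?nm_ge0// andbT eq_sym paddr_eq0 ?nm_ge0// !nm_eq0.
    apply/negP => /andP[/eqP b0 /eqP g0].
    move: g0; rewrite /ga b0 mul0r addr0 => al0.
    by move: ab; rewrite al0 b0 nm0 addr0 ltxx.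
  have tn : t n <= 2 * K ^+ n * en n.
    have := chain_norm_leD T0 T1 hG ht n; rewrite -/(en n).
    have : en n <= K ^+ n * en n by rewrite ler_peMl// ltW.
    by move: gn; clear; lra.
  have sn : s n <= 2 * K ^+ n * nm (F n 0).
    apply: le_trans (good_norm T0 T1 hF hs D1 gD) _.
    by rewrite ler_wpM2r ?nm_ge0// ler_pM2l// lerXn2r ?nnegrE ?(ltW K0)// (le_trans ler01).
  pose eta := d ^+ n * (2 * K ^+ n).
  have Kn0 : 0 <= K ^+ n := le_trans ler01 Kn1.
  have eta0 : 0 <= eta by rewrite mulr_ge0 ?exprn_ge0 ?(ltW d0)// mulr_ge0.
  pose M := 2 * K ^+ n * (nm be * en n + nm ga * nm (F n 0)).
  have [v0 v1] : nm (al * F n 0 + be * F n.+1 0) <= d ^+ n * M /\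
      nm (al * F n.+1 0 + be * F n.+2 0) <= d ^+ n * M.
    apply: hab => z zT.
    have -> : al * F n z + be * F n.+1 z = be * G n z + ga * F n z by rewrite /G /ga; ring.
    apply: le_trans (nmD _ _) _; rewrite !nmM /M mulrDr !(mulrCA (2 * K ^+ n)).
    by apply: lerD; rewrite ler_wpM2l ?nm_ge0//;
      [apply: le_trans tn; exact: (ht n).1|apply: le_trans sn; exact: (hs n).1].
  have grow : c / 4 * en n <= en n.+1.
    apply: (@coefficient_growth _ (G n 0) (G n.+1 0) (F n 0) (F n.+1 0) be ga eta c) => //.
    - have -> : eta * (6 + 12 / c) = 2 * (6 + 12 / c) * (d ^+ n * K ^+ n) by rewrite /eta; ring.
      apply: le_trans hN _; rewrite exprn_ile1 ?(ltW hf)//.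
      by clear; lra.
    - rewrite (_ : be * G n 0 + ga * F n 0 = al * F n 0 + be * F n.+1 0); last by rewrite /G /ga; ring.
      by rewrite /eta -mulrA.
    - rewrite (_ : be * G n.+1 0 + ga * F n.+1 0 = al * F n.+1 0 + be * F n.+2 0);
        last by rewrite /G /ga; ring.
      by rewrite /eta -mulrA.
  split => //.
  apply: le_trans (chain_norm_succ T0 T1 hG ht n.+1) _; rewrite -/(en n.+1) ler_pdivrMr//.
  have h2 := chain_norm_coef T0 ht n.+1; rewrite -/(en n.+1) in h2.
  have : 8 <= K * (T * c) by move: K8; rewrite ler_pdivrMr// mulr_gt0.
  move=> K8'.
  have KT : 0 < K * T by rewrite mulr_gt0.
  have h3 : K * T * (c / 4 * en n) <= K * T * en n.+1 by rewrite ler_pM2l.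
  have h4 : 8 * en n <= K * (T * c) * en n by rewrite ler_wpM2r// ltW.
  have h5 : K ^+ n * (2 * en n) <= K ^+ n * (K * T * en n.+1) by rewrite ler_wpM2l//; move: h3 h4; clear; lra.
  by rewrite exprS; move: h2 h5 gn; clear; lra.
have all_ j : t (m + j).+1 <= K ^+ (m + j) * en (m + j)%N /\ (c / 4) ^+ j * en m <= en (m + j)%N.
  elim: j => [|j [IH1 IH2]]; first by rewrite addn0 mul1r.
  have [s1 s2] := step (m + j)%N (leq_addr _ _) IH1.
  rewrite addnS; split => //; apply: le_trans s2.
  by rewrite exprS -[leLHS]mulrA ler_pM2l ?divr_gt0.
have aup j : nm (F (m + j)%N 0) <= B ^+ j * nm (F m 0).
  elim: j => [|j IH]; first by rewrite addn0 mul1r.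
  have [_ _ _ h] := hn1 (m + j)%N (leq_trans m1 (leq_addr _ _)).
  by rewrite addnS; apply: le_trans h _; rewrite exprS -[leRHS]mulrA ler_pM2l.
have em : 0 < en m.
  by have := lt_le_trans (t0 m.+1) gm; rewrite pmulr_rgt0// exprn_gt0.
have two1 : 1 < 2 :> R by clear; lra.
have [j hj] := expr_unbounded (2 * B * nm (F m 0) / en m) two1.
have [_ lo] := all_ j.
have hi := hN3 (m + j)%N (leq_trans mN3 (leq_addr _ _)).
have am0 := nm_ge0 (F m 0).
have c80 : 0 < c / 8 by rewrite divr_gt0.
have c8 : 0 < (c / 8) ^+ j by rewrite exprn_gt0.
have hi2 : en (m + j)%N <= 2 * B * nm (F m 0) * (c / 8) ^+ j.
  apply: le_trans hi _.
  apply: le_trans (_ : 2 * B * e ^+ j * (B ^+ j * nm (F m 0)) <= _).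
    have tB : 0 <= 2 * B by rewrite mulr_ge0// ltW.
    have le1 : e <= 1 by move: e1; clear; lra.
    apply: ler_pM; [|exact: nm_ge0| |exact: aup].
      by apply: mulr_ge0 => //; apply: exprn_ge0; exact: ltW.
    by apply: ler_wpM2l => //; apply: ler_wiXn2l; rewrite ?leq_addl ?(ltW e0).
  have -> : 2 * B * e ^+ j * (B ^+ j * nm (F m 0)) = 2 * B * nm (F m 0) * (B * e) ^+ j.
    by rewrite exprMn; ring.
  rewrite ler_wpM2l//; first by rewrite mulr_ge0// mulr_ge0// ltW.
  rewrite lerXn2r ?nnegrE//; first by rewrite mulr_ge0// ltW.
  exact: ltW.
have : (c / 8) ^+ j * (2 ^+ j * en m) <= (c / 8) ^+ j * (2 * B * nm (F m 0)).
  rewrite mulrA -exprMn (_ : c / 8 * 2 = c / 4); last by field.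
  by apply: le_trans lo _; rewrite mulrC.
rewrite ler_pM2l// => h; move: hj; rewrite ltr_pdivrMr//; move: h; clear; lra.
Qed.

Theorem rational_of_small_combination (F : nat -> C -> C) (T : R) : 0 < T -> T < 1 ->
  taylor_chain F -> small_combination F T ->
  (exists p : {poly C}, forall z, nm z < 1 -> F 0%N z = p.[z]) \/
  (exists2 l, l != 0 & exists p : {poly C}, forall z, nm z < 1 -> F 0%N z * (1 - l * z) = p.[z]).
Proof.
move=> T0 T1 hF hsc; have [s hs] := chain_norm_exists T0 T1 hF.
have [[n sn]|sn0] := pselect (exists n, s n = 0).
  by left; exact: (chain_poly_of_zero_norm T0 hF hs sn).
right; have s0 n : 0 < s n.
  rewrite lt_neqAle (chain_norm_ge0 T0 hs) andbT eq_sym; apply/negP => /eqP h.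
  by apply: sn0; exists n.
have [l l0 [p pE]] := shifted_chain_poly T0 T1 hF hs hsc s0.
exists l => //; exists ((F 0%N 0)%:P + 'X * p) => z z1.
rewrite hornerD hornerC hornerM hornerX -pE// {1}(hF.2 0%N z).
have := hF.2 0%N z; move: (F 0%N z) => y ->; ring.
Qed.

(** The supremum may be infinite or unattained; but if no count reached A n, then A n would bound
    all counts. *)
Lemma many_zeros_of_NK1 (f : C -> C) (r : R) :
  (fun n : nat => (NK1 f r n * ((n%:R : R)^-1)%:E)%E) @ \oo --> +oo%E -> many_zeros f r.
Proof.
(* [A] + 1 leaves a strict gap above the bound A n / n = [A]; n is then taken positive so that n
   cancels. *)
move=> /cvgeyPge h A; have [N _ hN] := h (A%:R + 1).
exists N.+1 => n Nn; have n0 : (0 < n)%N by apply: leq_trans Nn.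
have nR : 0 < n%:R :> R by rewrite ltr0n.
have := hN n (ltnW Nn) => /= hn; apply: contrapT => hno.
have ub : (NK1 f r n <= ((A * n)%:R)%:E)%E.
  apply: ge_ereal_sup => _ [k [P [Q [PQ hz]]] <-].
  rewrite lee_fin ler_nat leqNgt; apply/negP => Ak; apply: hno.
  by exists P, Q, k; split => //; exact: ltnW.
have : ((A%:R + 1)%:E <= ((A * n)%:R)%:E * ((n%:R : R)^-1)%:E)%E.
  by apply: le_trans hn _; apply: lee_wpmul2r.
rewrite -EFinM lee_fin natrM mulfK ?gt_eqF//; lra.
Qed.

End Rationality.

Theorem theorem1p2 (R : realType) (f : R[i] -> R[i]) (r : R) :
  holo_disk f -> 0 < r -> r < 1 ->
  ((fun n : nat => (NK1 f r n * ((n%:R : R)^-1)%:E)%E) @ \oo --> +oo%E) ->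
  (exists F : R[i] -> R[i], entire F /\ forall z : R[i], `|z| < 1 -> F z = f z)
  \/
  (exists P Q : {poly R[i]},
     [/\ size Q = 2%N, ~~ (Q %| P) &
         forall z : R[i], `|z| < 1 -> Q.[z] != 0 -> f z = P.[z] / Q.[z]]).
Proof.
move=> fd r0 r1 /many_zeros_of_NK1 hz.
have lt1 (z : R[i]) : (`|z| < 1) = (nm z < 1) by rewrite normr_nm -(rmorph1 (real_complex R)) ltcR.
have fd' : holo f by move=> z z1; apply: fd; rewrite lt1.
have [F hF F0] := taylor_chain_exists fd'.
have [rT T1] : r < (r + 1) / 2 /\ (r + 1) / 2 < 1 by split; lra.
have T0 : 0 < (r + 1) / 2 by lra.
rewrite -F0 in hz; have hsc := many_zeros_small_combination hF r0 rT T1 hz.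
have [] := rational_of_small_combination T0 T1 hF hsc; rewrite F0.
  move=> [p pE]; left; exists (horner p); split; first exact: cdiff_horner.
  by move=> z; rewrite lt1 => /pE ->.
move=> [l l0 [p pE]].
pose Q : {poly R[i]} := 1 - l *: 'X.
have QE z : Q.[z] = 1 - l * z by rewrite /Q hornerD hornerN hornerZ hornerX hornerC.
have sQ : size Q = 2%N.
  by rewrite /Q addrC size_polyDl size_polyN size_scale// size_polyX// size_poly1.
(* If Q divides p, the quotient polynomial extends [f], which is the entire alternative; agreement
   at the zero of Q follows by continuity. *)
have [dv|ndv] := boolP (Q %| p); last first.
  right; exists p, Q; split => // z; rewrite lt1 => z1; rewrite QE => Qz.
  by rewrite -pE// mulfK.
left; exists (horner (p %/ Q)); split; first exact: cdiff_horner.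
have pQ : p = p %/ Q * Q by rewrite divpK.
have off z : nm z < 1 -> Q.[z] != 0 -> (p %/ Q).[z] = f z.
  move=> z1 Qz; apply: (mulIf Qz); rewrite -hornerM -pQ -pE// QE.
  by [].
move=> z; rewrite lt1 => z1; have [Qz|] := eqVneq Q.[z] 0; last exact: off.
apply: ccont_eq_off.
- exact/cdiff_ccont/cdiff_horner.
- exact/cdiff_ccont/fd'.
exists (1 - nm z); first by rewrite subr_gt0.
move=> w wz zw; apply: off; first by have := nm_triB2 w z; lra.
rewrite QE; apply: contra zw => /eqP Qw; move: Qz; rewrite QE => Qz.
have : l * (w - z) = 0 by transitivity ((1 - l * z) - (1 - l * w)); [ring|rewrite Qz Qw subrr].
by move/eqP; rewrite mulf_eq0 (negbTE l0) subr_eq0.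
Qed.
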